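(* Let $m>1$ and $r$ be integers with $\gcd(r,m)=1$ and $0<r<m/2$. Let $s_{(r,m)}(n)$ denote the number of mixed congruence stacks of size $n$, i.e. the number of sequences of positive integers $a_1,\dots,a_R, c, b_S,\dots,b_1$ (with $R,S\ge 0$) such that \[ n=\sum_{i=1}^R a_i + c+\sum_{j=1}^S b_j,\qquad a_1\le a_2\le\cdots\le a_R\le c> b_S\ge\cdots\ge b_2\ge b_1, \] and $a_i\equiv r \pmod m$, $c\equiv r\pmod m$, $b_j\equiv -r\pmod m$ for all $i,j$. Then, as $n\to\infty$, \[ s_{(r,m)}(n)\sim \frac{\csc\left(\frac{\pi r}{m}\right)}{2^3\,3^{1/4}\,m^{1/4}\,n^{3/4}}\, e^{2\pi\sqrt{\frac{n}{3m}}}. \]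
   Context: Equivalently, $\sum_{n\ge1}s_{(r,m)}(n)q^n=\sum_{k\ge0}\frac{q^{km+r}}{(q^r;q^m)_{k+1}(q^{m-r};q^m)_k}$, where $(a;q)_n=\prod_{i=0}^{n-1}(1-aq^i)$. *)

(* Defs.v *)
From mathcomp Require Import all_boot all_order all_algebra finmap.
From mathcomp Require Import all_classical all_reals all_analysis.
Import Order.TTheory GRing.Theory Num.Theory.
Import numFieldNormedType.Exports.

Set Implicit Arguments.
Unset Strict Implicit.
Unset Printing Implicit Defensive.

Local Open Scope classical_set_scope.
Local Open Scope nat_scope.

(* The stack a_1, ..., a_R, c, b_S, ..., b_1 is encoded as the triple (a, c, b)
   with a = [:: a_1; ...; a_R] and b = [:: b_1; ...; b_S], so that b is read
   from right to left in the displayed sequence a ++ c :: rev b. Since c is the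
   last occurrence of the maximum of that sequence, counting triples is the
   same as counting sequences. *)
Definition mixed_congruence_stack (r m n : nat)
    (s : seq nat * nat * seq nat) : bool :=
  let: (a, c, b) := s in
  [&& all (ltn 0) a, 0 < c & all (ltn 0) b] &&
  [&& sorted leq (rcons a c), sorted leq b & all (fun y => y < c) b] &&
  [&& all (fun x => (x%:Z == r%:Z %[mod m%:Z])%Z) a,
      (c%:Z == r%:Z %[mod m%:Z])%Z
    & all (fun y => (y%:Z == (- r%:Z)%R %[mod m%:Z])%Z) b] &&
  (sumn a + c + sumn b == n).

Definition mixed_congruence_stacks (r m n : nat) :
    set (seq nat * nat * seq nat) :=
  [set s | mixed_congruence_stack r m n s].

Lemma pos_seq_bounded (n : nat) (a : seq nat) :
  all (ltn 0) a -> sumn a <= n ->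
  exists t : {bseq n of 'I_n.+1}, a = map val t.
Proof.
move=> a0 an.
have sza : size a <= n.
  apply: leq_trans an; elim: a a0 => //= x a ih /andP[x0 /ih].
  by move=> ?; rewrite -add1n leq_add.
have alt : all (fun x => x < n.+1) a.
  apply/allP => x xa; rewrite ltnS; apply: leq_trans an.
  elim: a xa {a0 sza} => //= y a ih; rewrite inE => /orP[/eqP->|/ih xa].
    exact: leq_addr.
  by apply: leq_trans xa _; exact: leq_addl.
have st : size (map (@inord n) a) <= n by rewrite size_map.
exists (Bseq st) => /=; rewrite -map_comp.
apply/esym/map_id_in => x /(allP alt) xn /=; exact: inordK.
Qed.

Lemma finite_mixed_congruence_stacks (r m n : nat) :
  finite_set (mixed_congruence_stacks r m n).
Proof.
pose T := ({bseq n of 'I_n.+1} * 'I_n.+1 * {bseq n of 'I_n.+1})%type.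
pose f (t : T) : seq nat * nat * seq nat :=
  (map val t.1.1, val t.1.2, map val t.2).
apply: (@sub_finite_set _ _ (f @` setT)); last by apply: finite_image; exact: finite_finset.
move=> [[a c] b] /= /andP[/andP[/andP[/and3P[a0 _ b0] _] _] /eqP E].
have an : sumn a <= n by rewrite -E -addnA leq_addr.
have cn : c < n.+1 by rewrite ltnS -E addnAC leq_addl.
have bn : sumn b <= n by rewrite -E leq_addl.
have [ta ->] := pos_seq_bounded a0 an.
have [tb ->] := pos_seq_bounded b0 bn.
by exists (ta, Ordinal cn, tb).
Qed.

(* [fset_set] is the empty set on infinite sets; by the lemma above this case
   does not occur, even for n = 0. *)
Definition num_mixed_congruence_stacks (r m n : nat) : nat :=
  #|` fset_set (mixed_congruence_stacks r m n)|.

Definition csc {R : realType} (x : R) : R := ((sin x)^-1)%R.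

(* Main.v *)
Require Import Defs.
From mathcomp Require Import all_boot all_order all_algebra.
From mathcomp Require Import all_classical all_reals all_analysis.
From mathcomp Require Import measurable_realfun complex ring lra zify.
Import Order.TTheory GRing.Theory Num.Theory.
Import numFieldNormedType.Exports.
Import ComplexField.Normc.
Local Open Scope classical_set_scope.
Local Open Scope ring_scope.

(* The circle method at [q = exp (- sigma)], [sigma = sqrt (A / n)],
   [A = pi ^ 2 / (3 m)]. Let [x_0 < x_1 < ...] be the integers congruent to [r]
   or [- r] modulo [m]. A stack with peak [x_j], [j] even, is [x_j] together with
   a partition into the parts [x_0, ..., x_j], so the generating function is
   the sum over even [j] of [q ^ x_j / \prod_(i <= j) (1 - q ^ x_i)]. Multiplied
   by [\prod_i (1 - |q| ^ x_i)], the sum over all [j] telescopes to essentially the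
   characteristic function of a sum of independent geometric variables; the
   alternating sum over [j] tends to 0 because consecutive terms nearly agree,
   hence a factor 1/2. For real [q] the asymptotics of the product needs no
   modular forms: its ratio to [\prod_j (1 - q ^ (m j)) ^ 2] tends to Euler's sine
   product, and the case [r / m = 1/2] relates [\prod_j (1 - q ^ j)] at [sigma] and
   [sigma / 2], which determines it. Convexity then gives mean and variance, the
   characteristic function is close to a Gaussian, and dominated convergence
   applies. *)

(** * Complex numbers *)

(** After multiplication by the product of the 1 - |q| ^ x_i the x_i carry independent geometric
    multiplicities and each term of the series belongs to one possible largest part, so the moduli
    of all terms add up to at most 1 whatever the truncation. That product is asymptotic to 2 sin
    (pi r / m) exp (- A / sigma): this yields the cosecant and half of the exponent, and |q| ^ (- n)
    yields the other half. Two obstacles shape the rest. Near an m-th root of unity the parts of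
    moderate size in one residue class have almost the same phase, so decay away from the positive
    axis cannot come from equidistribution; coprimality of r and m keeps that common phase away from
    1. And the asymptotics of the product is a bare limit, while the saddle point needs its
    logarithmic derivative up to o(sigma ^ (- 3 / 2)), the scale of the standard deviation. A limit
    cannot be differentiated, but the chords of a convex function enclose its derivative, and over a
    chord of length d sigma ^ (3 / 2) an error d ^ 2 in the values costs only d sigma ^ (- 3 / 2) in
    the slope. *)

Notation cRe := complex.Re.
Notation cIm := complex.Im.

Section Complex.
Context {R : realType}.
Implicit Types (z w : R[i]) (t a b : R).

Definition cis t : R[i] := Complex (cos t) (sin t).

Lemma cisD a b : cis (a + b) = cis a * cis b.
Proof.
rewrite /cis cosD sinD; apply/eqP; rewrite eq_complex /= eqxx/=.
by apply/eqP; ring.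
Qed.

Lemma cis0 : cis 0 = 1.
Proof. by rewrite /cis cos0 sin0. Qed.

Lemma normc_cis t : normc (cis t) = 1.
Proof. by rewrite /= cos2Dsin2 sqrtr1. Qed.

Lemma normc_ge0 z : 0 <= normc z.
Proof. by case: z => u v; exact: sqrtr_ge0. Qed.

Lemma normcD z w : normc (z + w) <= normc z + normc w.
Proof. exact: (@le_normcD R z w). Qed.

Lemma normc_opp z : normc (- z) = normc z.
Proof. exact: (@normcN R z). Qed.

Lemma normcB z w : normc (z - w) <= normc z + normc w.
Proof. by rewrite -(normc_opp w) normcD. Qed.

Lemma normc_distC z w : normc (z - w) = normc (w - z).
Proof. by rewrite -normc_opp opprB. Qed.

Lemma normc_sum I (s : seq I) (P : pred I) (F : I -> R[i]) :
  normc (\sum_(i <- s | P i) F i) <= \sum_(i <- s | P i) normc (F i).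
Proof.
elim/big_ind2 : _ => //; first by rewrite normc0.
by move=> z u w v zu wv; apply: le_trans (normcD _ _) _; rewrite lerD.
Qed.

Lemma normc_prod I (s : seq I) (P : pred I) (F : I -> R[i]) :
  normc (\prod_(i <- s | P i) F i) = \prod_(i <- s | P i) normc (F i).
Proof. by apply: (big_morph _ (@normcM R)); rewrite normc1. Qed.

Lemma normc_real t : normc (real_complex R t) = `|t|.
Proof. by rewrite /= expr0n/= addr0 sqrtr_sqr. Qed.

Lemma normc_inv z : normc z^-1 = (normc z)^-1.
Proof. exact: (@normcV R z). Qed.

Lemma normc_sqr z : normc z ^+ 2 = cRe z ^+ 2 + cIm z ^+ 2.
Proof. by case: z => u v /=; rewrite sqr_sqrtr// addr_ge0 ?sqr_ge0. Qed.

Lemma abs_Re_le z : `|cRe z| <= normc z.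
Proof.
by rewrite -(@ler_pXn2r _ 2)// ?nnegrE ?normc_ge0// normc_sqr real_normK ?num_real// lerDl sqr_ge0.
Qed.

Lemma normc_le_abs z : normc z <= `|cRe z| + `|cIm z|.
Proof.
rewrite -(@ler_pXn2r _ 2)// ?nnegrE ?normc_ge0 ?addr_ge0// normc_sqr.
rewrite sqrrD !real_normK ?num_real//.
have := mulr_ge0 (normr_ge0 (cRe z)) (normr_ge0 (cIm z)); lra.
Qed.

Lemma ReD z w : cRe (z + w) = cRe z + cRe w.
Proof. by case: z w => [a b] [c d]. Qed.

Lemma ReB z w : cRe (z - w) = cRe z - cRe w.
Proof. by case: z w => [a b] [c d]. Qed.

Lemma Re_sum I (s : seq I) (P : pred I) (F : I -> R[i]) :
  cRe (\sum_(i <- s | P i) F i) = \sum_(i <- s | P i) cRe (F i).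
Proof. exact: (big_morph _ ReD). Qed.

Lemma Re_realM t z : cRe (real_complex R t * z) = t * cRe z.
Proof. by case: z => a b /=; rewrite mul0r subr0. Qed.

(** Factors are exchanged one at a time; those already exchanged and those still to come have
    modulus at most 1 and drop out of the bound. *)
Lemma normc_prodB (n : nat) (z w : nat -> R[i]) :
  (forall i, (i < n)%N -> normc (z i) <= 1) ->
  (forall i, (i < n)%N -> normc (w i) <= 1) ->
  normc (\prod_(i < n) z i - \prod_(i < n) w i) <= \sum_(i < n) normc (z i - w i).
Proof.
elim: n => [|n ih] z1 w1; first by rewrite !big_ord0 subrr normc0.
rewrite !big_ord_recr/=.
set Z := \prod_(i < n) z i; set W := \prod_(i < n) w i.
have -> : Z * z n - W * w n = (Z - W) * z n + W * (z n - w n) by ring.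
apply: le_trans (normcD _ _) _; rewrite !normcM lerD//.
  apply: le_trans (ih _ _); last 2 first.
  - by move=> i /ltnW; exact: z1.
  - by move=> i /ltnW; exact: w1.
  by rewrite ler_piMr ?normc_ge0// z1.
rewrite ler_piMl ?normc_ge0// normc_prod.
by apply: prodr_ile1 => i _; rewrite normc_ge0/=; apply: w1; rewrite ltnS ltnW.
Qed.

Lemma normr_prodB (n : nat) (u v : nat -> R) :
  (forall i, (i < n)%N -> 0 <= u i <= 1) ->
  (forall i, (i < n)%N -> 0 <= v i <= 1) ->
  `|\prod_(i < n) u i - \prod_(i < n) v i| <= \sum_(i < n) `|u i - v i|.
Proof.
move=> u1 v1.
elim: n u1 v1 => [|n ih] u1 v1; first by rewrite !big_ord0 subrr normr0.
rewrite !big_ord_recr/=.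
set Z := \prod_(i < n) u i; set W := \prod_(i < n) v i.
have -> : Z * u n - W * v n = (Z - W) * u n + W * (u n - v n) by ring.
have /andP[un0 un1] := u1 n (ltnSn n).
apply: le_trans (ler_normD _ _) _; rewrite !normrM lerD//.
  apply: le_trans (ih _ _); last 2 first.
  - by move=> i /ltnW; exact: u1.
  - by move=> i /ltnW; exact: v1.
  by rewrite ler_piMr// ger0_norm.
rewrite ler_piMl// normr_prod; apply: prodr_ile1 => i _; rewrite normr_ge0/=.
by have /andP[v0 v1'] := v1 i (ltnW (ltn_ord i)); rewrite ger0_norm.
Qed.

(** Componentwise, because only real parts of complex functions are ever integrated. *)
Definition ccontinuous (f : R -> R[i]) :=
  continuous (fun x => cRe (f x)) /\ continuous (fun x => cIm (f x)).

Lemma ccontinuous_cst z : ccontinuous (fun=> z).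
Proof. by split => x; exact: cvg_cst. Qed.

Lemma ccontinuousM f g : ccontinuous f -> ccontinuous g ->
  ccontinuous (fun x => f x * g x).
Proof.
move=> [fr fi] [gr gi]; split.
  rewrite (_ : (fun x => cRe (f x * g x)) =
    (fun x => cRe (f x) * cRe (g x) - cIm (f x) * cIm (g x))); last first.
    by apply/funext => x; case: (f x) (g x) => [a b] [c d].
  by move=> x; apply: cvgB; apply: cvgM; [exact: fr|exact: gr|exact: fi|exact: gi].
rewrite (_ : (fun x => cIm (f x * g x)) =
    (fun x => cRe (f x) * cIm (g x) + cIm (f x) * cRe (g x))); last first.
  by apply/funext => x; case: (f x) (g x) => [a b] [c d].
by move=> x; apply: cvgD; apply: cvgM; [exact: fr|exact: gi|exact: fi|exact: gr].
Qed.

Lemma ccontinuousD f g : ccontinuous f -> ccontinuous g ->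
  ccontinuous (fun x => f x + g x).
Proof.
move=> [fr fi] [gr gi]; split.
  rewrite (_ : (fun x => cRe (f x + g x)) = (fun x => cRe (f x) + cRe (g x))); last first.
    by apply/funext => x; case: (f x) (g x) => [a b] [c d].
  by move=> x; apply: cvgD; [exact: fr|exact: gr].
rewrite (_ : (fun x => cIm (f x + g x)) = (fun x => cIm (f x) + cIm (g x))); last first.
  by apply/funext => x; case: (f x) (g x) => [a b] [c d].
by move=> x; apply: cvgD; [exact: fi|exact: gi].
Qed.

Lemma ccontinuousV f : (forall x, f x != 0) -> ccontinuous f ->
  ccontinuous (fun x => (f x)^-1).
Proof.
move=> f0 [fr fi].
have n0 x : cRe (f x) ^+ 2 + cIm (f x) ^+ 2 != 0.
  by rewrite -normc_sqr expf_eq0/=; apply: contra (f0 x) => /eqP/eq0_normc ->.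
have nc : continuous (fun x => (cRe (f x) ^+ 2 + cIm (f x) ^+ 2)^-1).
  move=> x; apply: cvgV => //; rewrite /=; apply: cvgD; rewrite expr2.
  by under eq_fun do rewrite expr2; apply: cvgM; exact: fr.
  by under eq_fun do rewrite expr2; apply: cvgM; exact: fi.
split.
  rewrite (_ : (fun x => cRe (f x)^-1) =
     (fun x => cRe (f x) * (cRe (f x) ^+ 2 + cIm (f x) ^+ 2)^-1)); last first.
    by apply/funext => x; case: (f x).
  by move=> x; apply: cvgM; [exact: fr|exact: nc].
rewrite (_ : (fun x => cIm (f x)^-1) =
     (fun x => - (cIm (f x) * (cRe (f x) ^+ 2 + cIm (f x) ^+ 2)^-1))); last first.
  by apply/funext => x; case: (f x).
by move=> x; apply: cvgN; apply: cvgM; [exact: fi|exact: nc].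
Qed.

Lemma ccontinuous_cis a : ccontinuous (fun x => cis (a * x)).
Proof.
have h : continuous (fun x : R => a * x).
  by move=> x; apply: cvgM; [exact: cvg_cst|exact: cvg_id].
split => x /=.
  by apply: (continuous_comp (h x)); exact: continuous_cos.
by apply: (continuous_comp (h x)); exact: continuous_sin.
Qed.

Lemma ccontinuous_prod (n : nat) (f : nat -> R -> R[i]) :
  (forall i, ccontinuous (f i)) -> ccontinuous (fun x => \prod_(i < n) f i x).
Proof.
move=> fc; elim: n => [|n ih].
  by under [X in ccontinuous X]eq_fun do rewrite big_ord0; exact: ccontinuous_cst.
under [X in ccontinuous X]eq_fun do rewrite big_ord_recr/=.
exact: ccontinuousM.
Qed.

End Complex.

(** * Trigonometric estimates *)

Section RealTrig.
Context {R : realType}.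
Implicit Types (a b x t u : R) (n : nat).

Lemma le_of_derive_ge0 (f f' : R -> R) a b :
  (forall x, a <= x <= b -> is_derive x (1 : R) f (f' x)) ->
  (forall x, a <= x <= b -> 0 <= f' x) -> a <= b -> f a <= f b.
Proof.
move=> df f'0 ab; apply: (@ger0_derive1_le_cc _ f a b) => //.
- by move=> x; rewrite in_itv/= => /andP[/ltW ax /ltW xb]; case: (df x); rewrite ?ax.
- move=> x; rewrite in_itv/= => /andP[/ltW ax /ltW xb].
  have := df x; rewrite ax xb => /(_ isT) h.
  by rewrite derive1E derive_val f'0// ax.
- apply: derivable_within_continuous => x; rewrite in_itv/= => /andP[ax xb].
  by case: (df x); rewrite ?ax.
- by rewrite in_itv/= lexx ab.
- by rewrite in_itv/= lexx ab.
Qed.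

Lemma sin_le_id x : 0 <= x -> sin x <= x.
Proof.
move=> x0; rewrite -subr_ge0 -[leLHS](_ : 0 - sin 0 = _); last by rewrite sin0 subrr.
apply: (@le_of_derive_ge0 (fun x => x - sin x) (fun x => 1 - cos x)) => //.
Qed.

Lemma abs_sin_le x : `|sin x| <= `|x|.
Proof.
wlog x0 : x / 0 <= x => [H|].
  have [/H//|x0] := leP 0 x.
  by rewrite -normrN -sinN -[leRHS]normrN H// oppr_ge0 ltW.
rewrite [leRHS]ger0_norm// ler_norml sin_le_id// andbT.
have [x1|x1] := leP 1 x; first by apply: le_trans (sin_geN1 x); rewrite lerN2.
rewrite (le_trans (y := 0)) ?oppr_le0// sin_ge0_pi// x0/=.
by have := @pi_ge2 R; lra.
Qed.

Lemma mul_cos_le_sin x : 0 <= x <= pi -> x * cos x <= sin x.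
Proof.
move=> /andP[x0 xp].
rewrite -subr_ge0 -[leLHS](_ : sin 0 - 0 * cos 0 = _); last by rewrite sin0 mul0r subrr.
apply: (@le_of_derive_ge0 (fun x => sin x - x * cos x) (fun x => x * sin x)) => //.
  move=> y _; apply: is_derive_eq.
  by rewrite -[_ *: _]/(_ * _) -[_ *: _]/(_ * _); lra.
by move=> y /andP[y0 yx]; rewrite mulr_ge0// sin_ge0_pi// y0 (le_trans yx).
Qed.

Lemma sin_half x : sin x = 2 * (cos (x / 2) * sin (x / 2)).
Proof.
by rewrite {1}(_ : x = (x / 2) *+ 2) ?sin_mulr2n ?mulr_natl//; lra.
Qed.

Lemma subr1_cos x : 1 - cos x = 2 * sin (x / 2) ^+ 2.
Proof.
rewrite {1}(_ : x = (x / 2) *+ 2); last lra.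
by rewrite cos_mulr2n cos2sin2; lra.
Qed.

(** Doubling: sin x = 2 sin (x/2) cos (x/2) >= x cos (x/2) ^ 2 by [mul_cos_le_sin], and cos (x/2) ^
    2 >= 1/2 because cos x >= 0. *)
Lemma sin_ge_half x : 0 <= x <= pi / 2 -> x / 2 <= sin x.
Proof.
move=> /andP[x0 xp]; have p0 := @pi_gt0 R.
have c1 : 0 <= cos x by apply: cos_ge0_pihalf; lra.
have c2 : 0 <= cos (x / 2) by apply: cos_ge0_pihalf; lra.
have hx : 0 <= x / 2 <= pi by lra.
have h := mul_cos_le_sin (x / 2) hx.
have := subr1_cos x; rewrite sin2cos2 => e.
rewrite sin_half; have : x / 2 * cos (x / 2) ^+ 2 <= cos (x / 2) * sin (x / 2) by nra.
by have : 2^-1 <= cos (x / 2) ^+ 2 by [lra]; nra.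
Qed.

Lemma subr1_cos_le x : 1 - cos x <= x ^+ 2 / 2.
Proof.
rewrite subr1_cos -(real_normK (num_real (sin _))).
have := abs_sin_le (x / 2); rewrite normrM (@gtr0_norm _ 2^-1)// => h.
have : `|sin (x / 2)| ^+ 2 <= (`|x| / 2) ^+ 2 by rewrite lerXn2r// nnegrE.
have -> : (`|x| / 2) ^+ 2 = x ^+ 2 / 4 by rewrite -(real_normK (num_real x)); field.
lra.
Qed.

Lemma sin_taylor x : `|sin x - x| <= 2 * `|x| ^+ 3.
Proof.
wlog x0 : x / 0 <= x => [H|].
  have [/H//|x0] := leP 0 x.
  by have := H (- x); rewrite sinN -opprD !normrN; apply; rewrite oppr_ge0 ltW.
rewrite distrC ger0_norm ?subr_ge0 ?sin_le_id// ger0_norm//.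
have [x1|x1] := leP 1 x.
  have := sin_geN1 x; have : x <= x ^+ 3 by rewrite exprS ler_peMr// exprn_ege1.
  lra.
have p2 := @pi_ge2 R.
have := @mul_cos_le_sin x; rewrite x0 => /(_ _)/wrap[]; first lra.
by have := subr1_cos_le x; rewrite !exprS expr0; nra.
Qed.

Lemma cos_taylor x : `|cos x - (1 - x ^+ 2 / 2)| <= 2 * `|x| ^+ 3.
Proof.
have -> : cos x - (1 - x ^+ 2 / 2) = x ^+ 2 / 2 - (1 - cos x) by lra.
rewrite ger0_norm ?subr_ge0 ?subr1_cos_le//.
have [x1|x1] := leP 1 `|x|.
  have : `|x| ^+ 2 <= `|x| ^+ 3 by rewrite ler_weXn2l.
  by rewrite real_normK ?num_real//; have := cos_le1 x; have := sqr_ge0 x; lra.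
have := sin_taylor (x / 2); have := abs_sin_le (x / 2).
rewrite subr1_cos normrM (@gtr0_norm _ 2^-1)// => h1 h2.
have -> : x ^+ 2 / 2 - 2 * sin (x / 2) ^+ 2 =
  2 * ((x / 2 - sin (x / 2)) * (x / 2 + sin (x / 2))) by field.
apply: le_trans (ler_norm _) _; rewrite normrM (@gtr0_norm _ 2)// ler_pM2l// normrM.
rewrite distrC in h2.
have h3 : `|x / 2 + sin (x / 2)| <= `|x|.
  by apply: le_trans (ler_normD _ _) _; rewrite normrM (@gtr0_norm _ 2^-1)//; lra.
have : `|x / 2 - sin (x / 2)| * `|x / 2 + sin (x / 2)| <= 2 * (`|x| / 2) ^+ 3 * `|x|.
  exact: ler_pM.
have := normr_ge0 x; move: `|x| x1 => y y1 y0; rewrite !exprS expr0; nra.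
Qed.

(** Half of |1 - exp (i t)| ^ 2. It stands for the squared distance of t to the multiples of 2 pi:
    [cosgapD] is the triangle inequality for squares, [cosgap_muln] the scaling by an integer,
    [cosgap_ge] the comparison with t ^ 2. *)
Definition cosgap t := 1 - cos t.

Lemma cosgap_ge0 t : 0 <= cosgap t.
Proof. by rewrite subr_ge0 cos_le1. Qed.

Lemma cosgap_le2 t : cosgap t <= 2.
Proof. by rewrite /cosgap; have := cos_geN1 t; lra. Qed.

Lemma cosgapN t : cosgap (- t) = cosgap t.
Proof. by rewrite /cosgap cosN. Qed.

Lemma cosgapD a b : cosgap (a + b) <= 2 * (cosgap a + cosgap b).
Proof.
rewrite /cosgap !subr1_cos (_ : (a + b) / 2 = a / 2 + b / 2) ?sinD; last by field.
have := cos2Dsin2 (a / 2); have := cos2Dsin2 (b / 2).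
move: (cos _) (sin _) (cos _) (sin _) => ca sa cb sb hb ha.
have := sqr_ge0 (sa * cb - ca * sb).
have : (sa * cb) ^+ 2 <= sa ^+ 2 by have := sqr_ge0 (sa * sb); rewrite !exprMn; nra.
have : (ca * sb) ^+ 2 <= sb ^+ 2 by have := sqr_ge0 (sa * sb); rewrite !exprMn; nra.
rewrite sqrrB sqrrD; lra.
Qed.

Lemma cosgapB a b : cosgap (a - b) <= 2 * (cosgap a + cosgap b).
Proof. by rewrite -(cosgapN b) cosgapD. Qed.

Lemma abs_sin_muln n u : `|sin (n%:R * u)| <= n%:R * `|sin u|.
Proof.
elim: n => [|n ih]; first by rewrite !mul0r sin0 normr0.
rewrite -addn1 natrD !mulrDl !mul1r sinD; apply: le_trans (ler_normD _ _) _.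
rewrite !normrM lerD//.
  by apply: le_trans ih; rewrite ler_piMr// cos_max.
by rewrite ler_piMl// cos_max.
Qed.

Lemma cosgap_muln n t : cosgap (n%:R * t) <= n%:R ^+ 2 * cosgap t.
Proof.
rewrite /cosgap !subr1_cos [leRHS]mulrCA ler_pM2l// -(mulrA n%:R).
rewrite -(real_normK (num_real (sin _))) -(real_normK (num_real (sin (t / 2)))).
by rewrite -exprMn lerXn2r ?nnegrE ?abs_sin_muln// mulr_ge0.
Qed.

Lemma cosgap_ge t : `|t| <= pi -> t ^+ 2 / 8 <= cosgap t.
Proof.
move=> tp; rewrite /cosgap subr1_cos.
have -> : t ^+ 2 / 8 = 2 * (`|t| / 2 / 2) ^+ 2.
  by rewrite -(real_normK (num_real t)); field.
rewrite ler_pM2l//.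
have -> : sin (t / 2) ^+ 2 = sin (`|t| / 2) ^+ 2.
  have [t0|t0] := leP 0 t; first by rewrite ger0_norm.
  by rewrite ltr0_norm// mulNr sinN sqrrN.
have /sin_ge_half h : 0 <= `|t| / 2 <= pi / 2 by have := normr_ge0 t; lra.
by rewrite lerXn2r// nnegrE ?divr_ge0// (le_trans _ h)// !divr_ge0.
Qed.

(* telescoping [2 sin (d/2) cos(e + j d) = sin (e + (j+1/2) d) - sin (e + (j-1/2) d)] *)
Lemma sum_cos_arith (e d : R) L :
  `|sin (d / 2)| * `|\sum_(j < L) cos (e + j%:R * d)| <= 1.
Proof.
suff -> : `|sin (d / 2)| * `|\sum_(j < L) cos (e + j%:R * d)| =
  2^-1 * `|sin (e + L%:R * d - d / 2) - sin (e - d / 2)|.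
  have : `|sin (e + L%:R * d - d / 2) - sin (e - d / 2)| <= 1 + 1.
    by apply: le_trans (ler_normB _ _) _; rewrite lerD// sin_max.
  lra.
transitivity (`|2^-1 * (sin (e + L%:R * d - d / 2) - sin (e - d / 2))|); last first.
  by rewrite normrM gtr0_norm.
rewrite -normrM; congr `|_|.
elim: L => [|L ih]; first by rewrite big_ord0 mul0r addr0 subrr !mulr0.
rewrite big_ord_recr/= mulrDr ih (_ : L.+1%:R * d = L%:R * d + d); last first.
  by rewrite -addn1 natrD mulrDl mul1r.
rewrite addrA.
have -> : e + L%:R * d + d - d / 2 = (e + L%:R * d) + d / 2 by lra.
rewrite sinB [sin (_ + d / 2)]sinD; lra.
Qed.

End RealTrig.

(** * Phases along an arithmetic progression *)

Section ArithmeticProgression.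
Context {R : realType}.
Variables (r m : nat) (coprime_rm : coprime r m) (r_gt0 : (0 < r)%N) (m_gt0 : (0 < m)%N).

Lemma leq_double_trunc (L K : nat) : (0 < K <= L)%N -> (L <= 2 * (L %/ K * K))%N.
Proof.
move=> /andP[K0 KL]; have := divn_eq L K; have := ltn_pmod L K0.
have : (0 < L %/ K)%N by rewrite divn_gt0.
move: (L %/ K)%N (L %% K)%N => q e; nia.
Qed.

Lemma sum_ord_ge_const (F : nat -> R) (v : R) lo hi L :
  (forall j, 0 <= F j) -> (lo <= hi <= L)%N ->
  (forall j, (lo <= j < hi)%N -> v <= F j) -> (hi - lo)%:R * v <= \sum_(j < L) F j.
Proof.
move=> F0 /andP[lh hL] Fv; rewrite -(big_mkord xpredT F) (@big_cat_nat _ _ _ lo)//=; last first.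
  exact: leq_trans hL.
rewrite (@big_cat_nat _ _ _ hi lo L)//= -[leLHS]add0r lerD ?sumr_ge0//.
rewrite -[leLHS]addr0 lerD ?sumr_ge0// mulr_natl -sumr_const_nat.
exact: ler_sum_nat.
Qed.

(* The three cases are the distance of [m t / 2] to the multiples of [pi] being
   large (geometric sum), [t] itself being small, and [t] being close to a
   non-trivial [m]-th root of unity, which Bezout turns into [r t] being far
   from [0]. *)
Lemma sum_cosgap_lower : exists2 c : R, 0 < c & exists L0 : nat,
  forall (L : nat) (t : R), (L0 <= L)%N -> `|t| <= pi ->
  c * L%:R * Num.min 1 ((L%:R * t) ^+ 2) <=
  \sum_(j < L) cosgap ((r + m * j)%:R * t).
Proof.
have [a b ab _] := @egcdnP r m r_gt0.
rewrite (eqP (coprime_rm : gcdn r m == 1%N)) in ab.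
(* [K] is large enough for the last case, where Bezout gives t ^ 2 <= 8 (64 a ^ 2 + 16 b ^ 2) / K ^
   2 and this has to imply m |t| <= 1. *)
have [K Kr K0] : exists2 K : nat,
    K%:R = 32 * (a%:R + b%:R) * m%:R + 1 :> R & (0 < K)%N.
  by exists (32 * (a + b) * m).+1; rewrite // -addn1 natrD !natrM natrD.
have K1 : 1 <= K%:R :> R by rewrite ler1n.
have m1 : 1 <= m%:R :> R by rewrite ler1n.
have K3 : 1 <= K%:R ^+ 3 :> R by exact: exprn_ege1.
(* One constant for all cases: the case of large cosgap (r t) needs 4 / K ^ 3, that of small t needs
   1 / (8 * 32 ^ 3). *)
exists ((K%:R ^+ 3)^-1 / 8 / 32 / 32 / 32); first by rewrite !divr_gt0 ?invr_gt0//; lra.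
exists (K + 8 * r + 32)%N => L t LL tp.
have [KL rL L32] : [/\ (K <= L)%N, (8 * r <= L)%N & (32 <= L)%N].
  by clear -LL; split; lia.
have L1 : 1 <= L%:R :> R by rewrite ler1n; apply: leq_trans L32.
set S := \sum_(j < L) _.
have min1 : Num.min 1 ((L%:R * t) ^+ 2) <= 1 by rewrite ge_min lexx.
have min0 : 0 <= Num.min 1 ((L%:R * t) ^+ 2) by rewrite le_min ler01 sqr_ge0.
have k1 : (K%:R ^+ 3)^-1 <= 1 :> R by rewrite invf_le1//; lra.
have k0 : 0 < (K%:R ^+ 3)^-1 :> R by rewrite invr_gt0; lra.
set c := (K%:R ^+ 3)^-1 / 8 / 32 / 32 / 32.
have cK : c <= 4 / K%:R ^+ 3 by rewrite /c; lra.
have c1 : c <= 8^-1 / 32 / 32 / 32 by rewrite /c; lra.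
have c0 : 0 <= c by rewrite /c; lra.
move: c cK c1 c0 => c cK c1 c0 {k0 k1}.
have [sge|slt] := leP (2 / L%:R) `|sin (m%:R * t / 2)|.
  have -> : S = L%:R - \sum_(j < L) cos (r%:R * t + j%:R * (m%:R * t)).
    rewrite /S /cosgap sumrB sumr_const card_ord; congr (_ - _).
    apply: eq_bigr => j _; congr cos.
    by rewrite natrD natrM; ring.
  have := sum_cos_arith (r%:R * t) (m%:R * t) L.
  set C := \sum_(j < L) _ => hC.
  have : `|C| * (2 / L%:R) <= 1.
    by apply: le_trans hC; rewrite mulrC ler_wpM2r.
  rewrite mulrA ler_pdivrMr ?mul1r; try lra.
  have := ler_norm C => C1 C2.
  apply: (@le_trans _ _ (c * L%:R)); first by rewrite ler_piMr// mulr_ge0//; lra.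
  nra.
have ym : cosgap (m%:R * t) <= 8 / L%:R ^+ 2.
  rewrite /cosgap subr1_cos -(real_normK (num_real (sin _))).
  have : `|sin (m%:R * t / 2)| ^+ 2 <= (2 / L%:R) ^+ 2.
    by rewrite lerXn2r ?nnegrE ?divr_ge0//; exact: ltW.
  by rewrite exprMn exprVn; lra.
(* If r t is far from 2 pi Z, so is (r + m j) t for every j < L / K: the increment j m t has
   [cosgap] at most 8 / K ^ 2, and [cosgapB] leaves 32 / 2 - 8 = 8 over K ^ 2. *)
have [yr|yr] := leP (32 / K%:R ^+ 2) (cosgap (r%:R * t)).
  have hj j : (0 <= j < L %/ K)%N -> 8 / K%:R ^+ 2 <= cosgap ((r + m * j)%:R * t).
    move=> /andP[_ jL].
    have jK : j%:R * K%:R <= L%:R :> R.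
      by rewrite -natrM ler_nat (leq_trans _ (leq_trunc_div L K))// leq_mul2r ltnW ?orbT.
    have : cosgap (j%:R * (m%:R * t)) <= 8 / K%:R ^+ 2.
      apply: le_trans (cosgap_muln _ _) _.
      apply: (@le_trans _ _ (j%:R ^+ 2 * (8 / L%:R ^+ 2))).
        by rewrite ler_wpM2l// exprn_ge0.
      rewrite mulrCA ler_pM2l// ler_pdivrMr ?exprn_gt0//; try lra.
      rewrite [leRHS]mulrC ler_pdivlMr ?exprn_gt0//; try lra.
      by rewrite -exprMn lerXn2r ?nnegrE ?mulr_ge0.
    have := cosgapB ((r + m * j)%:R * t) (j%:R * (m%:R * t)).
    rewrite (_ : (r + m * j)%:R * t - j%:R * (m%:R * t) = r%:R * t); last first.
      by rewrite natrD natrM; ring.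
    lra.
  have := @sum_ord_ge_const (fun j => cosgap ((r + m * j)%:R * t)) _ 0%N (L %/ K)%N L
    (fun j => cosgap_ge0 _) _ hj.
  rewrite leq0n leq_div => /(_ isT); apply: le_trans.
  rewrite subn0.
  have : L%:R <= 2 * ((L %/ K)%:R * K%:R) :> R.
    by rewrite -natrM -natrM ler_nat leq_double_trunc// K0.
  move=> h.
  apply: (@le_trans _ _ (4 / K%:R ^+ 3 * L%:R)).
    by apply: (le_trans (ler_wpM2l _ min1)); rewrite ?mulr1 ?mulr_ge0// ler_wpM2r.
  rewrite -(ler_pM2r (_ : 0 < K%:R ^+ 3)); try lra.
  rewrite mulrAC divfK; last by rewrite gt_eqF//; lra.
  rewrite -!mulrA (_ : (K%:R ^+ 2)^-1 * K%:R ^+ 3 = K%:R); first lra.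
  by field; rewrite gt_eqF//; lra.
(* Both r t and m t are now close to 2 pi Z, hence so is t = a (r t) - b (m t); since |t| <= pi, t
   itself is small. *)
have tt : t ^+ 2 / 8 <= (64 * a%:R ^+ 2 + 16 * b%:R ^+ 2) / K%:R ^+ 2.
  apply: le_trans (cosgap_ge _ tp) _.
  have -> : t = a%:R * (r%:R * t) - b%:R * (m%:R * t).
    have := congr1 (fun n => n%:R : R) ab; rewrite natrD !natrM => e.
    by rewrite !mulrA e; ring.
  apply: le_trans (cosgapB _ _) _.
  have h1 := cosgap_muln a (r%:R * t); have h2 := cosgap_muln b (m%:R * t).
  have h3 : a%:R ^+ 2 * cosgap (r%:R * t) <= a%:R ^+ 2 * (32 / K%:R ^+ 2).
    by rewrite ler_wpM2l ?exprn_ge0// ltW.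
  have h4 : b%:R ^+ 2 * cosgap (m%:R * t) <= b%:R ^+ 2 * (8 / K%:R ^+ 2).
    rewrite ler_wpM2l ?exprn_ge0//; apply: le_trans ym _.
    rewrite ler_pM2l// lef_pV2 ?posrE ?exprn_gt0//; try lra.
    by rewrite lerXn2r ?nnegrE ?ler_nat.
  move: (K%:R ^+ 2)^-1 h3 h4 => k; lra.
have mt : m%:R * `|t| <= 1.
  rewrite -(@ler_pXn2r _ 2)// ?nnegrE ?mulr_ge0// expr1n exprMn real_normK ?num_real//.
  rewrite -(ler_pM2r (_ : 0 < K%:R ^+ 2)) ?exprn_gt0//; try lra.
  have : t ^+ 2 * K%:R ^+ 2 <= 8 * (64 * a%:R ^+ 2 + 16 * b%:R ^+ 2).
    move: tt; rewrite ler_pdivlMr ?exprn_gt0//; lra.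
  rewrite mul1r mulrAC -mulrA.
  have : 8 * (64 * a%:R ^+ 2 + 16 * b%:R ^+ 2) * m%:R ^+ 2 <= K%:R ^+ 2 :> R.
    apply: (@le_trans _ _ ((32 * (a%:R + b%:R) * m%:R) ^+ 2)).
      rewrite exprMn ler_wpM2r ?exprn_ge0//.
      have : 0 <= a%:R :> R by []. have : 0 <= b%:R :> R by [].
      nra.
    by rewrite lerXn2r ?nnegrE// ?mulr_ge0// ?addr_ge0// Kr lerDl.
  have := sqr_ge0 (m%:R : R).
  nra.
have Lt : L%:R * m%:R * `|t| <= 8.
  have : m%:R * `|t| / 2 / 2 <= `|sin (m%:R * t / 2)|.
    have -> : `|sin (m%:R * t / 2)| = `|sin (m%:R * `|t| / 2)|.
      have [t0|t0] := leP 0 t; first by rewrite (ger0_norm t0).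
      by rewrite (ltr0_norm t0) mulrN mulNr sinN normrN.
    apply: le_trans (ler_norm _); apply: sin_ge_half.
    have := @pi_ge2 R; have := mulr_ge0 (le_trans ler01 m1) (normr_ge0 t); lra.
  move=> h; have := le_lt_trans h slt; rewrite ltr_pdivlMr; try lra.
(* The indices in [d, 2d) are large enough for r + m j >= L / 32 and small enough for (r + m j) |t|
   <= L m |t| / 4 <= 2 <= pi, where [cosgap_ge] applies. *)
pose d := (L %/ 16)%N.
have dL : (d * 16 <= L)%N := leq_trunc_div L 16.
have d2 : (L <= d * 32)%N by rewrite /d; clear -L32; lia.
have hj j : (d <= j < 2 * d)%N -> (L%:R * t / 32) ^+ 2 / 8 <= cosgap ((r + m * j)%:R * t).
  move=> /andP[dj jd].
  have j1 : L%:R <= 32 * (r + m * j)%:R :> R.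
    by rewrite -natrM ler_nat; clear -d2 dj m_gt0; nia.
  have j2 : (r + m * j)%:R * 4 <= L%:R * m%:R :> R.
    by rewrite -!natrM ler_nat; clear -dL jd m_gt0 rL; nia.
  apply: le_trans (cosgap_ge _ _); last first.
    rewrite normrM ger0_norm//; have := @pi_ge2 R.
    have := ler_wpM2r (normr_ge0 t) j2; rewrite -mulrA; lra.
  rewrite ler_pM2r// (_ : L%:R * t / 32 = (L%:R / 32) * t); last by field.
  rewrite !exprMn ler_wpM2r ?sqr_ge0// -exprMn lerXn2r ?nnegrE ?divr_ge0//.
  by rewrite ler_pdivrMr// mulrC.
have := @sum_ord_ge_const (fun j => cosgap ((r + m * j)%:R * t)) _ d (2 * d)%N L
    (fun j => cosgap_ge0 _) _ hj.
move=> /(_ _)/wrap[]; first by clear -dL; lia.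
apply: le_trans; rewrite mul2n -addnn addnK.
apply: (@le_trans _ _ (c * L%:R * (L%:R * t) ^+ 2)).
  by apply: ler_wpM2l; [rewrite mulr_ge0|rewrite ge_min lexx orbT].
have hd : L%:R <= d%:R * 32 :> R by rewrite -natrM ler_nat.
have cL : c * L%:R <= d%:R * (8^-1 / 32 / 32).
  apply: (@le_trans _ _ ((8^-1 / 32 / 32 / 32) * L%:R)); first by rewrite ler_wpM2r.
  lra.
have -> : d%:R * ((L%:R * t / 32) ^+ 2 / 8) = d%:R * (8^-1 / 32 / 32) * (L%:R * t) ^+ 2 by field.
by rewrite ler_wpM2r ?sqr_ge0.
Qed.
End ArithmeticProgression.

(** * Fourier coefficients of the partial products *)

Section Factors.
Context {R : realType}.
Implicit Types (s t : R) (k : nat).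

(* [qpow s t k] is [q^k] for [q = exp (- s + i t)] *)
Definition rpow s k : R := expR (- (k%:R * s)).
Definition qpow s t k : R[i] := real_complex R (rpow s k) * cis (k%:R * t).

Lemma rpow_ge0 s k : 0 <= rpow s k.
Proof. exact: expR_ge0. Qed.

Lemma rpow_lt1 s k : 0 < s -> (0 < k)%N -> rpow s k < 1.
Proof. by move=> s0 k0; rewrite /rpow expR_lt1 oppr_lt0 mulr_gt0// ltr0n. Qed.

Lemma rpow_le1 s k : 0 < s -> rpow s k <= 1.
Proof. by move=> s0; rewrite /rpow expR_le1 oppr_le0 mulr_ge0// ltW. Qed.

Lemma rpowD s j k : rpow s (j + k) = rpow s j * rpow s k.
Proof. by rewrite /rpow natrD mulrDl opprD expRD. Qed.

Lemma ler_rpow s j k : 0 < s -> (j <= k)%N -> rpow s k <= rpow s j.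
Proof.
by move=> s0 jk; rewrite /rpow ler_expR lerN2 ler_wpM2r ?ler_nat// ltW.
Qed.

Lemma normc_qpow s t k : normc (qpow s t k) = rpow s k.
Proof. by rewrite normcM normc_real normc_cis mulr1 ger0_norm ?rpow_ge0. Qed.

Lemma normc_ge_sub1 (z : R[i]) : 1 - normc z <= normc (1 - z).
Proof.
have := normcD (1 - z) z; rewrite subrK (_ : normc 1 = 1); last exact: normc1.
lra.
Qed.

Lemma sub1_qpow_ge s t k : 1 - rpow s k <= normc (1 - qpow s t k).
Proof. by rewrite -(normc_qpow s t k) normc_ge_sub1. Qed.

Lemma sub1_qpow_neq0 s t k : 0 < s -> (0 < k)%N -> 1 - qpow s t k != 0.
Proof.
move=> s0 k0; apply/eqP => e; have := sub1_qpow_ge s t k.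
by rewrite e (_ : normc 0 = 0) ?subr_le0 ?leNgt ?rpow_lt1//; exact: normc0.
Qed.

Lemma ccontinuous_qpow s (l : R) k : ccontinuous (fun y => qpow s (l * y) k).
Proof.
apply: ccontinuousM; first exact: ccontinuous_cst.
by under [X in ccontinuous X]eq_fun do rewrite mulrA; exact: ccontinuous_cis.
Qed.

End Factors.

Section Coefficients.
Context {R : realType}.
Variables (x : nat -> nat) (x_gt0 : forall i, (0 < x i)%N).
Variables (U : nat -> nat -> nat).
Hypothesis U0 : forall n, U 0 n = (n == 0)%N.
Hypothesis US : forall j n,
  U j.+1 n = (U j n + (if x j <= n then U j.+1 (n - x j) else 0))%N.
Variables (s l : R) (s_gt0 : 0 < s) (l_gt0 : 0 < l).
Local Notation mu := (@lebesgue_measure R).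
Let D : set R := `[- (pi / l), pi / l]%classic.

Definition genf (j : nat) (t : R) : R[i] := \prod_(i < j) (1 - qpow s t (x i))^-1.

(** Fourier coefficient over one period in the rescaled variable y = t / l. The index is an integer
    because the recurrence [coefS] runs below zero. *)
Definition coef (j : nat) (n : int) : R :=
  \int[mu]_(y in D) cRe (genf j (l * y) * cis (- n%:~R * l * y)).

Let ab : - (pi / l) < pi / l.
Proof. by have := divr_gt0 (@pi_gt0 R) l_gt0; lra. Qed.

Let mD : measurable D.
Proof. exact: measurable_itv. Qed.

Lemma continuous_integrable_itv (f : R -> R) : continuous f -> mu.-integrable D (EFin \o f).
Proof.
move=> cf; apply: continuous_compact_integrable; first exact: segment_compact.
exact: continuous_subspaceT.
Qed.

Lemma ccontinuous_genf j : ccontinuous (fun y => genf j (l * y)).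
Proof.
apply: (ccontinuous_prod j (fun i y => (1 - qpow s (l * y) (x i))^-1)) => i.
apply: ccontinuousV.
  by move=> y; exact: sub1_qpow_neq0.
apply: ccontinuousD; first exact: ccontinuous_cst.
under [X in ccontinuous X]eq_fun do rewrite -mulN1r.
by apply: ccontinuousM; [exact: ccontinuous_cst|exact: ccontinuous_qpow].
Qed.

Lemma continuous_coef j (n : int) :
  continuous (fun y => cRe (genf j (l * y) * cis (- n%:~R * l * y))).
Proof.
by case: (ccontinuousM _ _ (ccontinuous_genf j) (ccontinuous_cis (- n%:~R * l))).
Qed.

Lemma integrable_coef j (n : int) :
  mu.-integrable D (EFin \o (fun y => cRe (genf j (l * y) * cis (- n%:~R * l * y)))).
Proof.
by apply: continuous_integrable_itv; exact: continuous_coef.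
Qed.

Lemma mu_D : fine (mu D) = 2 * (pi / l).
Proof. by rewrite lebesgue_measure_itv/= lte_fin ab/=; lra. Qed.

Lemma coefS j n :
  coef j.+1 n = coef j n + rpow s (x j) * coef j.+1 (n - (x j)%:Z).
Proof.
rewrite /coef -RintegralZl//; last exact: integrable_coef.
apply/eqP; rewrite -subr_eq; apply/eqP; rewrite -RintegralB//; last 2 first.
- exact: integrable_coef.
- apply: continuous_integrable_itv => y; apply: cvgM; first exact: cvg_cst.
  exact: continuous_coef.
apply: eq_Rintegral => y _.
rewrite -Re_realM -ReB; congr cRe.
rewrite /genf big_ord_recr/=; set W := \prod_(i < j) _.
have q0 := sub1_qpow_neq0 s (l * y) (x j) s_gt0 (x_gt0 j).
have -> : cis (- (n - (x j)%:Z)%:~R * l * y) =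
    cis (- n%:~R * l * y) * cis ((x j)%:R * (l * y)).
  by rewrite -cisD; congr cis; rewrite rmorphB/=; ring.
rewrite [LHS](_ : _ = W * cis (- n%:~R * l * y) * (1 - qpow s (l * y) (x j))^-1 *
  (1 - qpow s (l * y) (x j))); last by rewrite /qpow; ring.
by rewrite divfK// mulrAC.
Qed.

Lemma sin_pi_muln (n : nat) : sin (n%:R * pi) = 0 :> R.
Proof.
elim: n => [|n ih]; first by rewrite mul0r sin0.
by rewrite -addn1 natrD mulrDl mul1r sinDpi ih oppr0.
Qed.

Lemma sin_pi_mulz (n : int) : sin (n%:~R * pi) = 0 :> R.
Proof.
case: n => n; first exact: sin_pi_muln.
by rewrite NegzE mulrNz mulNr sinN -pmulrn sin_pi_muln oppr0.
Qed.

Lemma coef0 (n : int) : coef 0 n = if n == 0 then 2 * (pi / l) else 0.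
Proof.
rewrite /coef; under eq_Rintegral do rewrite /genf big_ord0 mul1r /=.
case: eqP => [->|/eqP n0].
  under eq_Rintegral do rewrite oppr0 !mul0r cos0.
  by rewrite Rintegral_cst// mul1r mu_D.
have w0 : - n%:~R * l != 0 by rewrite mulf_eq0 oppr_eq0 intr_eq0 (negbTE n0) gt_eqF.
set w := - n%:~R * l in w0 *.
have dF (y : R) : is_derive y 1 (fun y => w^-1 * sin (w * y)) (cos (w * y)).
  by apply: is_derive_eq; rewrite -![_ *: _]/(_ * _); field.
have cF : continuous (fun y : R => w^-1 * sin (w * y)).
  move=> y; apply: cvgM; first exact: cvg_cst.
  by case: (@ccontinuous_cis R w) => _; apply.
rewrite /Rintegral (@continuous_FTC2 _ _ (fun y => w^-1 * sin (w * y)))//.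
- rewrite /= mulrN sinN mulrN opprK.
  have -> : w * (pi / l) = - (n%:~R * pi) by rewrite /w; field; rewrite gt_eqF.
  by rewrite sinN sin_pi_mulz oppr0 mulr0 addr0.
- apply: continuous_subspaceT.
  by case: (@ccontinuous_cis R w).
- split.
  + by move=> y _; case: (dF y).
  + by apply: cvg_at_right_filter; exact: cF.
  + by apply: cvg_at_left_filter; exact: cF.
- by move=> y _; rewrite derive1E; have := dF y => h; rewrite derive_val.
Qed.

Lemma coef_bound j : exists B : R, forall n, `|coef j n| <= B.
Proof.
pose B := \prod_(i < j) (1 - rpow s (x i))^-1.
exists (B * (2 * (pi / l))) => n.
have h y : `|cRe (genf j (l * y) * cis (- n%:~R * l * y))| <= B.
  apply: le_trans (abs_Re_le _) _; rewrite normcM normc_cis mulr1 normc_prod.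
  apply: ler_prod => i _; rewrite normc_ge0 andTb.
  rewrite [leLHS](_ : _ = (normc (1 - qpow s (l * y) (x i)))^-1); last exact: normc_inv.
  rewrite lef_pV2 ?posrE ?subr_gt0 ?rpow_lt1 ?sub1_qpow_ge//.
  by apply: lt_le_trans (sub1_qpow_ge _ _ _); rewrite subr_gt0 rpow_lt1.
rewrite /coef; apply: le_trans.
  by apply: le_normr_Rintegral => //; exact: integrable_coef.
rewrite -mu_D -(Rintegral_cst mu mD); apply: le_Rintegral => //.
- exact: integrable_abse (integrable_coef j n).
- by apply: continuous_integrable_itv => y; exact: cvg_cst.
Qed.

(** For negative n the recurrence shrinks to coef n = rho coef (n - x_j) with rho < 1, the term of
    index j being zero by induction. Iterating against the bound of [coef_bound], which is uniform
    in n, forces zero. So the absence of negative powers is obtained without a power series. *)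
Lemma coef_lt0 j (n : int) : n < 0 -> coef j n = 0.
Proof.
elim: j n => [|j ih] n n0; first by rewrite coef0 lt_eqF.
have step k : coef j.+1 n = rpow s (x j) ^+ k * coef j.+1 (n - (k * x j)%N%:Z).
  elim: k => [|k ihk]; first by rewrite mul1r mul0n subr0.
  rewrite ihk coefS ih ?add0r; last by rewrite ltrBlDr (lt_le_trans n0).
  by rewrite mulrA -exprSr mulSn addnC PoszD opprD addrA.
have [B hB] := coef_bound j.+1.
have cv : rpow s (x j) ^+ k * B @[k --> \oo] --> (0 : R).
  rewrite -[X in _ --> X](mul0r B); apply: cvgMl; apply: cvg_expr.
  by rewrite ger0_norm ?rpow_ge0 ?rpow_lt1.
apply/eqP; rewrite -normr_le0.
apply: (cvgr_to_ge cv); apply: nearW => k.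
by rewrite (step k) normrM ger0_norm ?exprn_ge0 ?rpow_ge0// ler_wpM2l ?exprn_ge0 ?rpow_ge0.
Qed.

(** Both sides obey the recurrence [US], whose boundary value at negative sizes is [coef_lt0]. *)
Lemma coefE j (n : nat) : coef j n = 2 * (pi / l) * rpow s n * (U j n)%:R.
Proof.
elim: j n => [|j ihj] n.
  by rewrite coef0 U0 eqz_nat; case: eqP => [->|_]; rewrite ?mulr0// mulr1 /rpow mul0r oppr0 expR0 mulr1.
elim/ltn_ind: n => n ih; rewrite coefS ihj US natrD mulrDr; congr (_ + _).
case: leqP => xn; last by rewrite coef_lt0 ?mulr0// subr_lt0 ltz_nat.
rewrite subzn// ih; last by rewrite ltn_subrL x_gt0 (leq_trans _ xn).
have -> : rpow s n = rpow s (n - x j) * rpow s (x j) by rewrite -rpowD subnK.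
ring.
Qed.

End Coefficients.

(** * The sine product *)

Section SineProduct.
Context {R : realType}.
Implicit Types (u x : R).

(* [sinpoly N] is the polynomial with [sin ((2N+1) u) = sin u * (sinpoly N).[sin u ^+ 2]] *)
Fixpoint sinpoly_rec (N : nat) : {poly R} * {poly R} :=
  if N is N'.+1 then
    let: (p, q) := sinpoly_rec N' in (((2%:P - 4%:P * 'X) * p - q)%R, p)
  else (1, -1).

Definition sinpoly N := (sinpoly_rec N).1.

Lemma sinpolySS N : sinpoly N.+2 = (2%:P - 4%:P * 'X) * sinpoly N.+1 - sinpoly N.
Proof. by rewrite /sinpoly /=; case: (sinpoly_rec N). Qed.

Lemma sinpoly0 : sinpoly 0 = 1. Proof. by []. Qed.

Lemma sinpoly1 : sinpoly 1 = 3%:P - 4%:P * 'X.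
Proof.
rewrite /sinpoly/= mulr1 opprK addrAC; congr (_ - _).
by rewrite -polyC1 -polyCD; congr polyC; lra.
Qed.

Lemma nat_ind2 (P : nat -> Prop) : P 0 -> P 1 -> (forall n, P n -> P n.+1 -> P n.+2) ->
  forall n, P n.
Proof.
move=> P0 P1 PS n; suff [] : P n /\ P n.+1 by [].
by elim: n => [|n [h1 h2]]; split=> //; exact: PS.
Qed.

Lemma sinpolyE N u : sin ((2 * N + 1)%:R * u) = sin u * (sinpoly N).[sin u ^+ 2].
Proof.
elim/nat_ind2: N => [| |N h1 h2].
- by rewrite sinpoly0 !hornerE ?mulr1 ?mul1r.
- rewrite sinpoly1 !(hornerD, hornerN, hornerM, hornerZ, hornerC, hornerX) (_ : (2 * 1 + 1)%:R * u = u + (u + u)); last first.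
    by rewrite natrD !natrM; lra.
  rewrite sinD cosD (sinD u u); have := cos2Dsin2 u.
  move: (sin u) (cos u) => a b e.
  have -> : a * (b * b - a * a) + b * (a * b + b * a) = a * (3 * (b ^+ 2 + a ^+ 2) - 4 * a ^+ 2) by ring.
  by rewrite e mulr1.
rewrite sinpolySS !(hornerD, hornerN, hornerM, hornerZ, hornerC, hornerX) mulrBr mulrCA -h1 -h2.
set v := (2 * N.+1 + 1)%:R * u.
have -> : (2 * N.+2 + 1)%:R * u = v + u *+ 2.
  by rewrite /v !mulnS !natrD mulr2n; ring.
have -> : (2 * N + 1)%:R * u = v - u *+ 2.
  by rewrite /v !mulnS !natrD mulr2n; ring.
rewrite sinD sinB.
have -> : 2 - 4 * sin u ^+ 2 = 2 * cos (u *+ 2) by rewrite cos_mulr2n cos2sin2; ring.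
ring.
Qed.

Lemma sinpoly_horner0 N : (sinpoly N).[0] = (2 * N + 1)%:R.
Proof.
elim/nat_ind2: N => [| |N h1 h2].
- by rewrite sinpoly0 hornerE.
- by rewrite sinpoly1 !(hornerD, hornerN, hornerM, hornerZ, hornerC, hornerX) mulr0 subr0.
by rewrite sinpolySS !(hornerD, hornerN, hornerM, hornerZ, hornerC, hornerX) h1 h2 !mulnS !natrD; lra.
Qed.

(** With the constant term [sinpoly_horner0], this is what Vieta needs for the sum of the reciprocal
    roots, the source of pi ^ 2 / 6 below. *)
Lemma sinpoly_deriv0 N :
  (sinpoly N)^`().[0] = - ((2 * N + 1)%:R * (4 * N%:R * (N%:R + 1)) / 6).
Proof.
elim/nat_ind2: N => [| |N h1 h2].
- by rewrite sinpoly0 -polyC1 derivC horner0 mulr0 mul0r mulr0 mul0r oppr0.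
- by rewrite sinpoly1 derivB derivC deriv_mulC derivX mulr1 sub0r hornerN hornerC; lra.
rewrite sinpolySS derivB derivM derivB derivC deriv_mulC derivX mulr1 sub0r.
rewrite !(hornerD, hornerN, hornerM, hornerC, hornerX) h1 h2 sinpoly_horner0.
rewrite !mulnS !natrD -[N.+2%:R]natr1 -[N.+1%:R]natr1; by field.
Qed.

Lemma size_sinpoly N : (size (sinpoly N) <= N.+1)%N.
Proof.
elim/nat_ind2: N => [| |N h1 h2].
- by rewrite sinpoly0 size_polyC; case: eqP.
- rewrite sinpoly1 (leq_trans (size_polyD _ _))// geq_max size_polyN.
  rewrite (leq_trans (size_polyC_leq1 _))//= (leq_trans (size_polyMleq _ _))// size_polyX addn2/=.
  by rewrite ltnS size_polyC_leq1.
rewrite sinpolySS (leq_trans (size_polyD _ _))// geq_max size_polyN.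
rewrite (leq_trans h1)?andbT; last by rewrite ltnW.
rewrite (leq_trans (size_polyMleq _ _))//.
have h : (size (2%:P - 4%:P * 'X : {poly R})%R <= 2)%N.
  rewrite (leq_trans (size_polyD _ _))// geq_max size_polyN.
  rewrite (leq_trans (size_polyC_leq1 _))//= (leq_trans (size_polyMleq _ _))// size_polyX addn2/=.
  by rewrite ltnS size_polyC_leq1.
by have := leq_add h h2; rewrite add2n; case: (_ + _)%N.
Qed.

Definition sinroot (N k : nat) : R := sin (k.+1%:R * pi / (2 * N + 1)%:R) ^+ 2.

Lemma sinroot_angle (N k : nat) : (k < N)%N ->
  0 < k.+1%:R * (pi : R) / (2 * N + 1)%:R < pi / 2.
Proof.
move=> kN; have M0 : 0 < (2 * N + 1)%:R :> R by rewrite ltr0n addn1.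
have p0 := @pi_gt0 R.
apply/andP; split; first by rewrite divr_gt0 ?mulr_gt0.
rewrite ltr_pdivrMr//.
have : k.+1%:R * 2 < (2 * N + 1)%:R :> R by rewrite -natrM ltr_nat; lia.
nra.
Qed.

Lemma sinroot_gt0 (N k : nat) : (k < N)%N -> 0 < sinroot N k.
Proof.
move=> kN; have /andP[h1 h2] := sinroot_angle N k kN.
by rewrite exprn_gt0// sin_gt0_pi// h1/=; have := @pi_gt0 R; lra.
Qed.

Lemma sinroot_uniq N : uniq [seq sinroot N k | k <- iota 0 N].
Proof.
rewrite map_inj_in_uniq ?iota_uniq// => i j; rewrite !mem_iota !add0n/= => iN jN.
have /andP[a1 a2] := sinroot_angle N i iN; have /andP[b1 b2] := sinroot_angle N j jN.
have p0 := @pi_gt0 R.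
have sa : 0 <= sin (i.+1%:R * pi / (2 * N + 1)%:R) :> R by apply: sin_ge0_pi; lra.
have sb : 0 <= sin (j.+1%:R * pi / (2 * N + 1)%:R) :> R by apply: sin_ge0_pi; lra.
move=> /eqP; rewrite /sinroot eqrXn2// => /eqP/sin_inj.
have ia : i.+1%:R * pi / (2 * N + 1)%:R \in `[(- ((pi : R) / 2)), pi / 2].
  by rewrite in_itv/=; apply/andP; split; lra.
have ib : j.+1%:R * pi / (2 * N + 1)%:R \in `[(- ((pi : R) / 2)), pi / 2].
  by rewrite in_itv/=; apply/andP; split; lra.
move=> /(_ ia ib).
have M0 : (2 * N + 1)%:R != 0 :> R by rewrite pnatr_eq0 addn1.
have pn0 : pi != 0 :> R by rewrite gt_eqF.
move=> /(divIf M0)/(mulIf pn0)/eqP.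
by rewrite eqr_nat => /eqP[].
Qed.

(** The N numbers sin (k pi / (2N + 1)) ^ 2 are distinct roots and the degree is at most N, so they
    are all the roots; the scalar is read off at 0. *)
Lemma sinpoly_prod N : sinpoly N =
  (2 * N + 1)%:R *: \prod_(k < N) (1 - (sinroot N k)^-1 *: 'X).
Proof.
have M0 : (2 * N + 1)%:R != 0 :> R by rewrite pnatr_eq0 addn1.
set s := [seq sinroot N k | k <- iota 0 N].
have sroot : all (root (sinpoly N)) s.
  apply/allP => z /mapP[k]; rewrite mem_iota add0n/= => kN ->; apply/rootP.
  have /andP[a1 a2] := sinroot_angle N k kN; have p0 := @pi_gt0 R.
  have := sinpolyE N (k.+1%:R * pi / (2 * N + 1)%:R).
  rewrite mulrCA divff// mulr1.
  have -> : sin (k.+1%:R * pi) = 0 :> R.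
    elim: k.+1 => [|i ih]; first by rewrite mul0r sin0.
    by rewrite -addn1 natrD mulrDl mul1r sinDpi ih oppr0.
  move=> /esym/eqP; rewrite mulf_eq0 gt_eqF ?sin_gt0_pi//=; last by rewrite a1/=; lra.
  by move=> /eqP.
have p0 : sinpoly N != 0.
  by apply/eqP => e; have := sinpoly_horner0 N; rewrite e horner0 => /esym/eqP; rewrite (negbTE M0).
have szs : size s = N by rewrite size_map size_iota.
have sz : size (sinpoly N) = (size s).+1.
  apply/eqP; rewrite eqn_leq szs size_sinpoly /= -{1}szs.
  by apply: max_poly_roots => //; exact: sinroot_uniq.
have us : uniq_roots s by rewrite uniq_rootsE sinroot_uniq.
have e := all_roots_prod_XsubC sz sroot us.
have rp (c : nat -> R) : (forall k, (k < N)%N -> c k != 0) ->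
   \prod_(k < N) ('X - (c k)%:P) =
   (\prod_(k < N) (- c k)) *: \prod_(k < N) (1 - (c k)^-1 *: 'X) :> {poly R}.
  elim: N {M0 s sroot p0 szs sz us e} => [|N ih] c0; first by rewrite !big_ord0 scale1r.
  rewrite !big_ord_recr/= ih; last by move=> k /ltnW; exact: c0.
  rewrite -scalerAl -scalerA; congr (_ *: _); rewrite scalerAr; congr (_ * _).
  by rewrite scalerBr scalerA mulNr divff ?c0// scaleN1r opprK addrC -polyC1 -mul_polyC -polyCM mulr1 polyCN.
move: e; rewrite big_map.
have -> : iota 0 N = index_iota 0 N by rewrite /index_iota subn0.
rewrite big_mkord rp; last by move=> k kN; rewrite gt_eqF ?sinroot_gt0.
rewrite scalerA; move: (_ * _) => C e.
have : C = (2 * N + 1)%:R; last by move=> <-.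
rewrite -sinpoly_horner0 e hornerZ horner_prod big1 ?mulr1// => k _.
by rewrite -polyC1 !(hornerD, hornerN, hornerM, hornerZ, hornerC, hornerX) mulr0 subr0.
Qed.

Lemma sin_prod N x : sin (pi * x) =
  (2 * N + 1)%:R * sin (pi * x / (2 * N + 1)%:R) *
  \prod_(k < N) (1 - sin (pi * x / (2 * N + 1)%:R) ^+ 2 / sinroot N k).
Proof.
have M0 : (2 * N + 1)%:R != 0 :> R by rewrite pnatr_eq0 addn1.
have := sinpolyE N (pi * x / (2 * N + 1)%:R); rewrite mulrCA divff// mulr1 => ->.
rewrite sinpoly_prod hornerZ horner_prod mulrCA mulrA; congr (_ * _).
by apply: eq_bigr => k _; rewrite hornerD hornerN hornerZ hornerX -polyC1 hornerC mulrC.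
Qed.

Lemma sum_sinroot N : \sum_(k < N) (sinroot N k)^-1 = 4 * N%:R * (N%:R + 1) / 6.
Proof.
have M0 : (2 * N + 1)%:R != 0 :> R by rewrite pnatr_eq0 addn1.
have := sinpoly_deriv0 N; rewrite sinpoly_prod derivZ hornerZ.
have e (c : nat -> R) : (\prod_(k < N) (1 - c k *: 'X))^`().[0] = - \sum_(k < N) c k.
  elim: N {M0} => [|N ih]; first by rewrite !big_ord0 -polyC1 derivC horner0 oppr0.
  rewrite !big_ord_recr/= derivM hornerD !hornerM ih.
  have -> : (\prod_(i < N) (1 - c i *: 'X)).[0] = 1.
    by rewrite horner_prod big1// => k _; rewrite -polyC1 !(hornerD, hornerN, hornerM, hornerZ, hornerC, hornerX) mulr0 subr0.
  by rewrite -polyC1 derivB derivC derivZ derivX sub0r -polyC1 !(hornerD, hornerN, hornerM, hornerZ, hornerC, hornerX) mulr0 subr0 mulr1 mul1r mulr1 opprD.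
rewrite (e (fun k => (sinroot N k)^-1)).
move=> h; apply: (mulfI M0); apply: oppr_inj; rewrite -mulrN h; congr (- _).
by rewrite !mulrA.
Qed.

End SineProduct.

(** * Tannery's theorem for products *)

Section Tannery.
Context {R : realType}.

Lemma sum_inv_sqr_tail (K i : nat) : (0 < K)%N ->
  \sum_(K <= j < K + i) (j.+1%:R ^+ 2)^-1 <= K%:R^-1 - (K + i)%:R^-1 :> R.
Proof.
move=> K0; elim: i => [|i ih]; first by rewrite addn0 big_geq// subrr.
rewrite addnS big_nat_recr/= ?leq_addr//.
have k0 : 0 < (K + i)%:R :> R by rewrite ltr0n addn_gt0 K0.
suff h : ((K + i).+1%:R ^+ 2)^-1 <= (K + i)%:R^-1 - (K + i).+1%:R^-1 :> R.
  by apply: (le_trans (lerD ih h)); rewrite addrA subrK.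
rewrite -natr1; move: ((K + i)%:R) k0 => k k0.
rewrite -subr_ge0 (_ : _ - _ = (k * (k + 1) ^+ 2)^-1); last first.
  by field; apply/andP; split; rewrite gt_eqF//; lra.
by rewrite invr_ge0 mulr_ge0 ?sqr_ge0// ltW.
Qed.

(** Factors beyond [K] cost at most C / K by the common majorant, the others are compared directly.
    [K] and [d] come before [a] and [N], so that the lemma serves both for N tending to infinity and
    for a parameter tending to 0 uniformly in N. *)
Lemma prod_tannery (C : R) (b : nat -> R) (e : R) : 0 < e ->
  (forall j, 0 <= b j <= 1) -> (forall j, b j <= C / j.+1%:R ^+ 2) ->
  exists K : nat, exists2 d : R, 0 < d & forall (a : nat -> R) (N : nat),
    (forall j, (j < N)%N -> 0 <= a j <= 1) ->
    (forall j, (j < N)%N -> a j <= C / j.+1%:R ^+ 2) ->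
    (forall j, (j < K)%N -> (j < N)%N -> `|a j - b j| <= d) ->
    `|\prod_(j < N) (1 - a j) - \prod_(j < N) (1 - b j)| <= e.
Proof.
move=> e0 b01 bC.
have C0 : 0 <= C.
  by have := bC 0%N; have /andP[] := b01 0%N; rewrite expr1n divr1; lra.
have [K K0 KC] : exists2 K : nat, (0 < K)%N & C / K%:R <= e / 2.
  exists (Num.trunc (2 * C / e)).+1 => //.
  rewrite ler_pdivrMr// mulrC -ler_pdivrMr; last lra.
  have := truncnS_gt (2 * C / e) => /ltW; apply: le_trans.
  by rewrite le_eqVlt; apply/orP; left; apply/eqP; field; lra.
exists K; exists (e / (2 * K%:R)); first by rewrite divr_gt0 ?mulr_gt0 ?ltr0n.
move=> a N a01 aC ab.
apply: le_trans (@normr_prodB R N (fun j => 1 - a j) (fun j => 1 - b j) _ _) _.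
- by move=> j /a01 /andP[h1 h2]; lra.
- by move=> j _; have /andP[h1 h2] := b01 j; lra.
have ee j : `|1 - a j - (1 - b j)| = `|a j - b j|.
  by rewrite -normrN; congr `|_|; ring.
under eq_bigr do rewrite ee.
rewrite -(big_mkord xpredT (fun j => `|a j - b j|)).
have h1 n : (n <= N)%N -> (n <= K)%N -> \sum_(0 <= j < n) `|a j - b j| <= e / 2.
  move=> nN nK; apply: (@le_trans _ _ (\sum_(0 <= j < n) (e / (2 * K%:R)))).
    by apply: ler_sum_nat => j /andP[_ jn]; apply: ab; exact: leq_trans jn _.
  rewrite sumr_const_nat subn0 -[_ *+ n]mulr_natr.
  have -> : e / (2 * K%:R) * n%:R = (e / 2) * (n%:R / K%:R).
    by rewrite invfM; ring.
  rewrite ler_piMr ?divr_ge0 ?(ltW e0)// ler_pdivrMr ?ltr0n// mul1r.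
  by rewrite ler_nat.
have [NK|KN] := leqP N K; first by apply: le_trans (h1 N _ _) _ => //; lra.
rewrite (@big_cat_nat _ _ _ K)//=; last exact: ltnW.
apply: (@le_trans _ _ (e / 2 + C / K%:R)); last by lra.
rewrite lerD//; first by apply: h1 => //; exact: ltnW.
apply: (@le_trans _ _ (\sum_(K <= j < N) C * (j.+1%:R ^+ 2)^-1)).
  apply: ler_sum_nat => j /andP[_ jN].
  have /andP[u1 u2] := a01 j jN; have /andP[v1 v2] := b01 j.
  have h := aC j jN; have h' := bC j.
  by rewrite ler_norml; move: (C / _) h h' => w *; apply/andP; split; lra.
rewrite -mulr_sumr ler_wpM2l// -(subnKC (ltnW KN)).
apply: le_trans (sum_inv_sqr_tail _ _ _) _ => //.
by rewrite gerBl invr_ge0.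
Qed.

End Tannery.

(** * Euler's sine product and the sum of inverse squares *)

Section SineLimit.
Context {R : realType}.
Implicit Types (x u : R).
Local Notation M N := ((2 * N + 1)%:R : R).

Let M_gt0 N : 0 < M N. Proof. by rewrite ltr0n addn1. Qed.

Lemma cvg_invM : (M N)^-1 @[N --> \oo] --> (0 : R).
Proof.
apply: (@squeeze_cvgr _ _ _ _ (cst 0) (@harmonic R)); [|exact: cvg_cst|exact: cvg_harmonic].
near=> N; rewrite invr_ge0 ltW//= lef_pV2 ?posrE// ler_nat; lia.
Unshelve. all: by end_near. Qed.

Lemma cvg_M_sin (y : R) : M N * sin (y / M N) @[N --> \oo] --> y.
Proof.
apply/subr_cvg0; apply: norm_cvg0.
apply: (@squeeze_cvgr _ _ _ _ (cst 0) (fun N => (2 * `|y| ^+ 3) * ((M N)^-1 * (M N)^-1))).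
- near=> N; rewrite normr_ge0/=.
  have M0 := M_gt0 N.
  have -> : M N * sin (y / M N) - y = M N * (sin (y / M N) - y / M N).
    by rewrite mulrBr mulrCA divff ?mulr1// gt_eqF.
  rewrite normrM gtr0_norm//; apply: le_trans (ler_wpM2l (ltW M0) (sin_taylor _)) _.
  rewrite normrM normfV (gtr0_norm M0) le_eqVlt; apply/orP; left; apply/eqP.
  by field; rewrite gt_eqF.
- exact: cvg_cst.
- rewrite -[X in _ --> X](mulr0 (2 * `|y| ^+ 3)); apply: cvgMr.
  by rewrite -[X in _ --> X](mulr0 0); apply: cvgM; exact: cvg_invM.
Unshelve. all: by end_near. Qed.

(** In the finite factorisation [sin_prod] each factor tends to 1 - x ^ 2 / k ^ 2. The majorant 4 /
    k ^ 2 comes from sin u <= u in the numerator and sin u >= u / 2 in the denominator. *)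
Lemma cvg_sin_prod x : 0 < x < 1 ->
  \prod_(k < N) (1 - x ^+ 2 / k.+1%:R ^+ 2) @[N --> \oo] --> sin (pi * x) / (pi * x).
Proof.
move=> /andP[x0 x1]; have p0 := @pi_gt0 R.
have px0 : 0 < pi * x by rewrite mulr_gt0.
pose a N k := sin (pi * x / M N) ^+ 2 / sinroot N k : R.
pose b k := x ^+ 2 / k.+1%:R ^+ 2 : R.
have x21 : x ^+ 2 <= 1 by rewrite expr_le1// ltW.
have b4 j : b j <= 4 / j.+1%:R ^+ 2 by rewrite ler_pM2r ?invr_gt0 ?exprn_gt0//; lra.
have b01 j : 0 <= b j <= 1.
  rewrite divr_ge0 ?sqr_ge0//= ler_pdivrMr ?exprn_gt0// mul1r (le_trans x21)//.
  by rewrite exprn_ege1// ler1n.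
have sx N : 0 < sin (pi * x / M N).
  rewrite sin_gt0_pi// divr_gt0//= ltr_pdivrMr// ltr_pM2l//.
  by apply: (lt_le_trans x1); rewrite ler1n addn1.
have a01 N j : (j < N)%N -> 0 <= a N j <= 1.
  move=> jN; rewrite divr_ge0 ?sqr_ge0//= ler_pdivrMr ?mul1r; last exact: sinroot_gt0.
  have /andP[h1 h2] := @sinroot_angle R N j jN.
  have xj : pi * x / M N <= j.+1%:R * pi / M N.
    rewrite ler_pM2r ?invr_gt0// mulrC ler_pM2r//.
    by apply: (le_trans (ltW x1)); rewrite ler1n.
  have y0 : 0 < pi * x / M N by rewrite divr_gt0.
  have sj : 0 < sin (j.+1%:R * pi / M N) by apply: sin_gt0_pi; rewrite h1/=; lra.
  rewrite /sinroot lerXn2r ?nnegrE ?(ltW (sx N)) ?(ltW sj)//.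
  case: (ltgtP (pi * x / M N) (j.+1%:R * pi / M N)) xj => // [xj|->] _ //.
  by apply: ltW; rewrite ltr_sin// in_itv/=; lra.
have aC N j : (j < N)%N -> a N j <= 4 / j.+1%:R ^+ 2.
  move=> jN; have /andP[h1 h2] := @sinroot_angle R N j jN.
  have h3 : 0 <= j.+1%:R * pi / M N <= pi / 2 by rewrite !ltW.
  have h4 := sin_ge_half _ h3.
  have M0 := M_gt0 N.
  rewrite ler_pdivrMr; last exact: sinroot_gt0.
  apply: (@le_trans _ _ ((pi * x / M N) ^+ 2)).
    have y0 : 0 <= pi * x / M N by rewrite divr_ge0 ?ltW.
    by rewrite lerXn2r ?nnegrE ?(ltW (sx N))// sin_le_id.
  apply: (@le_trans _ _ (4 / j.+1%:R ^+ 2 * (j.+1%:R * pi / M N / 2) ^+ 2)); last first.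
    have h5 : 0 <= j.+1%:R * pi / M N / 2 by rewrite divr_ge0// ltW.
    by rewrite ler_wpM2l ?divr_ge0 ?exprn_ge0// lerXn2r ?nnegrE// (le_trans h5).
  have aux (p q s : R) : p != 0 -> s != 0 ->
    4 / p ^+ 2 * (p * q / s / 2) ^+ 2 = (q / s) ^+ 2.
    by move=> p1 s1; field; rewrite ?p1 ?s1.
  rewrite aux ?gt_eqF//.
  rewrite mulrAC exprMn ler_piMr ?sqr_ge0//.
have acv j : a N j @[N --> \oo] --> b j.
  have -> : b j = (pi * x) ^+ 2 / (j.+1%:R * pi) ^+ 2.
    have aux (p q s : R) : p != 0 -> s != 0 -> q ^+ 2 / p ^+ 2 = (s * q) ^+ 2 / (p * s) ^+ 2.
      by move=> p1 s1; field; rewrite ?p1 ?s1.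
    by apply: aux; rewrite gt_eqF.
  rewrite (_ : a ^~ j = fun N => (M N * sin (pi * x / M N)) ^+ 2 /
      (M N * sin (j.+1%:R * pi / M N)) ^+ 2); last first.
    have aux (p q s : R) : p != 0 -> q ^+ 2 / s ^+ 2 = (p * q) ^+ 2 / (p * s) ^+ 2.
      by move=> p1; rewrite -!expr_div_n -mulf_div divff// mul1r.
    by apply/funext => N; apply: aux; rewrite gt_eqF.
  apply: cvgM.
    by rewrite expr2; under eq_fun do rewrite expr2; apply: cvgM; exact: cvg_M_sin.
  apply: cvgV; first by rewrite expf_neq0// mulf_neq0 ?gt_eqF.
  by rewrite expr2; under eq_fun do rewrite expr2; apply: cvgM; exact: cvg_M_sin.
have Acv : \prod_(k < N) (1 - a N k) @[N --> \oo] --> sin (pi * x) / (pi * x).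
  rewrite (_ : (fun N => _) = (fun N => sin (pi * x) / (M N * sin (pi * x / M N)))).
    apply: cvgM; first exact: cvg_cst.
    by apply: cvgV; [rewrite gt_eqF|exact: cvg_M_sin].
  apply/funext => N; rewrite (sin_prod N x) mulrAC divff ?mul1r//.
  by rewrite mulf_neq0 ?gt_eqF.
apply/cvgrPdist_le => e e0.
have e2 : 0 < e / 2 by rewrite divr_gt0.
have [K [d d0 h]] := @prod_tannery R 4 b (e / 2) e2 b01 b4.
move/cvgrPdist_le : Acv => /(_ _ e2) hA.
have hK : \forall N \near \oo, forall j, (j < K)%N -> `|a N j - b j| <= d.
  elim: K {h} => [|K ih]; first by near=> N.
  near=> N => j; rewrite ltnS leq_eqVlt => /predU1P[->|jK].
    by near: N; move/cvgrPdistC_le : (acv K) => /(_ _ d0).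
  by move: j jK; near: N.
near=> N.
have -> : sin (pi * x) / (pi * x) - \prod_(k < N) (1 - x ^+ 2 / k.+1%:R ^+ 2) =
  (sin (pi * x) / (pi * x) - \prod_(k < N) (1 - a N k)) +
  (\prod_(k < N) (1 - a N k) - \prod_(k < N) (1 - b k)) by rewrite subrKA.
apply: le_trans (ler_normD _ _) _; rewrite (splitr e) lerD//; first by near: N.
apply: h; [by move=> j; exact: a01|by move=> j; exact: aC|].
by move=> j jK _; move: j jK; near: N.
Unshelve. all: by end_near. Qed.

(** Cauchy's argument: 1 / u ^ 2 <= 1 / sin u ^ 2 <= 1 / u ^ 2 + 1, the second because u cos u <=
    sin u, summed over u = k pi / (2N + 1) with the exact value [sum_sinroot] in the middle. *)
Lemma sum_inv_sqr_bounds (N : nat) :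
  (pi : R) ^+ 2 / 6 - pi ^+ 2 / N.+1%:R <= \sum_(k < N) (k.+1%:R ^+ 2)^-1 <= (pi : R) ^+ 2 / 6.
Proof.
have p0 := @pi_gt0 R; have M0 := M_gt0 N.
have MN : M N = 2 * N%:R + 1 by rewrite natrD natrM.
set S := \sum_(k < N) _.
have e : \sum_(k < N) ((k.+1%:R * pi / M N) ^+ 2)^-1 = (M N) ^+ 2 / pi ^+ 2 * S.
  have aux (p q s : R) : ((p * q / s) ^+ 2)^-1 = s ^+ 2 / q ^+ 2 * (p ^+ 2)^-1.
    by rewrite -!exprVn !invfM invrK; ring.
  by rewrite /S mulr_sumr; apply: eq_bigr => k _; rewrite aux.
have h1 : (M N) ^+ 2 / pi ^+ 2 * S <= 4 * N%:R * (N%:R + 1) / 6.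
  rewrite -e -sum_sinroot; apply: ler_sum => k _.
  have /andP[a1 a2] := @sinroot_angle R N k (ltn_ord k).
  have s0 : 0 < sin (k.+1%:R * pi / M N) by apply: sin_gt0_pi; rewrite a1/=; lra.
  rewrite lef_pV2 ?posrE ?exprn_gt0// lerXn2r ?nnegrE ?(ltW s0) ?(ltW a1)//.
  by apply: sin_le_id; exact: ltW.
have h2 : 4 * N%:R * (N%:R + 1) / 6 - N%:R <= (M N) ^+ 2 / pi ^+ 2 * S.
  rewrite -e -sum_sinroot lerBlDr.
  have -> : (N%:R : R) = \sum_(k < N) 1 by rewrite sumr_const card_ord.
  rewrite -big_split/=; apply: ler_sum => k _.
  have /andP[a1 a2] := @sinroot_angle R N k (ltn_ord k).
  rewrite /sinroot; set u := _ * _ / _ in a1 a2 *.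
  have s0 : 0 < sin u by apply: sin_gt0_pi; rewrite a1/=; lra.
  have hu : u * cos u <= sin u by apply: mul_cos_le_sin; lra.
  have c0 : 0 <= cos u by apply: cos_ge0_pihalf; lra.
  have hu2 : (u * cos u) ^+ 2 <= sin u ^+ 2.
    have uc : 0 <= u * cos u := mulr_ge0 (ltW a1) c0.
    by rewrite lerXn2r// nnegrE// ltW.
  rewrite -(ler_pM2r (_ : 0 < sin u ^+ 2 * u ^+ 2)) ?mulr_gt0 ?exprn_gt0//.
  rewrite mulrA mulVf ?gt_eqF ?exprn_gt0// mul1r mulrDl mul1r.
  rewrite (mulrC (sin u ^+ 2)) mulrA mulVf ?gt_eqF ?exprn_gt0// mul1r.
  by move: hu2; rewrite exprMn cos2sin2; lra.
have p20 : 0 < pi ^+ 2 :> R by rewrite exprn_gt0.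
have n0 : 0 <= N%:R :> R by [].
rewrite MN in h1 h2 *.
have Mp : 0 < (2 * N%:R + 1) ^+ 2 :> R by rewrite exprn_gt0//; lra.
have eS : S = pi ^+ 2 * (((2 * N%:R + 1) ^+ 2 / pi ^+ 2 * S) / (2 * N%:R + 1) ^+ 2).
  by field; rewrite !gt_eqF//; lra.
move: h1 h2 eS; move: (_ / _ * S) => T h1 h2 ->.
rewrite -mulrBr !ler_pM2l//; apply/andP; split.
  rewrite ler_pdivlMr//; apply: le_trans h2.
  have w0 : 0 < N.+1%:R^-1 :> R by rewrite invr_gt0.
  have : N.+1%:R^-1 * (N%:R + 1) = 1 :> R by rewrite natr1 mulVf.
  move: (N.+1%:R^-1) w0 (N%:R) n0 {h1 Mp M0 MN e} => w w0 k n0 wk.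
  have wk0 : 0 <= w * k by rewrite mulr_ge0// ltW.
  have : w * (2 * k + 1) ^+ 2 = 4 * k * (w * (k + 1)) + w by ring.
  rewrite wk.
  have : w * k <= k by rewrite ler_piMl//; lra.
  lra.
rewrite ler_pdivrMr//; apply: le_trans h1 _.
by move: (N%:R) n0 {h2 Mp M0 MN e} => k n0; lra.
Qed.

End SineLimit.

(** * Infinite products near q = 1 *)

Section LogSeries.
Context {R : realType}.
Implicit Types (y t v : R).

Lemma cvg_sum_ord (T : Type) (F : set_system T) (FF : Filter F) (n : nat)
    (f : nat -> T -> R) (l : nat -> R) :
  (forall i, f i @ F --> l i) ->
  (fun x => \sum_(i < n) f i x) @ F --> \sum_(i < n) l i.
Proof.
move=> fl; elim: n => [|n ih].
  by rewrite big_ord0; under eq_fun do rewrite big_ord0; exact: cvg_cst.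
rewrite big_ord_recr/=; under eq_fun do rewrite big_ord_recr/=.
exact: cvgD.
Qed.

Lemma is_derive_exprn (n : nat) y :
  is_derive y 1 (fun y : R => y ^+ n) (n%:R * y ^+ n.-1).
Proof.
elim: n => [|n ih].
  by rewrite mul0r; under [X in is_derive _ _ X]eq_fun do rewrite expr0; exact: is_derive_cst.
under [X in is_derive _ _ X]eq_fun do rewrite exprS.
apply: is_derive_eq; rewrite /GRing.scale/=.
case: n {ih} => [|n]; first by rewrite mul0r mulr0 add0r.
by rewrite exprS -[n.+2%:R]natr1/=; ring.
Qed.

Definition logsum n y : R := \sum_(l < n) y ^+ l.+1 / l.+1%:R.

Lemma is_derive_logsum n y : y != 1 ->
  is_derive y 1 (logsum n) ((1 - y ^+ n) / (1 - y)).
Proof.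
move=> y1; have y1' : 1 - y != 0 by rewrite subr_eq0 eq_sym.
rewrite /logsum; elim: n => [|n ih].
  by under [X in is_derive _ _ X]eq_fun do rewrite big_ord0; rewrite expr0 subrr mul0r; exact: is_derive_cst.
under [X in is_derive _ _ X]eq_fun do rewrite big_ord_recr/=.
have h : is_derive y 1 (fun y : R => y ^+ n.+1 / n.+1%:R) (y ^+ n).
  under [X in is_derive _ _ X]eq_fun do rewrite mulrC.
  have hx := is_derive_exprn n.+1 y.
  by apply: is_derive_eq; rewrite /GRing.scale/= ?mulr0 ?addr0 mulKf.
have := is_deriveD ih h; rewrite (_ : (1 - y ^+ n) / (1 - y) + y ^+ n = (1 - y ^+ n.+1) / (1 - y)); last first.
  by rewrite exprS; field.
by [].
Qed.

Lemma is_derive_ln1m y : y < 1 -> is_derive y 1 (fun y => - ln (1 - y)) (1 - y)^-1.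
Proof.
move=> y1; have y0 : 0 < 1 - y by rewrite subr_gt0.
have h : is_derive y 1 (fun y : R => 1 - y) (-1).
  by apply: is_derive_eq; rewrite add0r mul1r.
have h2 := is_derive1_ln y0.
have h3 : is_derive y 1 (@ln R \o (fun y : R => 1 - y)) ((1 - y)^-1 * -1).
  exact: is_derive1_comp.
have := is_deriveN h3; rewrite mulrN1 opprK; exact.
Qed.

Lemma logsum_le n y : 0 <= y < 1 -> logsum n y <= - ln (1 - y).
Proof.
move=> /andP[y0 y1]; rewrite -subr_ge0.
have <- : - ln (1 - 0) - logsum n 0 = 0.
  by rewrite subr0 ln1 oppr0 /logsum big1 ?subr0// => i _; rewrite expr0n mul0r.
apply: (@le_of_derive_ge0 _ (fun y => - ln (1 - y) - logsum n y)
   (fun y => (1 - y)^-1 - (1 - y ^+ n) / (1 - y))) => //.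
  move=> z /andP[z0 zy]; have z1 : z < 1 by apply: le_lt_trans y1.
  by apply: is_deriveB; [exact: is_derive_ln1m|apply: is_derive_logsum; rewrite lt_eqF].
move=> z /andP[z0 zy]; have z1 : 0 < 1 - z by rewrite subr_gt0 (le_lt_trans zy).
by rewrite -[X in X - _]mul1r -mulrBl opprB addrC subrK divr_ge0 ?exprn_ge0// ltW.
Qed.

(** With [logsum_le] this encloses - ln (1 - y) between finite sums, so that no infinite series is
    handled; for y bounded away from 1 the factor 1 - y ^ n tends to 1. *)
Lemma le_logsum n y : 0 <= y < 1 -> (1 - y ^+ n) * - ln (1 - y) <= logsum n y.
Proof.
move=> /andP[y0 y1]; rewrite -subr_ge0.
have <- : logsum n 0 - (1 - 0 ^+ n) * - ln (1 - 0) = 0.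
  by rewrite subr0 ln1 oppr0 mulr0 subr0 /logsum big1// => i _; rewrite expr0n mul0r.
apply: (@le_of_derive_ge0 _ (fun y => logsum n y - (1 - y ^+ n) * - ln (1 - y))
   (fun y => n%:R * y ^+ n.-1 * - ln (1 - y))) => //.
  move=> z /andP[z0 zy]; have z1 : z < 1 by apply: le_lt_trans y1.
  have h1 := is_derive_logsum n z; rewrite lt_eqF// in h1.
  have {}h1 := h1 isT; have h2 := is_derive_ln1m z z1.
  have h3 : is_derive z 1 (fun z : R => 1 - z ^+ n) (- (n%:R * z ^+ n.-1)).
    have hx := is_derive_exprn n z.
    by apply: is_derive_eq; rewrite add0r mul1r.
  have := is_deriveB h1 (is_deriveM h3 h2).
  by move=> h; apply: is_derive_eq; rewrite -![_ *: _]/(_ * _); ring.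
move=> z /andP[z0 zy]; have z1 : 0 < 1 - z by rewrite subr_gt0 (le_lt_trans zy).
rewrite mulr_ge0 ?mulr_ge0 ?exprn_ge0// oppr_ge0 ln_le0//; lra.
Qed.

Definition lnq t N : R := \sum_(j < N) - ln (1 - expR (- (t * j.+1%:R))).

Let expj_bound t j : 0 < t -> 0 <= expR (- (t * j.+1%:R)) < 1.
Proof. by move=> t0; rewrite expR_ge0 expR_lt1 oppr_lt0 mulr_gt0. Qed.

Lemma lnq_nondecreasing t : 0 < t -> nondecreasing_seq (lnq t).
Proof.
move=> t0; apply/nondecreasing_seqP => N; rewrite /lnq big_ord_recr/= lerDl.
have /andP[h1 h2] := expj_bound t N t0.
by rewrite oppr_ge0 ln_le0// gerBl.
Qed.

Lemma expR_sub1_bounds v : 0 < v -> v^-1 - 1 <= (expR v - 1)^-1 <= v^-1.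
Proof.
move=> v0; have h := expR_ge1Dx v; have e0 : 0 < expR v - 1 by lra.
apply/andP; split; last by rewrite lef_pV2 ?posrE//; lra.
have [v1|v1] := leP 1 v.
  have : v^-1 <= 1 by rewrite invf_le1.
  have : 0 <= (expR v - 1)^-1 by rewrite invr_ge0 ltW.
  lra.
have h2 := expR_ge1Dx (- v); rewrite expRN in h2.
have h3 : (1 - v) * expR v <= 1.
  by rewrite -ler_pdivlMr ?expR_gt0// mul1r.
rewrite -[leRHS]mul1r ler_pdivlMr// (_ : v^-1 - 1 = (1 - v) / v); last by field; rewrite gt_eqF.
rewrite mulrAC ler_pdivrMr// mul1r; lra.
Qed.

(** After exchanging the sums, the one over j is geometric. The resulting terms 1 / (l (exp (t l) -
    1)) compare with 1 / (t l ^ 2), which brings in the sum of inverse squares. *)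
Lemma sum_logsum n t N : 0 < t ->
  \sum_(j < N) logsum n (expR (- (t * j.+1%:R))) =
  \sum_(l < n) l.+1%:R^-1 * ((1 - expR (- (t * l.+1%:R)) ^+ N) * (expR (t * l.+1%:R) - 1)^-1).
Proof.
move=> t0; rewrite /logsum exchange_big/=; apply: eq_bigr => l _.
set r := expR (- (t * l.+1%:R)).
have r1 : 0 < 1 - r by rewrite subr_gt0; have /andP[] := expj_bound t l t0.
have r0 : 0 < r by exact: expR_gt0.
have -> : (expR (t * l.+1%:R) - 1)^-1 = r / (1 - r).
  have -> : expR (t * l.+1%:R) = r^-1 by rewrite /r expRN invrK.
  by field; rewrite ?gt_eqF.
rewrite -mulr_suml mulrC; congr (_ * _).
have e j : expR (- (t * j.+1%:R)) ^+ l.+1 = r ^+ j.+1.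
  by rewrite /r -!expRM_natl; congr expR; ring.
under eq_bigr do rewrite e.
elim: N => [|N ih]; first by rewrite big_ord0 expr0 subrr mul0r.
by rewrite big_ord_recr/= ih exprS; field; rewrite gt_eqF.
Qed.

Lemma lnq_le t N : 0 < t -> lnq t N <= pi ^+ 2 / 6 / t.
Proof.
move=> t0.
pose y0 := expR (- (t * 1)) : R.
have /andP[y00 y01] : 0 <= y0 < 1 by exact: (expj_bound t 0).
have hn n : (1 - y0 ^+ n) * lnq t N <= pi ^+ 2 / 6 / t.
  apply: (@le_trans _ _ (\sum_(j < N) logsum n (expR (- (t * j.+1%:R))))).
    rewrite /lnq mulr_sumr; apply: ler_sum => j _.
    have hj := expj_bound t j t0; apply: le_trans (le_logsum n _ hj).
    case/andP: hj => h1 h2; rewrite ler_wpM2r ?oppr_ge0 ?ln_le0 ?gerBl//.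
    rewrite lerD2l lerN2 lerXn2r// ?nnegrE// /y0 ler_expR lerN2 ler_pM2l//.
    by rewrite ler1n.
  rewrite sum_logsum//.
  have /andP[_ hS] := @sum_inv_sqr_bounds R n.
  apply: (@le_trans _ _ (t^-1 * \sum_(k < n) (k.+1%:R ^+ 2)^-1)); last first.
    by rewrite mulrC ler_wpM2r// invr_ge0 ltW.
  rewrite mulr_sumr; apply: ler_sum => l _.
  have tl : 0 < t * l.+1%:R by rewrite mulr_gt0.
  have /andP[_ h] := expR_sub1_bounds _ tl.
  have /andP[r0 r1] := expj_bound t l t0.
  have h0 : 0 <= (expR (t * l.+1%:R) - 1)^-1.
    by rewrite invr_ge0; have := expR_ge1Dx (t * l.+1%:R); lra.
  have -> : t^-1 * (l.+1%:R ^+ 2)^-1 = l.+1%:R^-1 * (t * l.+1%:R)^-1.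
    by rewrite expr2 !invfM; ring.
  rewrite ler_pM2l ?invr_gt0//; apply: le_trans h; rewrite ler_piMl// gerBl exprn_ge0//.
have cv : (1 - y0 ^+ n) * lnq t N @[n --> \oo] --> (1 - 0) * lnq t N.
  apply: cvgM; last exact: cvg_cst.
  by apply: cvgB; [exact: cvg_cst|apply: cvg_expr; rewrite ger0_norm].
rewrite subr0 mul1r in cv.
by apply: (cvgr_to_le cv); apply: nearW.
Qed.

Definition Lq t : R := limn (lnq t).

Lemma cvg_lnq t : 0 < t -> lnq t N @[N --> \oo] --> Lq t.
Proof.
move=> t0; apply: nondecreasing_is_cvgn; first exact: lnq_nondecreasing.
by exists (pi ^+ 2 / 6 / t) => _ [N _ <-]; exact: lnq_le.
Qed.

Lemma Lq_le t : 0 < t -> Lq t <= pi ^+ 2 / 6 / t.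
Proof.
by move=> t0; apply: (cvgr_to_le (cvg_lnq t t0)); apply: nearW => N; exact: lnq_le.
Qed.

(** The number n of terms kept is free: it is fixed first, to make pi ^ 2 / (n + 1) small, and t is
    sent to 0 afterwards. *)
Lemma Lq_ge t n : 0 < t -> pi ^+ 2 / 6 - pi ^+ 2 / n.+1%:R - t * n%:R <= t * Lq t.
Proof.
move=> t0.
pose S := \sum_(l < n) l.+1%:R^-1 * (expR (t * l.+1%:R) - 1)^-1 : R.
have hS : S <= Lq t.
  have cv : \sum_(l < n) l.+1%:R^-1 *
     ((1 - expR (- (t * l.+1%:R)) ^+ N) * (expR (t * l.+1%:R) - 1)^-1) @[N --> \oo] --> S.
    have -> : S = \sum_(l < n) l.+1%:R^-1 * ((1 - 0) * (expR (t * l.+1%:R) - 1)^-1).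
      by apply: eq_bigr => l _; rewrite subr0 mul1r.
    apply: (@cvg_sum_ord _ \oo _ n (fun l N => l.+1%:R^-1 *
       ((1 - expR (- (t * l.+1%:R)) ^+ N) * (expR (t * l.+1%:R) - 1)^-1))
       (fun l => l.+1%:R^-1 * ((1 - 0) * (expR (t * l.+1%:R) - 1)^-1))) => l.
    apply: cvgMr; apply: cvgMl; apply: cvgB; first exact: cvg_cst.
    have /andP[r0 r1] := expj_bound t l t0.
    by apply: cvg_expr; rewrite ger0_norm.
  apply: (ler_cvg_to cv (cvg_lnq t t0)); apply: nearW => N.
  rewrite -sum_logsum//; apply: ler_sum => j _; apply: logsum_le; exact: expj_bound.
apply: (@le_trans _ _ (t * S)); last by rewrite ler_pM2l.
have /andP[h _] := @sum_inv_sqr_bounds R n.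
apply: (@le_trans _ _ (\sum_(k < n) (k.+1%:R ^+ 2)^-1 - t * n%:R)); first by rewrite lerD2r.
have -> : t * n%:R = \sum_(k < n) t by rewrite sumr_const card_ord mulr_natr.
rewrite -sumrB mulr_sumr; apply: ler_sum => l _.
have tl : 0 < t * l.+1%:R by rewrite mulr_gt0.
have /andP[h1 _] := expR_sub1_bounds _ tl.
have l1 : l.+1%:R^-1 <= 1 :> R by rewrite invf_le1// ler1n.
have l0 : 0 < l.+1%:R^-1 :> R by rewrite invr_gt0.
apply: (@le_trans _ _ (t * (l.+1%:R^-1 * ((t * l.+1%:R)^-1 - 1)))); last first.
  by rewrite !ler_pM2l.
rewrite mulrBr mulrBr mulr1 (_ : t * (l.+1%:R^-1 * (t * l.+1%:R)^-1) = (l.+1%:R ^+ 2)^-1).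
  by rewrite lerD2l lerN2 ler_piMr// ltW.
by rewrite expr2 !invfM mulrCA (mulrA t) mulfV ?gt_eqF// mul1r.
Qed.

End LogSeries.

(** * The theta product as q tends to 1 *)

Section ThetaProduct.
Context {R : realType}.
Implicit Types (t x u : R).

(** This is 2 sinh (u / 2). *)
Definition sh u : R := expR (u / 2) - expR (- (u / 2)).

Lemma sub1_expRN_bounds u : u * expR (- u) <= 1 - expR (- u) <= u.
Proof.
apply/andP; split; last by have := expR_ge1Dx (- u); lra.
rewrite -(ler_pM2r (expR_gt0 u)) -mulrA mulrBl -expRD addNr expR0 mulr1 mul1r.
by have := expR_ge1Dx u; lra.
Qed.

Lemma shE u : sh u = expR (u / 2) * (1 - expR (- u)).
Proof.
rewrite /sh mulrBr mulr1 -expRD; congr (_ - expR _); lra.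
Qed.

Lemma sh_bounds u : u * expR (- (u / 2)) <= sh u <= u * expR (u / 2).
Proof.
rewrite shE; have /andP[h1 h2] := sub1_expRN_bounds u.
apply/andP; split; last by rewrite mulrC ler_pM2r ?expR_gt0.
apply: le_trans (ler_wpM2l (expR_ge0 _) h1).
rewrite mulrCA -expRD le_eqVlt; apply/orP; left; apply/eqP; congr (_ * expR _); lra.
Qed.

Lemma sh_gt0 u : 0 < u -> 0 < sh u.
Proof.
move=> u0; have /andP[h _] := sh_bounds u.
by apply: lt_le_trans h; rewrite mulr_gt0 ?expR_gt0.
Qed.

Lemma sh_ge_half u : 0 <= u -> u / 2 <= sh u.
Proof.
move=> u0; rewrite /sh; have := expR_ge1Dx (u / 2).
have : expR (- (u / 2)) <= 1 by rewrite expR_le1; lra.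
lra.
Qed.

Definition shratio x t j : R := (sh (t * x) / sh (t * j.+1%:R)) ^+ 2.

(** Hyperbolic counterpart of an Euler factor: as t tends to 0, [shratio] tends to x ^ 2 / (j + 1) ^
    2. *)
Lemma shratioE x t j : 0 < t ->
  (1 - expR (- (t * (j.+1%:R + x)))) * (1 - expR (- (t * (j.+1%:R - x)))) =
  (1 - expR (- (t * j.+1%:R))) ^+ 2 * (1 - shratio x t j).
Proof.
move=> t0; rewrite /shratio /sh.
set E := expR (- (t * j.+1%:R / 2)); set Y := expR (- (t * x / 2)).
have E0 : E != 0 by rewrite gt_eqF ?expR_gt0.
have Y0 : Y != 0 by rewrite gt_eqF ?expR_gt0.
have -> : expR (t * j.+1%:R / 2) = E^-1 by rewrite /E expRN invrK.
have -> : expR (t * x / 2) = Y^-1 by rewrite /Y expRN invrK.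
have -> : expR (- (t * (j.+1%:R + x))) = E ^+ 2 * Y ^+ 2.
  by rewrite -!expRM_natl -expRD; congr expR; lra.
have -> : expR (- (t * (j.+1%:R - x))) = E ^+ 2 / Y ^+ 2.
  by rewrite -!expRM_natl -expRN -expRD; congr expR; lra.
have -> : expR (- (t * j.+1%:R)) = E ^+ 2.
  by rewrite -!expRM_natl; congr expR; lra.
have E2 : E ^+ 2 < 1.
  by rewrite expr_lt1 ?expR_ge0// expR_lt1 oppr_lt0 divr_gt0 ?mulr_gt0.
have E3 : 1 - E ^+ 2 != 0 by rewrite subr_eq0 gt_eqF.
have -> : E^-1 - E = (1 - E ^+ 2) / E by field.
by field; rewrite E0 Y0 E3.
Qed.

(** For x = r / m and t = m sigma these are the first 2N factors 1 - |q| ^ x_i ([prod_part]). *)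
Definition thetap x t N : R :=
  \prod_(j < N) ((1 - expR (- (t * (j%:R + x)))) * (1 - expR (- (t * (j%:R + 1 - x))))).

Lemma expR_lnq t N : 0 < t ->
  expR (- lnq t N) = \prod_(j < N) (1 - expR (- (t * j.+1%:R))).
Proof.
move=> t0; rewrite /lnq -sumrN expR_sum; apply: eq_bigr => j _.
by rewrite opprK lnK// posrE subr_gt0 expR_lt1 oppr_lt0 mulr_gt0.
Qed.

(** The exponents are paired anew, j + 1 + x with j + 1 - x, which leaves x at the beginning and N +
    1 - x at the end. *)
Lemma thetapS x t N : 0 < t ->
  thetap x t N.+1 = (1 - expR (- (t * x))) * (1 - expR (- (t * (N%:R + 1 - x)))) *
    expR (- lnq t N) ^+ 2 * \prod_(j < N) (1 - shratio x t j).
Proof.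
move=> t0; rewrite expR_lnq//; elim: N => [|N ih].
  by rewrite /thetap big_ord_recr !big_ord0/= mul1r !add0r expr1n !mulr1.
rewrite /thetap big_ord_recr/= -/(thetap x t N.+1) ih !big_ord_recr/=.
have := shratioE x t N t0.
have -> : N%:R + 1 - x = N.+1%:R - x by rewrite natr1.
set a := expR (- (t * (N.+1%:R + x))); set b := expR (- (t * (N.+1%:R - x))).
set q := \prod_(i < N) (1 - expR _); set w := \prod_(i < N) (1 - shratio x t i).
set y := expR (- (t * x)); set e := expR (- (t * N.+1%:R)).
set z := expR (- (t * (N.+1%:R + 1 - x))).
move=> h.
have -> : (1 - y) * (1 - z) * (q * (1 - e)) ^+ 2 * (w * (1 - shratio x t N)) =
  (1 - y) * (1 - z) * q ^+ 2 * w * ((1 - e) ^+ 2 * (1 - shratio x t N)) by ring.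
by rewrite -h; ring.
Qed.

Section LimitProduct.
Variables (x : R) (x0 : 0 < x) (x1 : x < 1).

Let tfac t j : 0 < t ->
  0 < (1 - expR (- (t * (j%:R + x)))) * (1 - expR (- (t * (j%:R + 1 - x)))) <= 1.
Proof.
move=> t0; have j0 : 0 <= j%:R :> R by [].
have h1 : 0 < 1 - expR (- (t * (j%:R + x))) <= 1.
  by rewrite subr_gt0 expR_lt1 oppr_lt0 mulr_gt0 ?ltr_wpDl//= gerBl expR_ge0.
have h2 : 0 < 1 - expR (- (t * (j%:R + 1 - x))) <= 1.
  have hj : 0 < j%:R + 1 - x by move: x1; lra.
  by rewrite subr_gt0 expR_lt1 oppr_lt0 mulr_gt0//= gerBl expR_ge0.
case/andP: h1 => a1 a2; case/andP: h2 => b1 b2.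
by rewrite mulr_gt0//= mulr_ile1// ltW.
Qed.

Lemma thetap_gt0 t N : 0 < t -> 0 < thetap x t N.
Proof. by move=> t0; apply: prodr_gt0 => j _; case/andP: (tfac t j t0). Qed.

Definition thetal t : R := limn (thetap x t).

Lemma cvg_thetap t : 0 < t -> thetap x t N @[N --> \oo] --> thetal t.
Proof.
move=> t0; apply: nonincreasing_is_cvgn.
  apply/nonincreasing_seqP => N; rewrite /thetap big_ord_recr/= ler_piMr//.
    exact/ltW/thetap_gt0.
  by case/andP: (tfac t N t0).
by exists 0 => _ [N _ <-]; exact/ltW/thetap_gt0.
Qed.

Lemma thetap_ge t N : 0 < t -> thetal t <= thetap x t N.
Proof.
move=> t0; apply: nonincreasing_cvgn_ge.
  apply/nonincreasing_seqP => k; rewrite /thetap big_ord_recr/= ler_piMr//.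
    exact/ltW/thetap_gt0.
  by case/andP: (tfac t k t0).
by apply/cvg_ex; eexists; exact: cvg_thetap.
Qed.

(** Majorant constant for t <= 1, from sh (t x) ^ 2 <= e t ^ 2 and sh (t (j + 1)) >= t (j + 1) /
    2. *)
Let C : R := 4 * expR 1.

Let shratio_dom t j : 0 < t <= 1 -> 0 <= shratio x t j <= 1 /\ shratio x t j <= C / j.+1%:R ^+ 2.
Proof.
move=> /andP[t0 t1]; have j1 : 1 <= j.+1%:R :> R by rewrite ler1n.
have tx0 : 0 < t * x by rewrite mulr_gt0.
have tj0 : 0 < t * j.+1%:R by rewrite mulr_gt0.
have sj := sh_gt0 _ tj0; have sx := sh_gt0 _ tx0.
split.
  rewrite /shratio sqr_ge0/= expr_le1 ?divr_ge0 ?(ltW sx) ?(ltW sj)//.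
  have xj : t * x <= t * j.+1%:R by rewrite ler_pM2l// (le_trans (ltW x1)).
  by rewrite ler_pdivrMr// mul1r /sh lerB// ler_expR ?lerN2 ler_pM2r.
rewrite /shratio expr_div_n.
have h1 : sh (t * x) ^+ 2 <= t ^+ 2 * expR 1.
  apply: (@le_trans _ _ ((t * x * expR (t * x / 2)) ^+ 2)).
    have /andP[_ h] := sh_bounds (t * x).
    by rewrite lerXn2r ?nnegrE ?(ltW sx)// mulr_ge0 ?expR_ge0// ltW.
  rewrite exprMn -expRM_natl ler_pM ?sqr_ge0 ?expR_ge0//.
    by rewrite exprMn ler_piMr ?sqr_ge0// expr_le1// ltW.
  rewrite ler_expR; have : t * x <= 1 by rewrite mulr_ile1// ltW.
  by move: (t * x) => u; lra.
have h2 : t ^+ 2 * j.+1%:R ^+ 2 / 4 <= sh (t * j.+1%:R) ^+ 2.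
  have h := sh_ge_half _ (ltW tj0).
  have -> : t ^+ 2 * j.+1%:R ^+ 2 / 4 = (t * j.+1%:R / 2) ^+ 2.
    by rewrite !exprMn exprVn; lra.
  by rewrite lerXn2r ?nnegrE ?(ltW sj)// divr_ge0 ?ltW.
rewrite ler_pdivrMr ?exprn_gt0//; apply: le_trans h1 _.
apply: (@le_trans _ _ (C / j.+1%:R ^+ 2 * (t ^+ 2 * j.+1%:R ^+ 2 / 4))); last first.
  by rewrite ler_wpM2l// divr_ge0 ?exprn_ge0// mulr_ge0 ?expR_ge0.
rewrite /C; have : j.+1%:R ^+ 2 != 0 :> R by rewrite expf_neq0// gt_eqF.
move: (j.+1%:R ^+ 2) => k k0; rewrite le_eqVlt; apply/orP; left; apply/eqP.
by field.
Qed.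

Lemma cvg_expR_right (c : R) : expR (t * c) @[t --> 0^'+] --> (1 : R).
Proof.
rewrite -[X in _ --> X](@expR0 R) -[X in expR X](mul0r c).
apply: cvg_at_right_filter.
have h : t * c @[t --> (0 : R)] --> 0 * c by apply: cvgM; [exact: cvg_id|exact: cvg_cst].
exact: (continuous_comp h (@continuous_expR R _)).
Qed.

Let cvg_shratio j : shratio x t j @[t --> 0^'+] --> x ^+ 2 / j.+1%:R ^+ 2.
Proof.
pose c := x + j.+1%:R.
have cc (s : R) : x ^+ 2 / j.+1%:R ^+ 2 * expR (t * s) @[t --> 0^'+] --> x ^+ 2 / j.+1%:R ^+ 2.
  by rewrite -[X in _ --> X]mulr1; apply: cvgMr; exact: cvg_expR_right.
apply: (@squeeze_cvgr _ _ _ _ (fun t => x ^+ 2 / j.+1%:R ^+ 2 * expR (t * - c))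
   (fun t => x ^+ 2 / j.+1%:R ^+ 2 * expR (t * c))); [|exact: cc|exact: cc].
near=> t.
have t0 : 0 < t by near: t; exact: nbhs_right_gt.
have tx0 : 0 < t * x by rewrite mulr_gt0.
have tj0 : 0 < t * j.+1%:R by rewrite mulr_gt0.
have sj := sh_gt0 _ tj0; have sx := sh_gt0 _ tx0.
have /andP[a1 a2] := sh_bounds (t * x); have /andP[b1 b2] := sh_bounds (t * j.+1%:R).
have e (s : R) : x ^+ 2 / j.+1%:R ^+ 2 * expR (t * s) = (x / j.+1%:R * expR (t * s / 2)) ^+ 2.
  by rewrite !exprMn exprVn -expRM_natl; congr (_ * expR _); lra.
rewrite !e /shratio !lerXn2r ?nnegrE ?divr_ge0 ?mulr_ge0 ?expR_ge0 ?invr_ge0 ?(ltW x0) ?(ltW sx) ?(ltW sj)//.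
  rewrite ler_pdivrMr//; apply: le_trans (ler_wpM2l _ b1); last first.
    by rewrite mulr_ge0 ?expR_ge0 ?divr_ge0// ltW.
  apply: (le_trans a2).
  rewrite (_ : _ * _ * (_ * _) = t * x * (j.+1%:R / j.+1%:R) * (expR (t * c / 2) * expR (- (t * j.+1%:R / 2)))).
    rewrite divff ?gt_eqF// mulr1 -expRD le_eqVlt; apply/orP; left; apply/eqP.
    by congr (_ * expR _); rewrite /c; lra.
  by ring.
rewrite ler_pdivlMr//.
apply: (le_trans (ler_wpM2l _ b2)).
    by rewrite mulr_ge0 ?expR_ge0 ?divr_ge0// ltW.
  apply: le_trans a1.
  rewrite [leLHS](_ : _ = t * x * (j.+1%:R / j.+1%:R) * (expR (t * - c / 2) * expR (t * j.+1%:R / 2))).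
    rewrite divff ?gt_eqF// mulr1 -expRD le_eqVlt; apply/orP; left; apply/eqP.
    by congr (_ * expR _); rewrite /c; lra.
  by ring.

Unshelve. all: by end_near. Qed.

(** The Tannery bound at a fixed small t holds for all N at once, so N may tend to infinity inside
    it before t tends to 0. The division by 1 - exp (- t x) removes the unpaired first factor. *)
Lemma cvg_thetal_sinc :
  thetal t * expR (Lq t) ^+ 2 / (1 - expR (- (t * x))) @[t --> 0^'+] --> sin (pi * x) / (pi * x).
Proof.
pose b k := x ^+ 2 / k.+1%:R ^+ 2 : R.
have x21 : x ^+ 2 <= 1 by rewrite expr_le1// ltW.
have C1 : 1 <= C by rewrite /C; have := expR_ge1Dx (1 : R); lra.
have bC j : b j <= C / j.+1%:R ^+ 2 by rewrite ler_pM2r ?invr_gt0 ?exprn_gt0//; lra.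
have b01 j : 0 <= b j <= 1.
  rewrite divr_ge0 ?sqr_ge0//= ler_pdivrMr ?exprn_gt0// mul1r (le_trans x21)//.
  by rewrite exprn_ege1// ler1n.
apply/cvgrPdist_le => e e0.
have [K [d d0 h]] := @prod_tannery R C b e e0 b01 bC.
have hK : \forall t \near 0^'+, forall j, (j < K)%N -> `|shratio x t j - b j| <= d.
  elim: K {h} => [|K ih]; first by near=> N.
  near=> t => j; rewrite ltnS leq_eqVlt => /predU1P[->|jK].
    by near: t; move/cvgrPdistC_le : (cvg_shratio K) => /(_ _ d0).
  by move: j jK; near: t.
near=> t.
have t0 : 0 < t by near: t; exact: nbhs_right_gt.
have t1 : t <= 1 by near: t; exact: nbhs_right_le.
have hN N : `|\prod_(j < N) (1 - shratio x t j) - \prod_(j < N) (1 - b j)| <= e.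
  have t01 : 0 < t <= 1 by rewrite t0.
  apply: h; [by move=> j _; case: (shratio_dom t j t01)|by move=> j _; case: (shratio_dom t j t01)|].
  by move=> j jK _; move: j jK; near: t.
have y0 : 0 < 1 - expR (- (t * x)) by rewrite subr_gt0 expR_lt1 oppr_lt0 mulr_gt0.
have cW : \prod_(j < N) (1 - shratio x t j) @[N --> \oo] -->
    thetal t * expR (Lq t) ^+ 2 / (1 - expR (- (t * x))).
  have -> : (fun N => \prod_(j < N) (1 - shratio x t j)) = (fun N =>
      thetap x t N.+1 * expR (lnq t N) ^+ 2 / (1 - expR (- (t * x))) /
       (1 - expR (- (t * (N%:R + 1 - x))))).
    apply/funext => N; rewrite thetapS// [expR (- lnq t N)]expRN.
    have : expR (lnq t N) != 0 by rewrite gt_eqF ?expR_gt0.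
    have : 1 - expR (- (t * (N%:R + 1 - x))) != 0.
      rewrite subr_eq0 gt_eqF// expR_lt1 oppr_lt0 mulr_gt0//.
      by move: x1 (ler0n R N); lra.
    have : 1 - expR (- (t * x)) != 0 by rewrite gt_eqF.
    move: (expR (lnq _ _)) (1 - expR _) (1 - expR _) (\prod_(j < N) _) => p q s w p0 q0 s0.
    by field; rewrite p0 q0 s0.
  rewrite (_ : thetal t * expR (Lq t) ^+ 2 / (1 - expR (- (t * x))) =
    thetal t * expR (Lq t) ^+ 2 / (1 - expR (- (t * x))) / (1 - 0)); last by rewrite subr0 divr1.
  apply: cvgM; last first.
    apply: cvgV; first by rewrite subr0 oner_eq0.
    apply: cvgB; first exact: cvg_cst.
    have -> : (fun N => expR (- (t * (N%:R + 1 - x)))) =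
        (fun N => expR (- (t * (1 - x))) * expR (- t) ^+ N).
      by apply/funext => N; rewrite -expRM_natl -expRD; congr expR; ring.
    rewrite -[X in _ --> X](mulr0 (expR (- (t * (1 - x))))); apply: cvgMr.
    by apply: cvg_expr; rewrite ger0_norm ?expR_ge0// expR_lt1 oppr_lt0.
  apply: cvgMl; apply: cvgM.
    by have := cvg_thetap t t0; rewrite -(@cvg_shiftS _ (thetap x t)).
  have ce : expR (lnq t N) @[N --> \oo] --> expR (Lq t).
    exact: (continuous_cvg _ (@continuous_expR R _) (cvg_lnq t t0)).
  by rewrite expr2; under eq_fun do rewrite expr2; exact: cvgM.
have cB := @cvg_sin_prod R x; rewrite x0 x1 in cB; have {}cB := cB isT.
have cD : `|\prod_(k < N) (1 - x ^+ 2 / k.+1%:R ^+ 2) -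
    \prod_(j < N) (1 - shratio x t j)| @[N --> \oo] -->
    `|sin (pi * x) / (pi * x) - thetal t * expR (Lq t) ^+ 2 / (1 - expR (- (t * x)))|.
  by apply: cvg_norm; exact: cvgB.
apply: (cvgr_to_le cD); apply: nearW => N.
by rewrite distrC; exact: hN.
Unshelve. all: by end_near. Qed.

Lemma cvg_thetal :
  thetal t * expR (Lq t) ^+ 2 / t @[t --> 0^'+] --> sin (pi * x) / pi.
Proof.
have p0 := @pi_gt0 R.
have -> : sin (pi * x) / pi = sin (pi * x) / (pi * x) * x by rewrite invfM mulrA divfK// gt_eqF.
have c2 : (1 - expR (- (t * x))) / t @[t --> 0^'+] --> x.
  apply: (@squeeze_cvgr _ _ _ _ (fun t => x * expR (t * - x)) (cst x)); last exact: cvg_cst.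
    near=> t.
    have t0 : 0 < t by near: t; exact: nbhs_right_gt.
    have /andP[h1 h2] := sub1_expRN_bounds (t * x).
    rewrite ler_pdivlMr// ler_pdivrMr//= (mulrC x t) h2 andbT.
    by move: h1; rewrite mulrN; congr (_ <= _); ring.
  by rewrite -[X in _ --> X]mulr1; apply: cvgMr; exact: cvg_expR_right.
apply: cvg_trans (cvgM cvg_thetal_sinc c2).
apply: near_eq_cvg; near=> t.
have t0 : 0 < t by near: t; exact: nbhs_right_gt.
have y0 : 1 - expR (- (t * x)) != 0 by rewrite gt_eqF// subr_gt0 expR_lt1 oppr_lt0 mulr_gt0.
by rewrite /= mulrA divfK.
Unshelve. all: by end_near. Qed.

End LimitProduct.
End ThetaProduct.

(** * The product of 1 - exp (- t j) from its behaviour under halving t *)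

Section EtaAsymptotics.
Context {R : realType}.
Implicit Types (t x : R).

(** At x = 1/2 the two families of exponents coincide. They are the odd multiples of t / 2, and the
    even multiples come from the product at t. *)
Lemma thetap_half t N : 0 < t ->
  thetap 2^-1 t N * expR (- lnq t N) ^+ 2 = expR (- lnq (t / 2) (2 * N)) ^+ 2.
Proof.
move=> t0; have t20 : 0 < t / 2 by rewrite divr_gt0.
rewrite !expR_lnq//.
suff -> : \prod_(j < 2 * N) (1 - expR (- (t / 2 * j.+1%:R))) =
  \prod_(j < N) (1 - expR (- (t * (j%:R + 2^-1)))) * \prod_(j < N) (1 - expR (- (t * j.+1%:R))).
  rewrite exprMn; congr (_ * _); rewrite /thetap expr2 -big_split/=.
  by apply: eq_bigr => j _; congr (_ * (1 - expR (- (t * _)))); lra.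
elim: N => [|N ih]; first by rewrite muln0 !big_ord0 mulr1.
rewrite (_ : 2 * N.+1 = (2 * N).+2)%N; last by rewrite mulnS.
rewrite !big_ord_recr/= ih.
have e1 : (2 * N).+1%:R = 2 * N%:R + 1 :> R by rewrite -(addn1 (2 * N)) natrD natrM.
have e2 : (2 * N).+2%:R = 2 * N.+1%:R :> R by rewrite -natrM mulnS.
have -> : t / 2 * (2 * N).+1%:R = t * (N%:R + 2^-1) by rewrite e1; field.
have -> : t / 2 * (2 * N).+2%:R = t * N.+1%:R by rewrite e2 mulrA divfK.
ring.
Qed.

Lemma thetal_half t : 0 < t ->
  thetal 2^-1 t * expR (Lq t) ^+ 2 = expR (2 * (2 * Lq t - Lq (t / 2))).
Proof.
move=> t0; have t20 : 0 < t / 2 by rewrite divr_gt0.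
have cexp (u : nat -> R) l : u @ \oo --> l -> expR (- u n) ^+ 2 @[n --> \oo] --> expR (- l) ^+ 2.
  move=> ul; have h : expR (- u n) @[n --> \oo] --> expR (- l).
    apply: (continuous_cvg _ (@continuous_expR R _)); exact: cvgN.
  by rewrite expr2; under eq_fun do rewrite expr2; exact: cvgM.
have h1 : thetap 2^-1 t N * expR (- lnq t N) ^+ 2 @[N --> \oo] -->
    thetal 2^-1 t * expR (- Lq t) ^+ 2.
  apply: cvgM; last exact/cexp/cvg_lnq.
  by apply: cvg_thetap => //; rewrite invf_lt1// ltr1n.
have h2 : expR (- lnq (t / 2) (2 * N)) ^+ 2 @[N --> \oo] --> expR (- Lq (t / 2)) ^+ 2.
  have h : (fun N => lnq (t / 2) (2 * N)%N) @ \oo --> Lq (t / 2).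
    apply: cvg_comp (cvg_lnq _ t20) => /=.
    apply/cvgnyPge => M; near=> N; have : (M <= N)%N by near: N; exact: nbhs_infty_ge.
    by move=> h; apply: (leq_trans h); rewrite mul2n -addnn leq_addr.
  exact: cexp h.
have e : thetal 2^-1 t * expR (- Lq t) ^+ 2 = expR (- Lq (t / 2)) ^+ 2.
  have h3 : expR (- lnq (t / 2) (2 * N)) ^+ 2 @[N --> \oo] -->
      thetal 2^-1 t * expR (- Lq t) ^+ 2.
    by have := h1; under eq_fun do rewrite thetap_half//.
  rewrite -(cvg_lim (@norm_hausdorff R R) h3) -[RHS](cvg_lim (@norm_hausdorff R R) h2)//.
have aux (a b : R) : 2 * (2 * a - b) = 2 * - b + 2 * a + 2 * a by ring.
rewrite aux !expRD !expRM_natl -e expRN.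
have : expR (Lq t) != 0 by rewrite gt_eqF ?expR_gt0.
move: (expR (Lq t)) (thetal _ _) => a b a0.
by rewrite exprVn divfK ?expf_neq0.
Unshelve. all: by end_near. Qed.

(** Logarithmic error in the classical asymptotics sqrt (2 pi / t) exp (- pi ^ 2 / (6 t)) of the
    product of the 1 - exp (- t j), j >= 1. *)
Definition etaerr t : R := - Lq t + pi ^+ 2 / 6 / t + ln (t / (2 * pi)) / 2.

(** Half the logarithm of [cvg_thetal] at x = 1/2, where the sine is 1: the terms in pi ^ 2 / t
    cancel, and the logarithms combine to ln (pi / t) / 2. *)
Lemma cvg_etaerr_dyadic : etaerr (t / 2) - 2 * etaerr t @[t --> 0^'+] --> (0 : R).
Proof.
have p0 := @pi_gt0 R.
have a1 : 0 < 2^-1 :> R by [].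
have a2 : 2^-1 < 1 :> R by rewrite invf_lt1// ltr1n.
have := @cvg_thetal R _ a1 a2; rewrite sin_pihalf => c.
have {}c : thetal 2^-1 t * expR (Lq t) ^+ 2 / t * pi @[t --> 0^'+] --> (1 : R).
  have h : thetal 2^-1 t * expR (Lq t) ^+ 2 / t * pi @[t --> 0^'+] --> (1 / pi * pi : R).
    exact: cvgMl.
  by rewrite divfK ?gt_eqF// in h.
have {}c : ln (thetal 2^-1 t * expR (Lq t) ^+ 2 / t * pi) @[t --> 0^'+] --> (0 : R).
  have h : ln (thetal 2^-1 t * expR (Lq t) ^+ 2 / t * pi) @[t --> 0^'+] --> (ln 1 : R).
    exact: (continuous_cvg _ (@continuous_ln R 1 ltr01) c).
  by rewrite ln1 in h.
have {}c : ln (thetal 2^-1 t * expR (Lq t) ^+ 2 / t * pi) / 2 @[t --> 0^'+] --> (0 : R).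
  have h : ln (thetal 2^-1 t * expR (Lq t) ^+ 2 / t * pi) / 2 @[t --> 0^'+] --> (0 * 2^-1 : R).
    exact: cvgMl.
  by rewrite mul0r in h.
apply: cvg_trans c; apply: near_eq_cvg; near=> t.
have t0 : 0 < t by near: t; exact: nbhs_right_gt.
rewrite thetal_half// /etaerr.
have p2 : 0 < 2 * pi :> R by rewrite mulr_gt0.
rewrite lnM ?posrE ?divr_gt0 ?expR_gt0// !ln_div ?posrE ?divr_gt0 ?expR_gt0// expRK.
rewrite lnM ?posrE//.
by field; rewrite gt_eqF.
Unshelve. all: by end_near. Qed.

Lemma mul_ln_bound (s : R) : 0 < s -> - (2 * Num.sqrt s) <= s * ln s.
Proof.
move=> s0; have r0 : 0 < Num.sqrt s by rewrite sqrtr_gt0.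
have := @ln_sublinear R (Num.sqrt s)^-1; rewrite invr_gt0 => /(_ r0).
rewrite lnV ?posrE// => h.
have e : ln s = 2 * ln (Num.sqrt s).
  by rewrite -{1}(sqr_sqrtr (ltW s0)) lnXn// mulr_natl.
have : Num.sqrt s ^+ 2 * - ln (Num.sqrt s) <= Num.sqrt s.
  apply: (@le_trans _ _ (Num.sqrt s ^+ 2 * (Num.sqrt s)^-1)).
    by rewrite ler_pM2l ?exprn_gt0// ltW.
  by rewrite expr2 mulfK// gt_eqF.
rewrite e sqr_sqrtr; last exact: ltW.
lra.
Qed.

(** First-order information only, from [Lq_le] and [Lq_ge]; combined with the halving relation it
    suffices to determine the limit of [etaerr] itself. *)
Lemma cvg_mul_etaerr : t * etaerr t @[t --> 0^'+] --> (0 : R).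
Proof.
have p0 := @pi_gt0 R.
have p20 : 0 < pi ^+ 2 :> R by rewrite exprn_gt0.
apply/cvgr0Pnorm_le => e e0.
pose n := Num.trunc (4 * pi ^+ 2 / e).
have n1 : 0 < n.+1%:R :> R by [].
have hn : pi ^+ 2 / n.+1%:R <= e / 4.
  rewrite ler_pdivrMr// mulrC -ler_pdivrMr; last lra.
  have := truncnS_gt (4 * pi ^+ 2 / e) => /ltW; apply: le_trans.
  by rewrite le_eqVlt; apply/orP; left; apply/eqP; field; lra.
near=> t.
have t0 : 0 < t by near: t; exact: nbhs_right_gt.
have h1 := Lq_ge t n t0; have := Lq_le t t0; rewrite ler_pdivlMr// => h2.
have h3 : t * n.+1%:R <= e / 4.
  rewrite -ler_pdivlMr//; near: t; apply: nbhs_right_le.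
  by rewrite !divr_gt0.
have h3' : t * n%:R <= t * n.+1%:R by rewrite ler_pM2l// ler_nat.
pose s := t / (2 * pi).
have s0 : 0 < s by rewrite divr_gt0 ?mulr_gt0.
have pn0 : pi != 0 :> R by rewrite gt_eqF.
have se : pi * (s * ln s) = t * (ln s / 2).
  move: (ln s) => l; rewrite /s; move: (pi : R) pn0 => p pn0; field.
  exact: pn0.
have s1 : s <= 1 by rewrite ler_pdivrMr ?mulr_gt0// mul1r; near: t; apply: nbhs_right_le; rewrite mulr_gt0.
have ls : ln s <= 0 by rewrite ln_le0.
have h4 := mul_ln_bound s s0.
have h5 : 2 * Num.sqrt s <= e / (4 * pi).
  have e1 : 0 < e / (8 * pi) by rewrite divr_gt0 ?mulr_gt0.
  have : s <= (e / (8 * pi)) ^+ 2.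
    rewrite /s ler_pdivrMr ?mulr_gt0//; near: t; apply: nbhs_right_le.
    by rewrite mulr_gt0 ?exprn_gt0 ?divr_gt0 ?mulr_gt0.
  move=> /ler_wsqrtr; rewrite sqrtr_sqr gtr0_norm// => h.
  apply: (@le_trans _ _ (2 * (e / (8 * pi)))); first by rewrite ler_pM2l.
  by rewrite le_eqVlt; apply/orP; left; apply/eqP; move: (pi : R) pn0 => p pn0; field; exact: pn0.
have h6 : - (e / 4) <= t * (ln s / 2).
  rewrite -se; apply: (@le_trans _ _ (pi * - (e / (4 * pi)))).
    by rewrite le_eqVlt; apply/orP; left; apply/eqP; move: (pi : R) pn0 => p pn0; field; exact: pn0.
  by rewrite ler_pM2l//; lra.
have h7 : t * (ln s / 2) <= 0 by rewrite -se pmulr_rle0// pmulr_rle0.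
have -> : t * etaerr t = - (t * Lq t) + pi ^+ 2 / 6 + t * (ln s / 2).
  by rewrite /etaerr -/s; field; rewrite gt_eqF.
rewrite ler_norml; move: h1 h2; rewrite (mulrC (Lq t) t).
move: (pi ^+ 2 / 6) (pi ^+ 2 / n.+1%:R) hn (t * Lq t) (t * n.+1%:R) h3 (t * n%:R) h3' (t * (ln s / 2)) h6 h7.
by move=> *; apply/andP; split; lra.
Unshelve. all: by end_near. Qed.

Lemma near_right0P (P : set R) :
  (\forall t \near 0^'+, P t) <-> exists2 d, 0 < d & forall t, 0 < t < d -> P t.
Proof.
split=> [[d /= d0 h]|[d d0 h]].
  exists d => // t /andP[t0 td]; apply: h => //=.
  by rewrite sub0r normrN gtr0_norm.
near=> t; apply: h; apply/andP; split; near: t; [exact: nbhs_right_gt|exact: nbhs_right_lt].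
Unshelve. all: by end_near. Qed.

(* Halving [t] doubles [etaerr] up to an error [e], so a value above [e] would
   make [t * etaerr t] stay away from [0] along [t / 2 ^ k]. *)
Lemma cvg_etaerr : etaerr t @[t --> 0^'+] --> (0 : R).
Proof.
apply/cvgr0Pnorm_le => e e0.
have e2 : 0 < e / 2 by rewrite divr_gt0.
have := cvg_etaerr_dyadic; move/cvgr0Pnorm_le => /(_ _ e2)/near_right0P[d d0 hd].
apply/near_right0P; exists d => // t /andP[t0 td].
have tk0 k : 0 < t / 2 ^+ k by rewrite divr_gt0 ?exprn_gt0.
have tkt k : t / 2 ^+ k <= t.
  by rewrite ler_pdivrMr ?exprn_gt0// ler_peMr ?(ltW t0)// exprn_ege1// ler1n.
have step k : `|etaerr t| <= e / 2 * (1 - 2 ^- k) + `|etaerr (t / 2 ^+ k)| * 2 ^- k.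
  elim: k => [|k ih].
    by rewrite !expr0 !(invr1, divr1, mulr1, subrr, mulr0, add0r).
  apply: (le_trans ih).
  have : `|etaerr (t / 2 ^+ k / 2) - 2 * etaerr (t / 2 ^+ k)| <= e / 2.
    by apply: hd; rewrite tk0 (le_lt_trans (tkt k)).
  have -> : t / 2 ^+ k / 2 = t / 2 ^+ k.+1 by rewrite exprSr invfM mulrA.
  have p0 : 0 < 2 ^- k :> R by rewrite invr_gt0 exprn_gt0.
  have -> : 2 ^- k.+1 = 2 ^- k / 2 :> R by rewrite exprSr invfM.
  move: p0; move: (etaerr (t / 2 ^+ k)) => a; move: (etaerr _) => b.
  move: (2 ^- k) => p p0 h.
  have h2 : 2 * `|a| <= e / 2 + `|b|.
    have -> : 2 * `|a| = `|2 * a| by rewrite normrM gtr0_norm.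
    rewrite (_ : 2 * a = b - (b - 2 * a)); last by ring.
    by apply: le_trans (ler_normB _ _) _; rewrite addrC lerD2r.
  have := ler_wpM2r (ltW p0) h2; lra.
have et : 0 < e / 2 * t by rewrite mulr_gt0.
have := cvg_mul_etaerr; move/cvgr0Pnorm_le => /(_ _ et)/near_right0P[d2 d20 hd2].
have [k hk] : exists k, t / 2 ^+ k < d2.
  have c : t * (2^-1) ^+ k @[k --> \oo] --> t * 0.
    apply: cvgMr; apply: cvg_expr; rewrite ger0_norm// invf_lt1// ltr1n//.
  rewrite mulr0 in c; move/cvgr0Pnorm_lt : c => /(_ _ d20)[k _ /(_ k (leqnn k))] /=.
  rewrite exprVn => h; exists k; exact: le_lt_trans (ler_norm _) h.
apply: (le_trans (step k)).
have := hd2 (t / 2 ^+ k); rewrite tk0 hk => /(_ isT).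
rewrite normrM gtr0_norm// => h.
have : `|etaerr (t / 2 ^+ k)| * 2 ^- k <= e / 2.
  by rewrite -(ler_pM2l t0) (mulrC t (e / 2)); move: h; congr (_ <= _); ring.
have : 0 <= e / 2 * 2 ^- k by rewrite mulr_ge0 ?invr_ge0 ?exprn_ge0// ltW.
lra.
Qed.

(** [cvg_thetal] times 2 pi exp (2 [etaerr] t): the logarithm contained in [etaerr] turns this
    factor into one that cancels the division by t, and [Lq] disappears. *)
Lemma cvg_thetal_exp x : 0 < x -> x < 1 ->
  thetal x t * expR (pi ^+ 2 / 3 / t) @[t --> 0^'+] --> 2 * sin (pi * x).
Proof.
move=> x0 x1; have p0 := @pi_gt0 R.
have c1 := @cvg_thetal R x x0 x1.
have c2 : 2 * pi * expR (2 * etaerr t) @[t --> 0^'+] --> 2 * pi * expR (2 * 0).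
  apply: cvgMr; apply: (continuous_cvg _ (@continuous_expR R _)).
  by apply: cvgMr; exact: cvg_etaerr.
have c3 : (thetal x t * expR (Lq t) ^+ 2 / t) * (2 * pi * expR (2 * etaerr t)) @[t --> 0^'+]
    --> sin (pi * x) / pi * (2 * pi * expR (2 * 0)) by exact: cvgM.
move: c3; rewrite mulr0 expR0 mulr1.
have pn0 : pi != 0 :> R by rewrite gt_eqF.
have -> : sin (pi * x) / pi * (2 * pi) = 2 * sin (pi * x).
  by rewrite mulrCA divfK.
apply: cvg_trans; apply: near_eq_cvg; near=> t.
have t0 : 0 < t by near: t; exact: nbhs_right_gt.
have p2 : 0 < t / (2 * pi) by rewrite divr_gt0 ?mulr_gt0.
have -> : 2 * etaerr t = 2 * - Lq t + pi ^+ 2 / 3 / t + ln (t / (2 * pi)).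
  by rewrite /etaerr; field; rewrite gt_eqF.
rewrite /= !expRD lnK ?posrE// expRM_natl expRN exprVn.
have : expR (Lq t) != 0 by rewrite gt_eqF ?expR_gt0.
move: (expR (Lq t)) (expR _) (thetal x t) (pi : R) pn0 => a b c p pn0 a0.
by field; rewrite a0 pn0 gt_eqF.
Unshelve. all: by end_near. Qed.

End EtaAsymptotics.

(** * Counting stacks *)

Section Parts.
Local Open Scope nat_scope.
Variables (r m : nat) (r_gt0 : 0 < r) (r_lt : 2 * r < m).

(* The integers congruent to [r] or [- r] modulo [m], in increasing order: the
   even indices give the former, the odd ones the latter. *)
Definition part (i : nat) : nat :=
  if odd i then (i./2).+1 * m - r else i./2 * m + r.

Lemma part_even k : part (2 * k) = k * m + r.
Proof. by rewrite /part mul2n odd_double doubleK. Qed.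

Lemma part_odd k : part (2 * k).+1 = k.+1 * m - r.
Proof. by rewrite /part mul2n /= odd_double /= uphalf_double. Qed.

Lemma parity_ind (P : nat -> Prop) :
  (forall k, P (2 * k)) -> (forall k, P (2 * k).+1) -> forall i, P i.
Proof.
move=> P0 P1 i; rewrite -(odd_double_half i) -mul2n.
by case: (odd i); [rewrite add1n|rewrite add0n].
Qed.

Lemma part_ltS i : part i < part i.+1.
Proof.
elim/parity_ind: i => k; rewrite ?part_odd ?part_even.
  by rewrite mulSn; clear -r_lt; lia.
rewrite (_ : (2 * k).+2 = 2 * k.+1) ?part_even; last by rewrite mulnS.
by rewrite mulSn; clear -r_lt r_gt0; lia.
Qed.

Lemma part_leS i : part i.+1 <= part i + m.
Proof.
elim/parity_ind: i => k; rewrite ?part_odd ?part_even.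
  by rewrite mulSn; clear -r_lt; lia.
rewrite (_ : (2 * k).+2 = 2 * k.+1) ?part_even; last by rewrite mulnS.
by rewrite mulSn; clear -r_lt r_gt0; lia.
Qed.

Lemma ltn_part : {homo part : i j / i < j}.
Proof. exact: (homo_ltn ltn_trans part_ltS). Qed.

Lemma part_gt i : i < part i.
Proof.
elim: i => [|i ih]; first by rewrite /part mul0n add0n.
exact: leq_ltn_trans ih (part_ltS i).
Qed.

Lemma part_gt0 i : 0 < part i.
Proof. exact: leq_ltn_trans (part_gt i). Qed.

(** By [partAS] and [partBS], [partA] and [partB] hold exactly for the parts of even, respectively
    odd, index below j. The class of - r is tested by m dividing y + r, which avoids a
    subtraction. *)
Definition partA j y := (y %% m == r) && (y < part j).
Definition partB j y := [&& m %| y + r, 0 < y & y < part j].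

Let rm : r < m.
Proof. by clear -r_lt; lia. Qed.

Let m0 : 0 < m.
Proof. by clear -r_lt; lia. Qed.

Lemma partAP y : y %% m = r -> exists q, y = q * m + r.
Proof. by move=> e; exists (y %/ m); rewrite {1}(divn_eq y m) e. Qed.

Lemma partBP y : m %| y + r -> 0 < y -> exists q, y = q.+1 * m - r.
Proof.
move=> /dvdnP[[|q] e] y0; first by exfalso; clear -e y0; lia.
by exists q; rewrite -e addnK.
Qed.

Lemma modn_part k : (k * m + r) %% m = r.
Proof. by rewrite modnMDl modn_small. Qed.

Lemma dvdn_part k : m %| k.+1 * m - r + r.
Proof. by rewrite subnK ?dvdn_mull// mulSn (leq_trans (ltnW rm))// leq_addr. Qed.

Lemma partA0 y : partA 0 y = false.
Proof.
apply/negP => /andP[/eqP/partAP[q ->]]; rewrite /part/= mul0n add0n.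
by clear; lia.
Qed.

Lemma partB0 y : partB 0 y = false.
Proof.
apply/negP => /and3P[/partBP h /h[q ->]]; have -> : part 0 = r by [].
by rewrite mulSn; clear -r_lt; lia.
Qed.

Lemma partAS j y : partA j.+1 y = partA j y || (~~ odd j && (y == part j)).
Proof.
apply/idP/idP; last first.
  move=> /orP[/andP[yr yj]|/andP[oj /eqP ->]].
    by rewrite /partA yr (ltn_trans yj)// part_ltS.
  rewrite /partA part_ltS andbT /part (negbTE oj) modn_part//.
move=> /andP[yr]; rewrite /partA yr/=.
have [//|jy yj] := ltnP y (part j).
move/eqP: yr => /partAP[q yq]; move: jy yj.
elim/parity_ind: j => k; rewrite ?part_odd ?part_even yq.
  rewrite mul2n odd_double/= mulSn => h1 h2.
  have -> : q = k; last by [].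
  by clear -h1 h2 r_lt r_gt0 m0; nia.
rewrite (_ : (2 * k).+2 = 2 * k.+1) ?part_even; last by rewrite mulnS.
rewrite mulSn => h1 h2; exfalso.
have : q < k.+1 by rewrite -(ltn_pmul2r m0) mulSn; clear -h2; lia.
rewrite ltnS => h3; have h4 : q * m <= k * m by rewrite leq_mul2r h3 orbT.
by move: h1 h4 r_lt; clear; lia.
Qed.

Lemma partBS j y : partB j.+1 y = partB j y || (odd j && (y == part j)).
Proof.
apply/idP/idP; last first.
  move=> /orP[/and3P[yr y0 yj]|/andP[oj /eqP ->]].
    by rewrite /partB yr y0 (ltn_trans yj)// part_ltS.
  by rewrite /partB part_ltS part_gt0 !andbT /part oj dvdn_part.
move=> /and3P[yr y0]; rewrite /partB yr y0/=.
have [//|jy yj] := ltnP y (part j).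
have [q yq] := partBP y yr y0; move: jy yj.
elim/parity_ind: j => k; rewrite ?part_odd ?part_even yq.
  rewrite !mulSn => h1 h2; exfalso.
  have h3 : q * m < k * m by clear -h2 r_lt; lia.
  have h4 : q.+1 * m <= k * m by rewrite leq_mul2r -(ltn_pmul2r m0) h3 orbT.
  by rewrite mulSn in h4; clear -h1 h4 r_lt r_gt0; lia.
rewrite (_ : (2 * k).+2 = 2 * k.+1) ?part_even; last by rewrite mulnS.
rewrite mul2n/= odd_double/= => h1 h2.
have h3 : q.+1 * m < k.+2 * m.
  by rewrite mulSn in h2; rewrite [k.+2 * m]mulSn; clear -h2 r_lt; lia.
have h4 : k.+1 * m <= q.+1 * m.
  have : r <= q.+1 * m by rewrite mulSn; clear -r_lt; lia.
  have : r <= k.+1 * m by rewrite mulSn; clear -r_lt; lia.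
  by clear -h1; lia.
have -> : q = k; last by [].
move: h3 h4; rewrite ltn_pmul2r// leq_pmul2r//; clear; lia.
Qed.

Lemma sorted_cat_nseq (s : seq nat) i x :
  sorted leq s -> all (fun y => y <= x) s -> sorted leq (s ++ nseq i x).
Proof.
rewrite !(sorted_pairwise leq_trans) pairwise_cat => -> sx /=.
apply/andP; split.
  apply/allrelP => y z ys; rewrite mem_nseq => /andP[_ /eqP ->]; exact: (allP sx).
by elim: i => //= i ->; rewrite andbT all_nseq leqnn orbT.
Qed.

Lemma sorted_split (P : pred nat) x (s : seq nat) : sorted leq s ->
  (forall y, P y -> y < x) -> all (fun y => P y || (y == x)) s ->
  s = [seq y <- s | P y] ++ nseq (count (predC P) s) x.
Proof.
move=> ss Px aP.
have sf : sorted leq ([seq y <- s | P y] ++ nseq (count (predC P) s) x).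
  apply: sorted_cat_nseq; first exact: (sorted_filter leq_trans).
  by apply/allP => y; rewrite mem_filter => /andP[/Px/ltnW].
apply: (sorted_eq leq_trans anti_leq ss sf).
have -> : nseq (count (predC P) s) x = [seq y <- s | predC P y].
  rewrite -size_filter; apply/esym/all_pred1P/allP => y; rewrite mem_filter => /andP[/= nP ys].
  by have := allP aP y ys; rewrite (negbTE nP).
by rewrite perm_sym perm_filterC.
Qed.

Definition addparts j i (ab : seq nat * seq nat) :=
  if odd j then (ab.1, ab.2 ++ nseq i (part j)) else (ab.1 ++ nseq i (part j), ab.2).

(** A pair is a partition of n into the parts of index below j, stored by residue class; [i] is the
    multiplicity of the largest available part. *)
Fixpoint mpairs j n : seq (seq nat * seq nat) :=
  if j is j'.+1 then
    [seq addparts j' i ab | i <- iota 0 (n %/ part j').+1,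
                            ab <- mpairs j' (n - i * part j')]
  else if n == 0 then [:: ([::], [::])] else [::].

Definition npairs j n := size (mpairs j n).

Lemma npairs0 n : npairs 0 n = (n == 0).
Proof. by rewrite /npairs /=; case: eqP. Qed.

Lemma npairsE j n : npairs j.+1 n = \sum_(i < (n %/ part j).+1) npairs j (n - i * part j).
Proof.
rewrite /npairs [mpairs j.+1 n]/(mpairs _ _) size_allpairs_dep sumnE big_map.
have -> : iota 0 (n %/ part j).+1 = index_iota 0 (n %/ part j).+1 by rewrite /index_iota subn0.
by rewrite big_mkord.
Qed.

(** Either part j is absent or one copy of it is removed; this is the recurrence [US] on which the
    Fourier coefficients rest. *)
Lemma npairsS j n :
  npairs j.+1 n = npairs j n + (if part j <= n then npairs j.+1 (n - part j) else 0).
Proof.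
rewrite npairsE big_ord_recl mul0n subn0; congr (_ + _).
have x0 := part_gt0 j.
case: leqP => xn; last by rewrite divn_small// big_ord0.
have -> : n %/ part j = ((n - part j) %/ part j).+1.
  by rewrite -{1}(subnK xn) divnDr// divnn x0 addn1.
rewrite npairsE.
by apply: eq_bigr => i _; rewrite /= /bump leq0n add1n mulSn subnDA.
Qed.

Lemma sum_part_divn i j n k : i * part j + k = n -> i < (n %/ part j).+1.
Proof. by move=> <-; rewrite ltnS leq_divRL ?part_gt0// leq_addr. Qed.

Lemma mem_mpairs j n a b : ((a, b) \in mpairs j n) =
  [&& sorted leq a, sorted leq b, all (partA j) a, all (partB j) b & sumn a + sumn b == n].
Proof.
elim: j n a b => [|j ih] n a b.
  rewrite /=; have -> : all (partA 0) a = (a == [::]) by case: a => //= y a; rewrite partA0.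
  have -> : all (partB 0) b = (b == [::]) by case: b => //= y b; rewrite partB0.
  case: (eqVneq n 0) => [->|n0].
    rewrite inE -pair_eqE/=; case: eqP => [->|]; last by rewrite !andbF.
    by case: eqP => [->|]; rewrite ?andbF.
  rewrite in_nil; case: eqP => [->|]; last by rewrite !andbF.
  by case: eqP => [->|]; rewrite ?andbF//= eq_sym (negbTE n0).
apply/idP/idP.
  move=> /allpairsPdep[i [[a' b']]][]; rewrite mem_iota add0n => /andP[_ hi].
  have ix : i * part j <= n by rewrite -leq_divRL ?part_gt0.
  rewrite ih => /and5P[sa sb pa pb /eqP e].
  have aA : all (fun y => y <= part j) a'.
    by apply/allP => y /(allP pa)/andP[_ /ltnW].
  have bB : all (fun y => y <= part j) b'.
    by apply/allP => y /(allP pb)/and3P[_ _ /ltnW].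
  have paS : all (partA j.+1) a' by apply/allP => y /(allP pa) h; rewrite partAS h.
  have pbS : all (partB j.+1) b' by apply/allP => y /(allP pb) h; rewrite partBS h.
  rewrite /addparts; case: ifP => oj [-> ->] /=.
    rewrite sa paS sorted_cat_nseq//= all_cat pbS all_nseq partBS oj eqxx orbT orbT/=.
    by rewrite sumn_cat sumn_nseq addnA e (mulnC (part j)) subnK.
  rewrite sb pbS sorted_cat_nseq//= all_cat paS all_nseq partAS oj eqxx orbT orbT/=.
  by rewrite sumn_cat sumn_nseq addnAC e (mulnC (part j)) subnK.
move=> /and5P[sa sb pa pb /eqP e]; apply/allpairsPdep.
case oj : (odd j).
  have pa' : all (partA j) a by apply/allP => y /(allP pa); rewrite partAS oj orbF.
  have pb' : all (fun y => partB j y || (y == part j)) b.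
    by apply/allP => y /(allP pb); rewrite partBS oj.
  have := sorted_split (partB j) (part j) b sb _ pb'.
  move=> /(_ _)/wrap[]; first by move=> y /and3P[].
  set k := count _ b => eb.
  have eb2 : sumn b = sumn ([seq y <- b | partB j y]) + k * part j.
    by rewrite {1}eb sumn_cat sumn_nseq mulnC.
  exists k, (a, [seq y <- b | partB j y]); split; last by rewrite /addparts oj -eb.
    rewrite mem_iota add0n leq0n (sum_part_divn k j n (sumn a + sumn ([seq y <- b | partB j y])))//.
    by rewrite -e eb2; clear; lia.
  rewrite ih sa (sorted_filter leq_trans)//= pa' filter_all/= -e eb2 addnA addnK//.
have pb' : all (partB j) b by apply/allP => y /(allP pb); rewrite partBS oj orbF.
have pa' : all (fun y => partA j y || (y == part j)) a.
  by apply/allP => y /(allP pa); rewrite partAS oj.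
have := sorted_split (partA j) (part j) a sa _ pa'.
move=> /(_ _)/wrap[]; first by move=> y /andP[].
set k := count _ a => ea.
have ea2 : sumn a = sumn ([seq y <- a | partA j y]) + k * part j.
  by rewrite {1}ea sumn_cat sumn_nseq mulnC.
exists k, ([seq y <- a | partA j y], b); split; last by rewrite /addparts oj -ea.
  rewrite mem_iota add0n leq0n (sum_part_divn k j n (sumn ([seq y <- a | partA j y]) + sumn b))//.
  by rewrite -e ea2; clear; lia.
by rewrite ih sb (sorted_filter leq_trans)//= pb' filter_all/= -e ea2 addnAC addnK eqxx.
Qed.

Lemma mpairs_uniq j n : uniq (mpairs j n).
Proof.
elim: j n => [|j ih] n; first by rewrite /=; case: eqP.
apply: allpairs_uniq_dep; [exact: iota_uniq|by move=> i _; exact: ih|].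
have nA i ab : ab \in mpairs j (n - i * part j) ->
    count_mem (part j) ab.1 = 0 /\ count_mem (part j) ab.2 = 0.
  case: ab => a b; rewrite mem_mpairs => /and5P[_ _ pa pb _].
  split; apply/count_memPn/negP.
    by move=> /(allP pa)/andP[_]; rewrite ltnn.
  by move=> /(allP pb)/and3P[_ _]; rewrite ltnn.
move=> _ _ /allpairsPdep[i [ab [_ hab ->]]] /allpairsPdep[i' [ab' [_ hab' ->]]] /=.
have [ca cb] := nA _ _ hab; have [ca' cb'] := nA _ _ hab'.
move: ab ab' {hab hab'} ca cb ca' cb' => [a b] [a' b'] /= ca cb ca' cb'.
rewrite /addparts; case: ifP => _ /= [].
  move=> -> e; have ei : i = i'.
    have := congr1 (count_mem (part j)) e.
    by rewrite !count_cat !count_nseq /= eqxx cb cb' !mul1n.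
  move: e; rewrite ei => e; move/eqP: (e); rewrite eqseq_cat; last first.
    have := congr1 size e; rewrite !size_cat !size_nseq => /addIn//.
  by move=> /andP[/eqP ->].
move=> e ->; have ei : i = i'.
  have := congr1 (count_mem (part j)) e.
  by rewrite !count_cat !count_nseq /= eqxx ca ca' !mul1n.
move: e; rewrite ei => e; move/eqP: (e); rewrite eqseq_cat; last first.
  have := congr1 size e; rewrite !size_cat !size_nseq => /addIn//.
by move=> /andP[/eqP ->].
Qed.

(** With peak [part (2 * k)] both flanks use indices up to 2k: the left one may repeat the peak,
    whereas the right one has odd indices only and so stays strictly below. This reproduces the weak
    and the strict inequality next to the peak. *)
Definition stack_list n : seq (seq nat * nat * seq nat) :=
  [seq (ab.1, part (2 * k), ab.2) | k <- [seq k <- iota 0 n.+1 | part (2 * k) <= n],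
     ab <- mpairs (2 * k).+1 (n - part (2 * k))].

Lemma stack_list_uniq n : uniq (stack_list n).
Proof.
apply: allpairs_uniq_dep.
- by rewrite filter_uniq// iota_uniq.
- by move=> k _; exact: mpairs_uniq.
move=> _ _ /allpairsPdep[k [[a b] [_ _ ->]]] /allpairsPdep[k' [[a' b'] [_ _ ->]]] /=.
case=> -> ek ->; have -> : k = k'; last by [].
move: ek; rewrite !part_even => /addIn/eqP; rewrite eqn_pmul2r// => /eqP; exact.
Qed.

Lemma eqz_mod_nat (x y : nat) : (x%:Z == y%:Z %[mod m%:Z])%Z = (x %% m == y %% m).
Proof. by rewrite !modz_nat. Qed.

Lemma eqz_mod_opp (y : nat) : (y%:Z == (- r%:Z)%R %[mod m%:Z])%Z = (m %| y + r).
Proof. by rewrite eqz_mod_dvd opprK -PoszD dvdzE. Qed.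

Lemma mem_stack_list n s : (s \in stack_list n) = mixed_congruence_stack r m n s.
Proof.
case: s => [[a c] b]; apply/idP/idP.
  move=> /allpairsPdep[k [[a' b'] []]]; rewrite mem_filter => /andP[kn _].
  rewrite mem_mpairs => /and5P[sa sb pa pb /eqP e] [-> -> ->] /=.
  have ck := part_even k.
  rewrite /mixed_congruence_stack part_gt0/=.
  have -> : all (ltn 0) a'.
    apply/allP => y /(allP pa)/andP[/eqP/partAP[q ->] _].
    by apply: (leq_trans r_gt0); exact: leq_addl.
  have -> : all (ltn 0) b' by apply/allP => y /(allP pb)/and3P[].
  have bc : all (fun y => y < part (2 * k)) b'.
    apply/allP => y /(allP pb); rewrite partBS mul2n odd_double/= orbF => /and3P[].
    by rewrite -mul2n.
  have ac : all (fun y => y <= part (2 * k)) a'.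
    apply/allP => y /(allP pa); rewrite partAS => /orP[/andP[_ /ltnW]//|/andP[_ /eqP ->]].
    exact: leqnn.
  rewrite -cats1 (sorted_cat_nseq a' 1)// sb bc/=.
  have -> : all (fun x => (x%:Z == r%:Z %[mod m%:Z])%Z) a'.
    by apply/allP => y /(allP pa)/andP[/eqP h _]; rewrite eqz_mod_nat h modn_small.
  rewrite eqz_mod_nat ck modn_part (modn_small rm) eqxx/= -ck.
  have -> : all (fun y => (y%:Z == (- r%:Z)%R %[mod m%:Z])%Z) b'.
    by apply/allP => y /(allP pb)/and3P[h _ _]; rewrite eqz_mod_opp.
  by rewrite /= addnAC e subnK.
move=> /andP[/andP[/andP[/and3P[a0 c0 b0] /and3P[sac sb bc]] /and3P[am cm bm]] /eqP e].
rewrite eqz_mod_nat (modn_small rm) in cm.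
have [k ck] := partAP c (eqP cm).
have cE : c = part (2 * k) by rewrite part_even.
have cn : c <= n by rewrite -e addnAC leq_addl.
apply/allpairsPdep; exists k, (a, b); split; last by rewrite cE.
  rewrite mem_filter -cE cn mem_iota add0n/= ltnS.
  apply: leq_trans cn; rewrite ck; clear -m0; nia.
have sa : sorted leq a.
  by move: sac; rewrite -cats1 => /cat_sorted2[].
have ac : all (fun y => y <= c) a.
  move: sac; rewrite (sorted_pairwise leq_trans) pairwise_rcons => /andP[h _].
  exact: h.
rewrite mem_mpairs sa sb -cE -e addnAC addnK eqxx andbT /=.
apply/andP; split; apply/allP => y yin.
  rewrite /partA (leq_ltn_trans (allP ac y yin)) ?andbT; last by rewrite cE part_ltS.
  by have := allP am y yin; rewrite eqz_mod_nat (modn_small rm).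
rewrite /partB (ltn_trans (allP bc y yin)) ?andbT; last by rewrite cE part_ltS.
by have := allP bm y yin; rewrite eqz_mod_opp => ->; exact: (allP b0).
Qed.

Lemma num_stacksE n : num_mixed_congruence_stacks r m n =
  \sum_(k < n.+1 | part (2 * k) <= n) npairs (2 * k).+1 (n - part (2 * k)).
Proof.
rewrite /num_mixed_congruence_stacks.
have -> : fset_set (mixed_congruence_stacks r m n) = finmap.seq_fset tt (stack_list n).
  apply/finmap.fsetP => s; rewrite in_fset_set; last exact: finite_mixed_congruence_stacks.
  rewrite finmap.seq_fsetE mem_stack_list.
  by apply/idP/idP; [move=> /set_mem|move=> h; apply/mem_set].
rewrite finmap.size_seq_fset undup_id ?stack_list_uniq//.
rewrite /stack_list size_allpairs_dep sumnE big_map big_filter.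
have -> : iota 0 n.+1 = index_iota 0 n.+1 by rewrite /index_iota subn0.
by rewrite big_mkord.
Qed.

End Parts.

(** * Summation over the peak *)

Section LargestPart.
Context {R : realType}.
Variables (x : nat -> nat) (m : nat) (J : nat) (s : R).
Hypothesis x_gt0 : forall i, (0 < x i)%N.
Hypothesis x_ltS : forall i, (x i < x i.+1)%N.
Hypothesis x_leS : forall i, (x i.+1 <= x i + m)%N.
Hypothesis s_gt0 : 0 < s.

Definition tailp (j : nat) : R := \prod_(j <= i < J) (1 - rpow s (x i)).
(** Characteristic function of k times a geometric variable with ratio [rpow s k]; hence [headz] is
    that of the total size when only the first j parts are available. *)
Definition zfac (t : R) (k : nat) : R[i] := real_complex R (1 - rpow s k) / (1 - qpow s t k).
Definition headz (t : R) (j : nat) : R[i] := \prod_(i < j) zfac t (x i).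
(** Give the parts independent geometric multiplicities: this is the characteristic function of the
    total size restricted to the event that x_j is the largest part present. The factor [tailp] says
    that later parts are absent, and [qpow] accounts for one forced copy of x_j. At t = 0 it is the
    probability of that event. *)
Definition aterm (t : R) (j : nat) : R[i] :=
  qpow s t (x j) * real_complex R (tailp j.+1) * headz t j.+1.

Lemma sub1_rpow_itv k : (0 < k)%N -> 0 < 1 - rpow s k <= 1.
Proof.
move=> k0; have := rpow_lt1 s k s_gt0 k0; have := rpow_ge0 s k.
by move=> *; apply/andP; split; lra.
Qed.

Lemma tailpE j : (j < J)%N -> tailp j = (1 - rpow s (x j)) * tailp j.+1.
Proof. by move=> jJ; rewrite /tailp big_ltn. Qed.

Lemma tailpJ : tailp J = 1.
Proof. by rewrite /tailp big_geq. Qed.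

Lemma tailp_gt0 j : 0 < tailp j.
Proof. by apply: prodr_gt0 => i _; case/andP: (sub1_rpow_itv (x i) (x_gt0 i)). Qed.

Lemma tailp_le1 j : tailp j <= 1.
Proof.
suff : 0 <= tailp j <= 1 by case/andP.
rewrite /tailp; elim/big_ind : _ => [|a b /andP[a0 a1] /andP[b0 b1]|i _].
- by rewrite ler01 lexx.
- by rewrite mulr_ge0// mulr_ile1.
by case/andP: (sub1_rpow_itv (x i) (x_gt0 i)) => /ltW -> ->.
Qed.
Lemma rpow_tailp j : (j < J)%N -> rpow s (x j) * tailp j.+1 = tailp j.+1 - tailp j.
Proof. by move=> jJ; rewrite [tailp j]tailpE//; ring. Qed.

Lemma sum_rpow_tailp a b : (a <= b <= J)%N ->
  \sum_(a <= j < b) rpow s (x j) * tailp j.+1 = tailp b - tailp a.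
Proof.
move=> /andP[ab bJ]; rewrite -telescope_sumr//; apply: eq_big_nat => j /andP[_ jb].
by rewrite rpow_tailp// (leq_trans jb).
Qed.

Lemma normc_zfac_le1 t k : (0 < k)%N -> normc (zfac t k) <= 1.
Proof.
move=> k0; have /andP[r0 r1] := sub1_rpow_itv k k0.
rewrite /zfac normcM normc_inv normc_real (ger0_norm (ltW r0)).
have h := sub1_qpow_ge s t k.
by rewrite ler_pdivrMr ?mul1r//; exact: lt_le_trans h.
Qed.

Lemma headz0 t : headz t 0 = 1.
Proof. by rewrite /headz big_ord0. Qed.

Lemma headzS t j : headz t j.+1 = headz t j * zfac t (x j).
Proof. by rewrite /headz big_ord_recr. Qed.

Lemma headzSM t j :
  (1 - qpow s t (x j)) * headz t j.+1 = real_complex R (1 - rpow s (x j)) * headz t j.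
Proof.
rewrite headzS /zfac; have := sub1_qpow_neq0 s t (x j) s_gt0 (x_gt0 j).
by move=> q0; rewrite mulrCA (mulrC (headz t j)) (mulrCA _ _ _^-1) divff// mulr1.
Qed.

Lemma normc_headz_le1 t j : normc (headz t j) <= 1.
Proof.
elim: j => [|j ih]; first by rewrite headz0 normc1.
by rewrite headzS normcM mulr_ile1 ?normc_ge0 ?normc_zfac_le1.
Qed.

Lemma normc_headz_le t i j : (i <= j)%N -> normc (headz t j) <= normc (headz t i).
Proof.
move=> /subnK <-; elim: (j - i)%N => [|k ih]; first by rewrite add0n.
rewrite addSn headzS normcM; apply: le_trans ih.
by rewrite ler_piMr ?normc_ge0 ?normc_zfac_le1.
Qed.

Lemma genfS t j : genf x s j.+1 t = genf x s j t * (1 - qpow s t (x j))^-1.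
Proof. by rewrite /genf big_ord_recr. Qed.

Lemma headz_genf t j : (j <= J)%N ->
  real_complex R (tailp j) * headz t j = real_complex R (tailp 0) * genf x s j t.
Proof.
elim: j => [_|j ih jJ]; first by rewrite headz0 /genf big_ord0.
rewrite genfS mulrA -ih ?(ltnW jJ)// [tailp j]tailpE// headzS /zfac rmorphM/=.
by move: (_^-1) => a; ring.
Qed.

Lemma atermE t j : (j < J)%N ->
  aterm t j = real_complex R (tailp 0) * (qpow s t (x j) * genf x s j.+1 t).
Proof.
by move=> jJ; rewrite /aterm -mulrA headz_genf//; ring.
Qed.

Lemma normc_aterm t j : normc (aterm t j) = rpow s (x j) * tailp j.+1 * normc (headz t j.+1).
Proof.
rewrite /aterm [LHS]normcM [X in X * _ = _]normcM normc_qpow normc_real.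
by rewrite ger0_norm ?ltW ?tailp_gt0.
Qed.

Lemma atermD t j : (j < J)%N ->
  aterm t j = real_complex R (tailp j.+1) * headz t j.+1 - real_complex R (tailp j) * headz t j.
Proof.
move=> jJ; rewrite [tailp j]tailpE// rmorphM/=.
transitivity (real_complex R (tailp j.+1) * headz t j.+1 - real_complex R (tailp j.+1) *
  (real_complex R (1 - rpow s (x j)) * headz t j)); last by ring.
by rewrite -headzSM /aterm; ring.
Qed.

Lemma sum_aterm t : \sum_(0 <= j < J) aterm t j = headz t J - real_complex R (tailp 0).
Proof.
under eq_big_nat => j /andP[_ jJ] do rewrite atermD//.
by rewrite telescope_sumr// tailpJ headz0 rmorph1 mul1r mulr1.
Qed.

(** The common factor leaves two small quantities: the difference of the powers, small as the gap
    between consecutive parts is at most m, and their product, which is summable by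
    [sum_tailp_rpow_sqr]. *)
Lemma aterm_subS t j : (j.+1 < J)%N -> aterm t j.+1 - aterm t j =
  real_complex R (tailp j.+2) * headz t j.+2 *
  (qpow s t (x j.+1) - qpow s t (x j) + qpow s t (x j) * qpow s t (x j.+1)).
Proof.
move=> jJ; rewrite /aterm [tailp j.+1]tailpE// rmorphM/=.
transitivity (qpow s t (x j.+1) * real_complex R (tailp j.+2) * headz t j.+2 -
  qpow s t (x j) * real_complex R (tailp j.+2) *
  (real_complex R (1 - rpow s (x j.+1)) * headz t j.+1)); first by ring.
by rewrite -headzSM; ring.
Qed.

Lemma rpow_subS_le j : rpow s (x j) - rpow s (x j.+1) <= m%:R * s * rpow s (x j).
Proof.
rewrite -(subnKC (ltnW (x_ltS j))) rpowD.
have h : 1 - m%:R * s <= rpow s (x j.+1 - x j).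
  apply: le_trans (ler_rpow s _ m s_gt0 _); last by rewrite leq_subLR.
  by rewrite /rpow; apply: le_trans (expR_ge1Dx _).
have := ler_wpM2l (rpow_ge0 s (x j)) h; lra.
Qed.

Lemma normc_cis_sub1 (t : R) : normc (cis t - 1) <= `|t|.
Proof.
rewrite -(@ler_pXn2r _ 2)// ?nnegrE ?normc_ge0// normc_sqr real_normK ?num_real//.
have -> : cRe (cis t - 1) = cos t - 1 by rewrite ReB.
have -> : cIm (cis t - 1) = sin t by rewrite /= subr0.
have := subr1_cos_le t; have := cos2Dsin2 t.
move: (cos t) (sin t) => c d; rewrite !expr2; lra.
Qed.

Lemma qpow_subS_le t j :
  normc (qpow s t (x j.+1) - qpow s t (x j)) <= m%:R * (s + `|t|) * rpow s (x j).
Proof.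
rewrite -(subnKC (ltnW (x_ltS j))); set d := (x j.+1 - x j)%N.
have dm : (d <= m)%N by rewrite leq_subLR.
have -> : qpow s t (x j + d) - qpow s t (x j) = qpow s t (x j) *
   (real_complex R (rpow s d) * (cis (d%:R * t) - 1) - real_complex R (1 - rpow s d)).
  by rewrite /qpow rpowD natrD mulrDl cisD rmorphM/= rmorphB/= rmorph1; ring.
rewrite normcM normc_qpow mulrC; apply: ler_wpM2r; first exact: rpow_ge0.
apply: le_trans (normcB _ _) _.
rewrite normcM !normc_real.
have d1 : 1 - m%:R * s <= rpow s d.
  apply: le_trans (ler_rpow s _ m s_gt0 dm).
  by rewrite /rpow; apply: le_trans (expR_ge1Dx _).
have d2 := rpow_le1 s d s_gt0; have d3 := rpow_ge0 s d.
rewrite [`|1 - _|]ger0_norm ?subr_ge0// ger0_norm//.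
have h : normc (cis (d%:R * t) - 1) <= m%:R * `|t|.
  apply: le_trans (normc_cis_sub1 _) _; rewrite normrM ger0_norm//.
  by rewrite ler_wpM2r// ler_nat.
have : rpow s d * normc (cis (d%:R * t) - 1) <= 1 * normc (cis (d%:R * t) - 1).
  by rewrite ler_wpM2r ?normc_ge0.
lra.
Qed.

(** The weights [tailp] times [rpow] have total mass at most 1 and sit where [rpow] is already
    small. With p, p' consecutive powers and c = m s, the induction closes as (1 - p)(p + c) + p ^ 2
    = p + c - p c <= p' + c. *)
Lemma sum_tailp_rpow_sqr :
  \sum_(0 <= j < J) tailp j.+1 * rpow s (x j) ^+ 2 <= m%:R * s + rpow s J.
Proof.
have h b : (b <= J)%N -> \sum_(0 <= j < b) tailp j.+1 * rpow s (x j) ^+ 2 <=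
    tailp b * (rpow s (x b) + m%:R * s).
  elim: b => [_|b ih bJ].
    rewrite big_geq//; apply: mulr_ge0; first by rewrite ltW ?tailp_gt0.
    by rewrite addr_ge0 ?rpow_ge0// mulr_ge0// ltW.
  rewrite big_nat_recr//=; apply: (le_trans (lerD (ih (ltnW bJ)) (lexx _))).
  rewrite [tailp b]tailpE//.
  have := ler_wpM2l (ltW (tailp_gt0 b.+1)) (rpow_subS_le b).
  move: (tailp b.+1) (rpow s (x b)) (rpow s (x b.+1)) (m%:R * s) => T p p' c.
  by rewrite expr2; lra.
apply: (le_trans (h J (leqnn J))); rewrite tailpJ mul1r addrC lerD2l.
apply: ler_rpow => //; elim: J => // j; exact: (fun h => leq_ltn_trans h (x_ltS j)).
Qed.

Lemma sum_double (V : zmodType) (F : nat -> V) N :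
  \sum_(0 <= i < 2 * N) F i = \sum_(k < N) (F (2 * k)%N + F (2 * k).+1).
Proof.
elim: N => [|N ih]; first by rewrite muln0 big_geq// big_ord0.
by rewrite mulnS !addSn add0n !big_nat_recr//= ih big_ord_recr/= addrA.
Qed.

Lemma rpow_leS j : rpow s (x j) <= expR (m%:R * s) * rpow s (x j.+1).
Proof.
rewrite /rpow -expRD ler_expR.
have : (x j.+1)%:R <= (x j)%:R + m%:R :> R by rewrite -natrD ler_nat.
by move=> /(ler_wpM2r (ltW s_gt0)); lra.
Qed.

Lemma sum_aterm_diff t N : J = (2 * N)%N ->
  normc (\sum_(k < N) (aterm t (2 * k)%N - aterm t (2 * k).+1)) <=
  expR (m%:R * s) * (m%:R * (2 * s + `|t|) + rpow s J).
Proof.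
move=> JN; apply: le_trans (normc_sum _ _ _ _) _.
(* Each pair is charged to its odd index, but [B] is then summed over all indices, so that its first
   part telescopes. *)
pose B i := m%:R * (s + `|t|) * (rpow s (x i) * tailp i.+1) + tailp i.+1 * rpow s (x i) ^+ 2.
have B0 i : 0 <= B i.
  rewrite addr_ge0// ?mulr_ge0 ?addr_ge0 ?rpow_ge0 ?sqr_ge0 ?normr_ge0//;
  by rewrite ltW ?tailp_gt0.
have h k : (k < N)%N -> normc (aterm t (2 * k)%N - aterm t (2 * k).+1) <=
    expR (m%:R * s) * B (2 * k).+1.
  move=> kN; rewrite normc_distC aterm_subS; last by rewrite JN; clear -kN; lia.
  set j := (2 * k)%N; rewrite [leLHS]normcM [X in X * _ <= _]normcM normc_real.
  rewrite [X in X * _ * _]ger0_norm; last by rewrite ltW ?tailp_gt0.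
  rewrite -mulrA; set T := tailp _; have T0 : 0 <= T by rewrite ltW ?tailp_gt0.
  have h1 := normcD (qpow s t (x j.+1) - qpow s t (x j)) (qpow s t (x j) * qpow s t (x j.+1)).
  rewrite (normcM (qpow _ _ _)) !normc_qpow in h1.
  have h2 := qpow_subS_le t j.
  have h3 := rpow_leS j.
  have h4 : 0 <= m%:R * (s + `|t|) by rewrite mulr_ge0// addr_ge0// ltW.
  have h5 := ler_wpM2l h4 h3.
  have h6 := ler_wpM2r (rpow_ge0 s (x j.+1)) h3.
  rewrite /B -/T; set q := normc (_ + _) in h1 *.
  have q0 : 0 <= q by exact: normc_ge0.
  apply: (@le_trans _ _ (T * q)).
    rewrite ler_wpM2l// ler_piMl// normc_headz_le1//.
  rewrite [leRHS](_ : _ = T * (m%:R * (s + `|t|) * (expR (m%:R * s) * rpow s (x j.+1)) +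
     expR (m%:R * s) * rpow s (x j.+1) * rpow s (x j.+1))); last by ring.
  by rewrite ler_wpM2l//; lra.
apply: (@le_trans _ _ (expR (m%:R * s) * \sum_(0 <= i < J) B i)).
  rewrite mulr_sumr JN sum_double; apply: ler_sum => k _.
  apply: le_trans (h k (ltn_ord k)) _.
  by rewrite lerDr mulr_ge0// expR_ge0.
rewrite ler_wpM2l ?expR_ge0// big_split/= -mulr_sumr sum_rpow_tailp; last first.
  by rewrite leqnn.
rewrite tailpJ.
have h1 := sum_tailp_rpow_sqr.
have : m%:R * (s + `|t|) * (1 - tailp 0) <= m%:R * (s + `|t|).
  rewrite ler_piMr ?mulr_ge0 ?addr_ge0 ?normr_ge0//; first by rewrite ltW.
  by rewrite gerBl ltW ?tailp_gt0.
lra.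
Qed.

Lemma sum_aterm_even t N : J = (2 * N)%N ->
  normc (\sum_(k < N) aterm t (2 * k)%N - 2^-1 * headz t J) <=
  tailp 0 + expR (m%:R * s) * (m%:R * (2 * s + `|t|) + rpow s J).
Proof.
move=> JN; set S := \sum_(k < N) _; set d := \sum_(k < N) (aterm t (2 * k)%N - aterm t (2 * k).+1).
have e : 2 * S - d = headz t J - real_complex R (tailp 0).
  rewrite -sum_aterm {1}JN sum_double /S /d mulr_sumr -sumrB; apply: eq_bigr => k _; ring.
have h : normc d <= expR (m%:R * s) * (m%:R * (2 * s + `|t|) + rpow s J).
  exact: sum_aterm_diff.
have -> : S - 2^-1 * headz t J = real_complex R 2^-1 * (d - real_complex R (tailp 0)).
  have -> : real_complex R 2^-1 = 2^-1 by rewrite fmorphV rmorph_nat.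
  have -> : headz t J = 2 * S - d + real_complex R (tailp 0) by rewrite e subrK.
  by field.
rewrite normcM normc_real ger0_norm//.
have := normcB d (real_complex R (tailp 0)); rewrite normc_real.
rewrite (ger0_norm (ltW (tailp_gt0 0))).
have := normc_ge0 d; have := tailp_gt0 0; lra.
Qed.

(** Peaks of index below L require all later parts to be absent, which has total mass at most
    [tailp L]; for the other peaks every term contains the first L factors of [headz]. *)
Lemma sum_aterm_even_le t N L : J = (2 * N)%N -> (L <= J)%N ->
  normc (\sum_(k < N) aterm t (2 * k)%N) <= tailp L + normc (headz t L).
Proof.
move=> JN LJ; apply: le_trans (normc_sum _ _ _ _) _.
apply: (@le_trans _ _ (\sum_(0 <= j < J) normc (aterm t j))).
  by rewrite {1}JN sum_double; apply: ler_sum => k _; rewrite lerDl normc_ge0.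
rewrite (@big_cat_nat _ _ _ L)//=; apply: lerD.
  rewrite -[leRHS]subr0; apply: (@le_trans _ _ (tailp L - tailp 0)); last first.
    by rewrite lerD2l lerN2 ltW ?tailp_gt0.
  rewrite -sum_rpow_tailp ?LJ//; apply: ler_sum => j _.
  by rewrite normc_aterm ler_piMr ?normc_headz_le1// mulr_ge0 ?rpow_ge0 ?ltW ?tailp_gt0.
apply: (@le_trans _ _ (\sum_(L <= j < J) (rpow s (x j) * tailp j.+1) * normc (headz t L))).
  apply: ler_sum_nat => j /andP[Lj _].
  rewrite normc_aterm ler_wpM2l ?normc_headz_le ?(leq_trans Lj)//.
  by rewrite mulr_ge0 ?rpow_ge0 ?ltW ?tailp_gt0.
rewrite -mulr_suml sum_rpow_tailp ?LJ ?leqnn// ler_piMl ?normc_ge0//.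
by rewrite tailpJ gerBl ltW ?tailp_gt0.
Qed.

End LargestPart.

(** * Bounds valid on the whole circle *)

Section Domination.
Context {R : realType}.

Lemma expR_Nnat_ge (k : nat) (u : R) : u <= k%:R -> 4 ^- k <= expR (- u).
Proof.
move=> uk; have h1 : 4^-1 <= expR (- 1) :> R.
  have := expR_ge1Dx (- (1 / 2) : R) => h.
  have -> : expR (- 1) = expR (- (1 / 2)) ^+ 2 :> R by rewrite -expRM_natl; congr expR; lra.
  have : (1 / 2) ^+ 2 <= expR (- (1 / 2)) ^+ 2 :> R.
    by rewrite lerXn2r ?nnegrE ?expR_ge0//; lra.
  by apply: le_trans; rewrite expr2; lra.
apply: (@le_trans _ _ (expR (- 1) ^+ k)).
  by rewrite -exprVn lerXn2r ?nnegrE ?expR_ge0// invr_ge0.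
by rewrite -expRM_natl ler_expR mulrN1 lerN2.
Qed.

(** With p = rpow s k and g the gap, |1 - p exp (i k t)| ^ 2 = (1 - p) ^ 2 + 2 p g. As k s <= 1
    gives p >= 1/4, the square is at most 1 / (1 + g / 2), and exp (g / 4) <= 1 + g / 2 for 0 <= g
    <= 2. *)
Lemma normc_zfac_sqr_le (s t : R) (k : nat) : 0 < s -> (0 < k)%N -> k%:R * s <= 1 ->
  normc (zfac s t k) ^+ 2 <= expR (- (cosgap (k%:R * t) / 4)).
Proof.
move=> s0 k0 ks; have p1 := rpow_lt1 s k s0 k0.
have p4 : 4^-1 <= rpow s k by rewrite -[4^-1]expr1 exprVn; exact: expR_Nnat_ge.
rewrite /zfac normcM normc_inv normc_real exprMn exprVn normc_sqr real_normK ?num_real//.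
have -> : cRe (1 - qpow s t k) = 1 - rpow s k * cos (k%:R * t).
  by rewrite ReB /qpow Re_realM.
have -> : cIm (1 - qpow s t k) = - (rpow s k * sin (k%:R * t)).
  by rewrite /qpow /=; ring.
have g0 := cosgap_ge0 (k%:R * t); have g2 := cosgap_le2 (k%:R * t).
have := cos2Dsin2 (k%:R * t); have : cos (k%:R * t) = 1 - cosgap (k%:R * t).
  by rewrite /cosgap; lra.
move: (cos _) (sin _) (cosgap _) g0 g2 => c d g g0 g2 -> h.
move: (rpow s k) p1 p4 => p p1 p4.
have -> : (1 - p * (1 - g)) ^+ 2 + (- (p * d)) ^+ 2 = (1 - p) ^+ 2 + 2 * p * g.
  have -> : (- (p * d)) ^+ 2 = p ^+ 2 * d ^+ 2 by ring.
  by rewrite -[d ^+ 2](addKr ((1 - g) ^+ 2)) h; ring.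
have h1 : expR (g / 4) * (1 - g / 4) <= 1.
  have := expR_ge1Dx (- (g / 4)); rewrite -(ler_pM2l (expR_gt0 (g / 4))) -expRD subrr expR0.
  by [].
have h2 : expR (g / 4) <= 1 + g / 2.
  have : expR (g / 4) * (1 - g / 4) <= (1 + g / 2) * (1 - g / 4).
    by apply: (le_trans h1); nra.
  by rewrite ler_pM2r//; lra.
rewrite expRN ler_pdivrMr; last first.
  by apply: ltr_pwDl; [rewrite exprn_gt0 ?subr_gt0|rewrite !mulr_ge0//; lra].
rewrite ler_pdivlMl ?expR_gt0//.
apply: (@le_trans _ _ ((1 + g / 2) * (1 - p) ^+ 2)); first by rewrite ler_wpM2r ?sqr_ge0.
have h3 : (1 - p) ^+ 2 <= 1 by rewrite expr_le1//; lra.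
have : g * (1 - p) ^+ 2 <= g * (4 * p) by rewrite ler_wpM2l//; lra.
move: ((1 - p) ^+ 2) => w; lra.
Qed.

Lemma tailp_le_exp (x : nat -> nat) J (s : R) a b : (forall i, 0 < x i)%N ->
  {homo x : i j / (i < j)%N} -> 0 < s -> (a <= b <= J)%N ->
  tailp x J s a <= expR (- ((b - a)%:R * rpow s (x b))).
Proof.
move=> x0 xh s0 /andP[ab bJ].
have h : tailp x J s a <= \prod_(a <= i < b) (1 - rpow s (x i)).
  rewrite /tailp (@big_cat_nat _ _ _ b)//= ler_piMr//.
    apply: prodr_ge0 => i _.
    by case/andP: (sub1_rpow_itv s s0 (x i) (x0 i)) => /ltW.
  exact: (tailp_le1 x J s x0 s0).
apply: (le_trans h).
apply: (@le_trans _ _ (\prod_(a <= i < b) expR (- rpow s (x b)))).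
  rewrite big_nat_cond [leRHS]big_nat_cond; apply: ler_prod => i /andP[/andP[_ ib] _].
  have /andP[h1 _] := sub1_rpow_itv s s0 (x i) (x0 i).
  rewrite (ltW h1)/=; apply: le_trans (expR_ge1Dx _).
  by rewrite lerD2l lerN2 ler_rpow// ltnW// xh.
by rewrite prodr_const_nat -expRM_natl mulrN.
Qed.

End Domination.

Section EvenTerms.
Context {R : realType}.
Variables (r m : nat) (coprime_rm : coprime r m) (r_gt0 : (0 < r)%N) (r_lt : (2 * r < m)%N).

Let m_gt0 : (0 < m)%N.
Proof. by clear -r_lt; lia. Qed.

Let x_gt0 : forall i, (0 < part r m i)%N := part_gt0 r m r_gt0 r_lt.
Let x_lt := ltn_part r m r_gt0 r_lt.

(** Only the parts r + m j are used, the odd indices being dropped. The condition on L m s puts all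
    parts involved in the range of [normc_zfac_sqr_le]; the constant loses 1/4 there and 1/2 in the
    square root. *)
Lemma normc_headz_part_le : exists2 c : R, 0 < c & exists L0 : nat,
  forall (L : nat) (s t : R), (L0 <= L)%N -> 0 < s -> (L * m)%:R * s <= 1 -> `|t| <= pi ->
  normc (headz (part r m) s t (2 * L)) <= expR (- (c * L%:R * Num.min 1 ((L%:R * t) ^+ 2))).
Proof.
have [c c0 [L0 hL]] := @sum_cosgap_lower R r m coprime_rm r_gt0 m_gt0.
exists (c / 8); first by rewrite divr_gt0.
exists L0 => L s t L0L s0 Ls tp; have := hL L t L0L tp.
set M := Num.min _ _ => h.
rewrite -(@ler_pXn2r _ 2)// ?nnegrE ?normc_ge0 ?expR_ge0//.
rewrite -expRM_natl /headz normc_prod -prodrXl.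
have x1 i : (i < 2 * L)%N -> (part r m i)%:R * s <= 1.
  move=> iL; apply: le_trans Ls; rewrite ler_wpM2r ?(ltW s0)// ler_nat.
  apply: (@leq_trans (part r m (2 * L).-1)).
    have /orP[/eqP ->//|/x_lt/ltnW//] : ((i == (2 * L).-1) || (i < (2 * L).-1))%N.
    by clear -iL; lia.
  case: L iL {h hL L0L M} => // L _.
  have -> : (2 * L.+1).-1 = (2 * L).+1 by lia.
  by rewrite part_odd leq_subr.
apply: (@le_trans _ _ (\prod_(i < 2 * L) expR (- (cosgap ((part r m i)%:R * t) / 4)))).
  apply: ler_prod => i _; rewrite exprn_ge0 ?normc_ge0//=.
  by apply: normc_zfac_sqr_le => //; exact: x1.
rewrite -expR_sum ler_expR sumrN mulrN lerN2 -mulr_suml.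
rewrite -(big_mkord xpredT (fun i => cosgap ((part r m i)%:R * t))) sum_double.
have h2 : \sum_(j < L) cosgap ((r + m * j)%:R * t) <=
    \sum_(k < L) (cosgap ((part r m (2 * k))%:R * t) + cosgap ((part r m (2 * k).+1)%:R * t)).
  apply: ler_sum => k _; rewrite part_even addnC (mulnC k).
  by rewrite lerDl cosgap_ge0.
have := le_trans h h2; move: (\sum_(k < L) _) => S; lra.
Qed.

(** At least 2L factors have index between j and 4L. The part of index 4L is at most 3 L m, so each
    of them is at most 1 - 4 ^ (- 3), and 2L / 64 = L / 32. *)
Lemma tailp_part_le (J L : nat) (s : R) j : (0 < L)%N -> 0 < s -> (L * m)%:R * s <= 1 ->
  (4 * L <= J)%N -> (j <= 2 * L)%N ->
  tailp (part r m) J s j <= expR (- (L%:R / 32)).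
Proof.
move=> L0 s0 Ls LJ jL.
apply: (le_trans (tailp_le_exp (part r m) J s j (4 * L)%N x_gt0 x_lt s0 _)).
  by rewrite LJ andbT; clear -jL; lia.
rewrite ler_expR lerN2.
have h : 4 ^- 3 <= rpow s (part r m (4 * L)).
  apply: expR_Nnat_ge; apply: (@le_trans _ _ ((3 * (L * m))%:R * s)); last first.
    by rewrite natrM -mulrA; lra.
  rewrite ler_wpM2r ?(ltW s0)// ler_nat.
  have -> : (4 * L = 2 * (2 * L))%N by lia.
  rewrite part_even; have : (m <= L * m)%N by rewrite leq_pmull.
  by clear -r_lt; lia.
have h2 : (2 * L)%:R <= (4 * L - j)%:R :> R by rewrite ler_nat; clear -jL; lia.
have := ler_pM _ _ h2 h.
rewrite -exprVn !exprS expr0 mulr1 natrM.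
move=> /(_ _ _)/wrap[]; first by rewrite mulr_ge0.
  by rewrite !mulr_ge0.
lra.
Qed.

(** The minimum in [normc_headz_part_le] becomes a sum: a term independent of t, which also absorbs
    [tailp], and a Gaussian of width L ^ (- 3 / 2). *)
Lemma normc_even_terms_le : exists2 c : R, 0 < c & exists2 L0 : nat, (0 < L0)%N &
  forall (L N : nat) (s t : R), (L0 <= L)%N -> (2 * L <= N)%N -> 0 < s ->
  (L * m)%:R * s <= 1 -> `|t| <= pi ->
  normc (\sum_(k < N) aterm (part r m) (2 * N) s t (2 * k)) <=
  2 * expR (- (c * L%:R)) + expR (- (c * L%:R * (L%:R * t) ^+ 2)).
Proof.
have [c c0 [L0 h]] := normc_headz_part_le.
have d0 : 0 < Num.min c 32^-1 by rewrite lt_min c0/= invr_gt0.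
exists (Num.min c 32^-1) => //; exists L0.+1 => // L N s t L0L LN s0 Ls tp.
have JL : (4 * L <= 2 * N)%N by clear -LN; lia.
apply: (le_trans (sum_aterm_even_le (part r m) (2 * N) s x_gt0 s0 t N (2 * L)%N _ _)) => //.
  by clear -LN; lia.
have h1 := tailp_part_le (2 * N) L s (2 * L) (leq_ltn_trans (leq0n _) L0L) s0 Ls JL (leqnn _).
have h2 := h L s t (ltnW L0L) s0 Ls tp.
have d1 : Num.min c 32^-1 <= c by rewrite ge_min lexx.
have d2 : Num.min c 32^-1 <= 32^-1 by rewrite ge_min lexx orbT.
move: (Num.min c _) d0 d1 d2 => d d0 d1 d2.
have h3 : expR (- (L%:R / 32)) <= expR (- (d * L%:R)).
  by rewrite ler_expR lerN2 mulrC ler_wpM2l.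
have h4 : expR (- (c * L%:R * Num.min 1 ((L%:R * t) ^+ 2))) <=
    expR (- (d * L%:R)) + expR (- (d * L%:R * (L%:R * t) ^+ 2)).
  have h5 (M : R) : 0 <= M -> expR (- (c * L%:R * M)) <= expR (- (d * L%:R * M)).
    by move=> M0; rewrite ler_expR lerN2 !ler_wpM2r.
  rewrite /Num.min; case: ifP => _.
    apply: (le_trans (h5 _ _)) => //.
    by rewrite mulr1 lerDl expR_ge0.
  apply: (le_trans (h5 _ _)); first exact: sqr_ge0.
  by rewrite lerDr expR_ge0.
lra.
Qed.

End EvenTerms.

(** * Gaussian approximation *)

Section CharacteristicFunction.
Context {R : realType}.

Lemma expRN_sub1 (y : R) : 0 <= y -> `|expR (- y) - (1 - y)| <= y ^+ 2.
Proof.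
move=> y0; have h1 := expR_ge1Dx (- y); rewrite ger0_norm; last by lra.
have h2 : expR (- y) * (1 + y) <= 1.
  have := ler_wpM2l (expR_ge0 (- y)) (expR_ge1Dx y).
  by rewrite -expRD addNr expR0.
have h3 : expR (- y) * (1 + y) <= (1 - y + y ^+ 2) * (1 + y).
  apply: (le_trans h2); rewrite (_ : (1 - y + y ^+ 2) * (1 + y) = 1 + y ^+ 3); last by ring.
  by rewrite lerDl exprn_ge0.
rewrite ler_pM2r in h3; last by lra.
lra.
Qed.

Lemma normc_complex_le (a b : R) : normc (Complex a b) <= `|a| + `|b|.
Proof. exact: (normc_le_abs (Complex a b)). Qed.

(** The inverse is the characteristic function of a geometric variable of mean N and variance N + N
    ^ 2; the three hypotheses let all cubic Taylor remainders be measured by E ^ 3. The Gaussian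
    factor is multiplied by the denominator and compared with 1, so that no inverse is expanded. *)
Lemma geometric_factor_approx (N t E : R) : 0 <= N -> E <= 1 ->
  N * `|t| <= E -> N * t ^+ 2 <= E ^+ 2 -> N * `|t| ^+ 3 <= E ^+ 3 ->
  normc ((1 - real_complex R N * (cis t - 1))^-1 -
    real_complex R (expR (- ((N + N ^+ 2) * t ^+ 2 / 2))) * cis (N * t)) <= 45 * E ^+ 3.
Proof.
move=> N0 E1 Nu Nb Nr.
set u := N * t; pose b := N * t ^+ 2; pose v := (N + N ^+ 2) * t ^+ 2.
have uE : `|u| <= E by rewrite normrM ger0_norm.
have E0 : 0 <= E by apply: le_trans uE.
have b0 : 0 <= b by rewrite mulr_ge0 ?sqr_ge0.
have vE : v = b + u ^+ 2 by rewrite /v /b /u; ring.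
have uE2 : u ^+ 2 <= E ^+ 2 by rewrite -(real_normK (num_real u)) lerXn2r// nnegrE.
have E2 : E ^+ 2 <= 1 by rewrite expr_le1.
have E3 : E ^+ 4 <= E ^+ 3 by rewrite (exprSr _ 3) ler_piMr// exprn_ge0.
have E30 : 0 <= E ^+ 3 by rewrite exprn_ge0.
have E31 : E ^+ 3 <= 1 by rewrite expr_le1.
have bE : b <= E ^+ 2 by [].
have v0 : 0 <= v by rewrite vE addr_ge0 ?sqr_ge0.
have v2 : v <= 2 * E ^+ 2 by rewrite vE; lra.
have u1 : `|u| <= 1 by apply: le_trans E1.
(* Second-order Taylor polynomials: [c] for exp (i u), [d] for the denominator with remainder [e],
   and later [h] for exp (- v / 2). The product h c d is 1 up to order three. *)
pose c : R[i] := Complex (1 - u ^+ 2 / 2) u.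
pose d : R[i] := Complex (1 + b / 2) (- u).
pose e : R[i] := Complex (N * (cos t - (1 - t ^+ 2 / 2))) (N * (sin t - t)).
have aE : 1 - real_complex R N * (cis t - 1) = d - e.
  by apply/eqP; rewrite eq_complex /= /b /u; apply/andP; split; apply/eqP; field.
have eE : normc e <= 4 * E ^+ 3.
  apply: (le_trans (normc_complex_le _ _)); rewrite !normrM (ger0_norm N0) -mulrDr.
  apply: (@le_trans _ _ (N * (4 * `|t| ^+ 3))); last by lra.
  by rewrite ler_wpM2l//; have := cos_taylor t; have := sin_taylor t; lra.
have dE : normc (d - e) <= 13 / 2.
  apply: (le_trans (normcB _ _)).
  have : normc d <= 1 + b / 2 + `|u|.
    apply: (le_trans (normc_complex_le _ _)); rewrite normrN lerD2r ger0_norm//; lra.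
  lra.
have cE : normc c <= 5 / 2.
  apply: (le_trans (normc_complex_le _ _)).
  have := ler_normB 1 (u ^+ 2 / 2); rewrite normr1 [`|u ^+ 2 / 2|]ger0_norm ?divr_ge0 ?sqr_ge0//.
  lra.
have ccE : normc (cis u - c) <= 4 * E ^+ 3.
  have -> : cis u - c = Complex (cos u - (1 - u ^+ 2 / 2)) (sin u - u) by [].
  apply: (le_trans (normc_complex_le _ _)).
  have := cos_taylor u; have := sin_taylor u.
  have : `|u| ^+ 3 <= E ^+ 3 by rewrite lerXn2r// nnegrE.
  lra.
set w := real_complex R _ * cis u.
pose h := 1 - v / 2.
have h0 : 0 <= h <= 1 by rewrite /h; apply/andP; split; lra.
have wE : normc (w - real_complex R h * c) <= 5 * E ^+ 3.
  have -> : w - real_complex R h * c =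
     real_complex R (expR (- (v / 2)) - h) * cis u + real_complex R h * (cis u - c).
    rewrite /w -/v (rmorphB (real_complex R) (expR (- (v / 2))) h)/=.
    move: (real_complex R h) (real_complex R (expR _)) => a a'; ring.
  apply: (le_trans (normcD _ _)); rewrite !normcM !normc_real normc_cis mulr1.
  have [/andP[h00 h1]] := h0; rewrite (ger0_norm h00).
  have := expRN_sub1 (v / 2); rewrite divr_ge0// => /(_ isT).
  have : (v / 2) ^+ 2 <= (E ^+ 2) ^+ 2 by rewrite lerXn2r ?nnegrE ?sqr_ge0 ?divr_ge0//; lra.
  rewrite -exprM => k1 k2.
  have : h * normc (cis u - c) <= normc (cis u - c) by rewrite ler_piMl ?normc_ge0.
  rewrite /h; lra.
have rE : normc (real_complex R h * c * d - 1) <= 9 / 4 * E ^+ 3.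
  have -> : real_complex R h * c * d - 1 =
    Complex (- (v ^+ 2 / 4) - h * (u ^+ 2 * b / 4)) (h * (u * v / 2)).
    by apply/eqP; rewrite eq_complex /= /h vE; apply/andP; split; apply/eqP; field.
  apply: (le_trans (normc_complex_le _ _)).
  have [/andP[h00 h1]] := h0.
  rewrite -opprD normrN ger0_norm; last first.
    have k4 : 0 <= u ^+ 2 * b := mulr_ge0 (sqr_ge0 u) b0.
    apply: addr_ge0; first by have := sqr_ge0 v; lra.
    by apply: mulr_ge0 => //; lra.
  rewrite (normrM h) (normrM (u * v)) (normrM u v) (ger0_norm h00) (ger0_norm v0).
  rewrite [`|2^-1|]ger0_norm//.
  have k1 : v ^+ 2 <= 4 * E ^+ 4.
    rewrite (_ : 4 * E ^+ 4 = (2 * E ^+ 2) ^+ 2); last by ring.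
    by rewrite lerXn2r ?nnegrE//; lra.
  have k2 : u ^+ 2 * b <= E ^+ 4 by rewrite (exprD E 2 2) ler_pM ?sqr_ge0.
  have k3 : `|u| * v <= 2 * E ^+ 3.
    by rewrite (_ : 2 * E ^+ 3 = E * (2 * E ^+ 2)); [rewrite ler_pM|ring].
  have k4 : 0 <= u ^+ 2 * b by rewrite mulr_ge0 ?sqr_ge0.
  have k5 : 0 <= `|u| * v by rewrite mulr_ge0.
  have k6 : h * (u ^+ 2 * b / 4) <= u ^+ 2 * b / 4 by rewrite ler_piMl// divr_ge0.
  have k7 : h * (`|u| * v / 2) <= `|u| * v / 2 by rewrite ler_piMl// divr_ge0.
  lra.
have de1 : 1 <= normc (d - e).
  rewrite -aE; apply: le_trans (abs_Re_le _); apply: le_trans (ler_norm _).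
  rewrite ReB Re_realM /=; have := mulr_ge0 N0 (cosgap_ge0 t); rewrite /cosgap; lra.
have de0 : d - e != 0.
  by apply/eqP => de; move: de1; rewrite de (_ : normc 0 = 0) ?ler10//; exact: normc0.
rewrite aE.
have -> : (d - e)^-1 - w = (d - e)^-1 * - ((w - real_complex R h * c) * (d - e) -
   real_complex R h * c * e + (real_complex R h * c * d - 1)).
  have -> : (w - real_complex R h * c) * (d - e) - real_complex R h * c * e +
    (real_complex R h * c * d - 1) = w * (d - e) - 1 by ring.
  by rewrite opprB mulrBr mulr1 mulrCA mulVf// mulr1.
rewrite normcM normc_opp normc_inv.
apply: (@le_trans _ _ (normc ((w - real_complex R h * c) * (d - e) -
   real_complex R h * c * e + (real_complex R h * c * d - 1)))).
  by rewrite ler_piMl ?normc_ge0// invf_le1// (lt_le_trans ltr01).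
apply: (le_trans (normcD _ _)); apply: (le_trans (lerD (normcB _ _) rE)).
rewrite normcM [normc (real_complex R h * c * e)]normcM [normc (real_complex R h * c)]normcM.
rewrite normc_real; have [/andP[h00 h1]] := h0; rewrite (ger0_norm h00).
(* The constant is 5 * 13/2 + 5/2 * 4 + 9/4 <= 45. *)
have l1 := ler_pM (normc_ge0 _) (normc_ge0 _) wE dE.
have l2 : h * normc c <= 5 / 2.
  by apply: le_trans cE; rewrite ler_piMl ?normc_ge0.
have l3 := ler_pM (mulr_ge0 h00 (normc_ge0 _)) (normc_ge0 _) l2 eE.
lra.
Qed.

Lemma geometric_denominator (F : fieldType) (p c : F) : 1 - p != 0 ->
  (1 - p) * (1 - p / (1 - p) * (c - 1)) = 1 - p * c.
Proof. by move=> p1; field. Qed.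

(* mean and variance of [k] times the multiplicity of the part [k], a geometric variable *)
Definition pmean (s : R) (k : nat) := k%:R * rpow s k / (1 - rpow s k).
Definition pvar (s : R) (k : nat) := k%:R ^+ 2 * rpow s k / (1 - rpow s k) ^+ 2.

(** Uses [geometric_factor_approx] with E = 7 (|t| / s) exp (- k s / 12). The exponential decay in
    k, inherited from the mean, makes the errors summable over all parts. *)
Lemma zfac_approx (s t : R) (k : nat) : 0 < s -> (0 < k)%N -> 7 * `|t| <= s ->
  normc (zfac s t k - real_complex R (expR (- (pvar s k * t ^+ 2 / 2))) * cis (pmean s k * t))
  <= 45 * (7 * `|t| / s) ^+ 3 * expR (- (k%:R * s / 4)).
Proof.
move=> s0 k0 ts; have p1 := rpow_lt1 s k s0 k0.
set N := rpow s k / (1 - rpow s k).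
have pn : 1 - rpow s k != 0 by rewrite subr_eq0 gt_eqF.
have N0 : 0 <= N by rewrite divr_ge0 ?rpow_ge0// subr_ge0 ltW.
pose xi := k%:R * s; have xi0 : 0 < xi by rewrite mulr_gt0// ltr0n.
(* A twelfth root of [rpow s k]: powers of xi are absorbed by powers of g through xi g <= 12. The 7
   is large enough since 2 * 12 ^ 2 <= 7 ^ 3. *)
pose g := expR (- (xi / 12)).
have gE : expR (- (xi / 2)) = g ^+ 6 by rewrite /g -expRM_natl; congr expR; lra.
have pE : rpow s k = g ^+ 12 by rewrite /g -expRM_natl /rpow -/xi; congr expR; lra.
have g0 : 0 < g := expR_gt0 _.
have g1 : g <= 1 by rewrite expR_le1; lra.
have xg : xi * g <= 12.
  have : xi / 12 * g <= 1.
    have := expR_ge1Dx (xi / 12); have := ler_wpM2r (ltW g0) (lexx (expR (xi / 12))).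
    move=> _ h; have : (xi / 12) * g <= expR (xi / 12) * g by rewrite ler_pM2r//; lra.
    by move=> /le_trans; apply; rewrite -expRD subrr expR0.
  lra.
have NE : xi * N <= 2 * g ^+ 6.
  rewrite /N mulrA ler_pdivrMr ?subr_gt0// pE.
  have h : xi / 2 * g ^+ 6 <= 1 - g ^+ 6.
    have := expR_ge1Dx (xi / 2) => h.
    have : (1 + xi / 2) * g ^+ 6 <= expR (xi / 2) * g ^+ 6 by rewrite ler_pM2r ?exprn_gt0.
    by rewrite -{2}gE -expRD subrr expR0; lra.
  have g60 : 0 <= g ^+ 6 by rewrite exprn_ge0// ltW.
  have -> : g ^+ 12 = g ^+ 6 * g ^+ 6 by rewrite -exprD.
  have g61 : g ^+ 6 <= 1 by rewrite exprn_ile1// ltW.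
  move: (g ^+ 6) h g60 g61 => G h G0 G1.
  have := ler_wpM2r G0 h => h2.
  have : 0 <= G * (1 - G) * G by rewrite !mulr_ge0// subr_ge0.
  lra.
set e := `|t| / s; have e0 : 0 <= e by rewrite divr_ge0// ltW.
have e7 : 7 * e <= 1 by rewrite mulrA ler_pdivrMr// mul1r.
have ktE : `|k%:R * t| = e * xi.
  by rewrite normrM ger0_norm// /e /xi; field; rewrite gt_eqF.
have gn n : 0 <= g ^+ n <= 1 by rewrite exprn_ge0 ?(ltW g0)//= exprn_ile1// ltW.
have NtE : N * `|k%:R * t| <= 2 * e * g ^+ 6.
  rewrite ktE (_ : N * (e * xi) = e * (xi * N)); last by ring.
  by have := ler_wpM2l e0 NE; lra.
have h1 : N * `|k%:R * t| <= 7 * e * g.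
  apply: (le_trans NtE).
  have g6 : g ^+ 6 <= g by rewrite exprS ler_piMr ?(ltW g0)//; case/andP: (gn 5%N).
  by have := ler_wpM2l e0 g6; have := mulr_ge0 e0 (ltW g0); lra.
have gX (j n : nat) : (n <= j)%N -> g ^+ j <= g ^+ n.
  by move=> nj; rewrite ler_wiXn2l ?(ltW g0).
have h2 : N * (k%:R * t) ^+ 2 <= (7 * e * g) ^+ 2.
  rewrite -(real_normK (num_real (_ * _))) ktE.
  rewrite (_ : N * (e * xi) ^+ 2 = e ^+ 2 * (xi * (xi * N))); last by ring.
  rewrite (_ : (7 * e * g) ^+ 2 = e ^+ 2 * (49 * g ^+ 2)); last by ring.
  rewrite ler_wpM2l ?sqr_ge0//; apply: (le_trans (ler_wpM2l (ltW xi0) NE)).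
  rewrite (_ : xi * (2 * g ^+ 6) = 2 * (xi * g) * g ^+ 5); last by ring.
  have [/andP[g50 _]] := gn 5%N; have := ler_wpM2r g50 xg.
  have := gX 5%N 2%N isT; have [/andP[g20 _]] := gn 2%N; lra.
have h3 : N * `|k%:R * t| ^+ 3 <= (7 * e * g) ^+ 3.
  rewrite ktE (_ : N * (e * xi) ^+ 3 = e ^+ 3 * (xi ^+ 2 * (xi * N))); last by ring.
  rewrite (_ : (7 * e * g) ^+ 3 = e ^+ 3 * (343 * g ^+ 3)); last by ring.
  rewrite ler_wpM2l ?exprn_ge0//; apply: (le_trans (ler_wpM2l (sqr_ge0 xi) NE)).
  rewrite (_ : xi ^+ 2 * (2 * g ^+ 6) = 2 * (xi * g) ^+ 2 * g ^+ 4); last by ring.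
  have h4 : (xi * g) ^+ 2 <= 12 ^+ 2 by rewrite lerXn2r// nnegrE// mulr_ge0// ltW.
  have [/andP[g40 _]] := gn 4%N; have := ler_wpM2r g40 h4.
  have := gX 4%N 3%N isT; have [/andP[g30 _]] := gn 3%N; lra.
have e7g : 7 * e * g <= 1 by apply: mulr_ile1 => //; [exact: mulr_ge0|exact: ltW].
have := geometric_factor_approx N (k%:R * t) (7 * e * g) N0 e7g h1 h2 h3.
have -> : (1 - real_complex R N * (cis (k%:R * t) - 1))^-1 = zfac s t k.
  have key : real_complex R (1 - rpow s k) * (1 - real_complex R N * (cis (k%:R * t) - 1)) =
      1 - qpow s t k.
    have NE2 : real_complex R N = real_complex R (rpow s k) / (1 - real_complex R (rpow s k)).
      by rewrite /N fmorph_div rmorphB rmorph1.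
    have pn2 : 1 - real_complex R (rpow s k) != 0.
      by rewrite -(rmorph1 (real_complex R)) -rmorphB fmorph_eq0.
    rewrite NE2 /qpow (rmorphB (real_complex R) 1) rmorph1.
    exact: geometric_denominator.
  by rewrite /zfac -key invfM mulrA mulfV ?mul1r// fmorph_eq0.
have -> : (N + N ^+ 2) * (k%:R * t) ^+ 2 / 2 = pvar s k * t ^+ 2 / 2.
  by rewrite /pvar /N; field.
have -> : N * (k%:R * t) = pmean s k * t by rewrite /pmean /N; field.
move=> /le_trans; apply; rewrite exprMn mulrA (mulrA 7).
by rewrite /g -expRM_natl le_eqVlt; apply/orP; left; apply/eqP; congr (_ * expR _); rewrite /xi; lra.
Qed.

Lemma sum_expRN_le (x : nat -> nat) (J : nat) (s : R) : (forall i, i < x i)%N -> 0 < s ->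
  \sum_(i < J) expR (- ((x i)%:R * s)) <= s^-1.
Proof.
move=> xi s0; pose a := expR (- s).
have a1 : a * (1 + s) <= 1.
  have := ler_wpM2l (expR_ge0 (- s)) (expR_ge1Dx s).
  by rewrite -expRD addNr expR0.
have a0 : 0 < a := expR_gt0 _.
suff h : s * \sum_(i < J) expR (- ((x i)%:R * s)) <= 1 - a ^+ J.
  rewrite -(ler_pM2l s0) divff ?gt_eqF//; apply: (le_trans h).
  by rewrite gerBl exprn_ge0// ltW.
elim: J => [|J ih]; first by rewrite big_ord0 mulr0 expr0 subrr.
rewrite big_ord_recr/= mulrDr.
have : expR (- ((x J)%:R * s)) <= a ^+ J.+1.
  rewrite /a -expRM_natl ler_expR mulrN lerN2 ler_wpM2r ?(ltW s0)// ler_nat.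
  exact: xi.
move=> /(ler_wpM2l (ltW s0)); rewrite exprSr.
have := ler_wpM2l (exprn_ge0 J (ltW a0)) a1.
move: ih; move: (a ^+ J) => b; lra.
Qed.

Lemma headz_approx (x : nat -> nat) (J : nat) (s t : R) : (forall i, i < x i)%N -> 0 < s ->
  7 * `|t| <= s ->
  normc (headz x s t J -
    real_complex R (expR (- ((\sum_(i < J) pvar s (x i)) * t ^+ 2 / 2))) *
    cis ((\sum_(i < J) pmean s (x i)) * t)) <= 180 * (7 * `|t| / s) ^+ 3 / s.
Proof.
move=> xi s0 ts; have x0 i : (0 < x i)%N by exact: leq_ltn_trans (xi i).
pose w k := real_complex R (expR (- (pvar s k * t ^+ 2 / 2))) * cis (pmean s k * t).
have -> : real_complex R (expR (- ((\sum_(i < J) pvar s (x i)) * t ^+ 2 / 2))) *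
    cis ((\sum_(i < J) pmean s (x i)) * t) = \prod_(i < J) w (x i).
  elim: J => [|J ih]; first by rewrite !big_ord0 !mul0r oppr0 expR0 cis0 mul1r.
  rewrite !big_ord_recr/= -ih /w !mulrDl opprD expRD cisD rmorphM/=; ring.
have w1 i : normc (w (x i)) <= 1.
  rewrite normcM normc_cis mulr1 normc_real ger0_norm ?expR_ge0// expR_le1 oppr_le0.
  rewrite divr_ge0// mulr_ge0 ?sqr_ge0// /pvar divr_ge0 ?sqr_ge0//.
  by rewrite mulr_ge0 ?sqr_ge0 ?rpow_ge0.
apply: (le_trans (normc_prodB J (fun i => zfac s t (x i)) (fun i => w (x i)) _ _)) => //.
  by move=> i _; exact: normc_zfac_le1.
apply: (@le_trans _ _ (\sum_(i < J) 45 * (7 * `|t| / s) ^+ 3 * expR (- ((x i)%:R * (s / 4))))).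
  by apply: ler_sum => i _; rewrite mulrA; exact: zfac_approx.
rewrite -mulr_sumr.
have s40 : 0 < s / 4 by rewrite divr_gt0.
have := sum_expRN_le x J (s / 4) xi s40; rewrite invf_div => h.
have : 0 <= 45 * (7 * `|t| / s) ^+ 3 by rewrite mulr_ge0// exprn_ge0// divr_ge0 ?mulr_ge0// ltW.
by move=> hE; have := ler_wpM2l hE h; move: ((7 * `|t| / s) ^+ 3) => E; lra.
Qed.

End CharacteristicFunction.

(** * Mean and variance from convexity *)

Section Convexity.
Context {R : realType}.

(** The convex function - ln (1 - exp (- u)) lies above its tangent at u; it follows from ln (1 + z)
    <= z and exp z >= 1 + z, without differentiation. *)
Lemma ln_sub1_expRN_convex (u v : R) : 0 < u -> 0 < v ->
  ln (1 - expR (- v)) - ln (1 - expR (- u)) <= (v - u) * (expR (- u) / (1 - expR (- u))).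
Proof.
move=> u0 v0.
have pu : 0 < 1 - expR (- u) by rewrite subr_gt0 expR_lt1 oppr_lt0.
have pv : 0 < 1 - expR (- v) by rewrite subr_gt0 expR_lt1 oppr_lt0.
rewrite -ln_div ?posrE// -[_ / _ in leLHS](subrKC 1).
apply: (le_trans (le_ln1Dx _)); first by rewrite ltrBrDl subrr divr_gt0.
rewrite mulrA ler_pdivlMr// mulrBl mul1r divfK ?gt_eqF//.
have -> : expR (- v) = expR (- u) * expR (- (v - u)) by rewrite -expRD; congr expR; lra.
have := ler_wpM2l (expR_ge0 (- u)) (expR_ge1Dx (- (v - u))); lra.
Qed.

Lemma expRN_geometric_convex (u v : R) : 0 < u -> 0 < v ->
  expR (- u) / (1 - expR (- u)) - expR (- v) / (1 - expR (- v)) <=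
  (v - u) * (expR (- u) / (1 - expR (- u)) ^+ 2).
Proof.
move=> u0 v0.
have pu : 0 < 1 - expR (- u) by rewrite subr_gt0 expR_lt1 oppr_lt0.
have pv : 0 < 1 - expR (- v) by rewrite subr_gt0 expR_lt1 oppr_lt0.
have h := expR_ge1Dx (v - u); have h' := expR_ge1Dx (- (v - u)).
have e : expR (- v) = expR (- u) * expR (- (v - u)) by rewrite -expRD; congr expR; lra.
move: pu pv; rewrite e; set p := expR (- u); set q := expR (- (v - u)) => pu pv.
have p0 : 0 < p := expR_gt0 _; have q0 : 0 < q := expR_gt0 _.
have -> : p / (1 - p) - p * q / (1 - p * q) = p * (1 - q) / ((1 - p) * (1 - p * q)).
  by field; rewrite !gt_eqF.
rewrite ler_pdivrMr ?mulr_gt0// [leRHS](_ : _ = (v - u) * p * (1 - p * q) / (1 - p)); last first.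
  by field; rewrite gt_eqF.
rewrite ler_pdivlMr// -!mulrA (mulrCA _ p) ler_pM2l//.
have h1 : 1 - q <= v - u by rewrite /q; lra.
apply: (@le_trans _ _ ((1 - q) * (1 - p * q))); last by rewrite ler_pM2r.
have : 0 <= p * (1 - q) ^+ 2 by rewrite mulr_ge0 ?sqr_ge0// ltW.
lra.
Qed.

Variables (x : nat -> nat) (x_gt0 : forall i, (0 < x i)%N) (J : nat).

Definition lnprod (s : R) := \sum_(i < J) - ln (1 - rpow s (x i)).
Definition mean (s : R) := \sum_(i < J) pmean s (x i).
Definition variance (s : R) := \sum_(i < J) pvar s (x i).

Let xs_gt0 i (s : R) : 0 < s -> 0 < (x i)%:R * s.
Proof. by move=> s0; rewrite mulr_gt0// ltr0n. Qed.

(** [mean] is minus the derivative of [lnprod] and [variance] minus that of [mean]. The tangent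
    inequalities bound these derivatives by values of [lnprod] alone, which is all that the
    asymptotics provides. *)
Lemma lnprod_convex (s s' : R) : 0 < s -> 0 < s' ->
  lnprod s - lnprod s' <= (s' - s) * mean s.
Proof.
move=> s0 s0'; rewrite /lnprod -sumrB /mean mulr_sumr; apply: ler_sum => i _.
have := ln_sub1_expRN_convex _ _ (xs_gt0 i s s0) (xs_gt0 i s' s0').
rewrite /pmean /rpow; set a := expR _; set b := expR _; rewrite -mulrBr.
set c := b / _; rewrite -mulrA -/c; lra.
Qed.

Lemma mean_convex (s s' : R) : 0 < s -> 0 < s' ->
  mean s - mean s' <= (s' - s) * variance s.
Proof.
move=> s0 s0'; rewrite /mean -sumrB /variance mulr_sumr; apply: ler_sum => i _.
have := expRN_geometric_convex _ _ (xs_gt0 i s s0) (xs_gt0 i s' s0').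
have := xs_gt0 i 1 ltr01; rewrite mulr1 => xi0.
move=> /(ler_wpM2l (ltW xi0)).
by rewrite /pmean /pvar /rpow; congr (_ <= _); ring.
Qed.

Lemma expR_lnprod (s : R) : 0 < s -> expR (lnprod s) = (\prod_(i < J) (1 - rpow s (x i)))^-1.
Proof.
move=> s0; rewrite /lnprod expR_sum -prodfV; apply: eq_bigr => i _.
by rewrite expRN lnK// posrE; case/andP: (sub1_rpow_itv s s0 (x i) (x_gt0 i)).
Qed.

End Convexity.

Section MeanEstimate.
Context {R : realType}.
Variables (g M V : R -> R) (A C : R).
Hypothesis A0 : 0 < A.
Hypothesis gM : forall s s', 0 < s -> 0 < s' -> g s - g s' <= (s' - s) * M s.
Hypothesis MV : forall s s', 0 < s -> 0 < s' -> M s - M s' <= (s' - s) * V s.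

(* If [g] is within [d ^ 2] of [A / s + C], the slopes of its chords over steps
   of length [d * s ^ (3 / 2)] determine its derivative up to
   [O(d * s ^ (- 3 / 2))]; here [q = s ^ (1 / 2)]. *)
Lemma mean_estimate (q d : R) : 0 < q <= 1 -> 0 < d <= 1 / 4 ->
  (forall s, q ^+ 2 / 4 <= s <= 4 * q ^+ 2 -> `|g s - (A / s + C)| <= d ^+ 2) ->
  forall s, q ^+ 2 / 2 <= s <= 2 * q ^+ 2 ->
  `|M s - A / s ^+ 2| <= (2 + 16 * A) * d / q ^+ 3.
Proof.
move=> /andP[q0 q1] /andP[d0 d1] hg s /andP[s1 s2].
have q20 : 0 < q ^+ 2 by rewrite exprn_gt0.
have q21 : q ^+ 2 <= 1 by rewrite expr_le1// ltW.
have s0 : 0 < s by apply: lt_le_trans s1; rewrite divr_gt0.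
pose h := d * q ^+ 3.
have h0 : 0 < h by rewrite mulr_gt0// exprn_gt0.
have h1 : h <= q ^+ 2 / 4.
  rewrite /h exprS mulrA [leRHS]mulrC ler_pM2r//.
  by apply: (@le_trans _ _ d); [rewrite ler_piMr// ltW|lra].
have sh : 0 < s - h by lra.
have hs := hg s; rewrite (_ : _ <= s <= _) in hs; last by apply/andP; split; lra.
have hs1 := hg (s - h); rewrite (_ : _ <= s - h <= _) in hs1; last by apply/andP; split; lra.
have hs2 := hg (s + h); rewrite (_ : _ <= s + h <= _) in hs2; last by apply/andP; split; lra.
move: hs hs1 hs2 => /(_ isT) + /(_ isT) + /(_ isT).
rewrite !ler_norml => /andP[a1 a2] /andP[b1 b2] /andP[c1 c2].
have m1 : g s - g (s - h) <= - h * M s.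
  by have := gM s (s - h) s0 sh; rewrite addrAC subrr sub0r.
have m2 : g s - g (s + h) <= h * M s.
  by have := gM s (s + h) s0 (addr_gt0 s0 h0); rewrite [_ - s]addrAC subrr add0r.
have q3 : 0 < q ^+ 3 by rewrite exprn_gt0.
have bound D : q ^+ 6 / 16 <= D -> A * h / D <= 16 * A * d / q ^+ 3.
  move=> hD; have D0 : 0 < D by apply: lt_le_trans hD; rewrite divr_gt0 ?exprn_gt0.
  rewrite ler_pdivrMr//; have c0 : 0 <= 16 * A * d / q ^+ 3.
    by rewrite divr_ge0 ?(ltW q3)// !mulr_ge0// ltW.
  apply: le_trans (ler_wpM2l c0 hD); rewrite le_eqVlt /h; apply/orP; left; apply/eqP.
  by field; rewrite gt_eqF.
have ss : q ^+ 6 / 16 <= s ^+ 2 * (s - h).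
  rewrite (_ : q ^+ 6 / 16 = (q ^+ 2 / 2) ^+ 2 * (q ^+ 2 / 4)); last by field.
  by rewrite ler_pM ?sqr_ge0 ?divr_ge0 ?(ltW q20)// ?lerXn2r ?nnegrE ?divr_ge0 ?(ltW q20) ?(ltW s0)//; lra.
have ss2 : q ^+ 6 / 16 <= s ^+ 2 * (s + h).
  by apply: (le_trans ss); rewrite ler_wpM2l ?sqr_ge0//; lra.
have r1 : A / (s - h) - A / s <= h * (A / s ^+ 2) + h * (16 * A * d / q ^+ 3).
  have -> : A / (s - h) - A / s = h * (A / s ^+ 2) + h * (A * h / (s ^+ 2 * (s - h))).
    by field; rewrite !gt_eqF.
  by rewrite lerD2l ler_pM2l// bound.
have r2 : h * (A / s ^+ 2) - h * (16 * A * d / q ^+ 3) <= A / s - A / (s + h).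
  have -> : A / s - A / (s + h) = h * (A / s ^+ 2) - h * (A * h / (s ^+ 2 * (s + h))).
    by field; rewrite !gt_eqF// addr_gt0.
  by rewrite lerD2l lerN2 ler_pM2l// bound.
have d2 : d ^+ 2 = h * (d / q ^+ 3) by rewrite /h; field; rewrite gt_eqF.
have : `|h * (M s - A / s ^+ 2)| <= h * ((2 + 16 * A) * d / q ^+ 3).
  rewrite ler_norml; apply/andP; split.
  - by rewrite [leLHS](_ : _ = - (2 * (h * (d / q ^+ 3)) + h * (16 * A * d / q ^+ 3))); [lra|ring].
  - by rewrite [leRHS](_ : _ = (2 * (h * (d / q ^+ 3)) + h * (16 * A * d / q ^+ 3))); [lra|ring].
by rewrite normrM (gtr0_norm h0) (ler_pM2l h0) ler_norml.
Qed.

(** The chord argument once more, now on [M]. Only the leading order is wanted, so the step is a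
    fixed fraction k of s: the error of [M] contributes the term in d / k, the curvature of A / s ^
    2 the term in k. *)
Lemma variance_estimate (q d k : R) : 0 < q <= 1 -> 0 < d <= 1 / 4 -> 0 < k <= 1 / 4 ->
  (forall s, q ^+ 2 / 4 <= s <= 4 * q ^+ 2 -> `|g s - (A / s + C)| <= d ^+ 2) ->
  `|q ^+ 6 * V (q ^+ 2) - 2 * A| <= 2 * (2 + 16 * A) * d / k + 8 * A * k.
Proof.
move=> q01 d01 /andP[k0 k1] hg; have hM := mean_estimate q d q01 d01 hg.
have /andP[q0 q1] := q01; have /andP[d0 d1] := d01.
set s := q ^+ 2; have s0 : 0 < s by rewrite exprn_gt0.
have hs := hM s; rewrite (_ : _ <= s <= _) in hs; last by apply/andP; split; rewrite -/s; lra.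
have ks : 0 < k * s by rewrite mulr_gt0.
have ks1 : k * s <= s / 4 by rewrite mulrC ler_pM2l//; lra.
have hs1 := hM (s - k * s); rewrite (_ : _ <= s - _ <= _) in hs1; last by rewrite -/s; apply/andP; split; lra.
have hs2 := hM (s + k * s); rewrite (_ : _ <= s + _ <= _) in hs2; last by rewrite -/s; apply/andP; split; lra.
move: hs hs1 hs2 => /(_ isT) + /(_ isT) + /(_ isT).
set K := (_ + _) * d / q ^+ 3.
have -> : A / s ^+ 2 = A / s * s^-1 by field; rewrite gt_eqF.
have -> : A / (s - k * s) ^+ 2 = A / s * s^-1 / (1 - k) ^+ 2.
  by field; rewrite !gt_eqF//; lra.
have -> : A / (s + k * s) ^+ 2 = A / s * s^-1 / (1 + k) ^+ 2.
  by field; rewrite !gt_eqF//; lra.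
rewrite !ler_norml => /andP[a1 a2] /andP[b1 b2] /andP[c1 c2].
have v1 : M s - M (s - k * s) <= - (k * s) * V s.
  by have := MV s (s - k * s) s0; rewrite addrAC subrr sub0r; apply; lra.
have v2 : M s - M (s + k * s) <= k * s * V s.
  by have := MV s (s + k * s) s0 (addr_gt0 s0 ks); rewrite [_ - s]addrAC subrr add0r.
have KE : s ^+ 2 * K <= (2 + 16 * A) * d.
  rewrite (_ : s ^+ 2 * K = (2 + 16 * A) * d * q); last by rewrite /s /K; field; rewrite gt_eqF.
  by rewrite ler_piMr// mulr_ge0 ?(ltW d0)// addr_ge0// mulr_ge0// ltW.
have kk : 0 <= k * k by rewrite mulr_ge0// ltW.
have r1 : (1 - k) ^- 2 - 1 <= k * (2 + 8 * k).
  have k2 : 0 < (1 - k) ^+ 2 by rewrite exprn_gt0//; lra.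
  rewrite lerBlDr -div1r ler_pdivrMr//.
  have := mulr_ge0 kk (ltW k0); have := mulr_ge0 kk kk.
  have : 0 <= k * k * (5 - 14 * k) by rewrite mulr_ge0//; lra.
  by rewrite expr2; lra.
have r2 : k * (2 - 8 * k) <= 1 - (1 + k) ^- 2.
  have k2 : 0 < (1 + k) ^+ 2 by rewrite exprn_gt0//; lra.
  rewrite lerBrDr -lerBrDl -div1r ler_pdivrMr//.
  have := mulr_ge0 kk (ltW k0); have := mulr_ge0 kk kk.
  by rewrite expr2; lra.
have s2 : 0 <= s ^+ 2 := sqr_ge0 s.
set B := q ^+ 6 * V s; have BE : s ^+ 2 * (k * s * V s) = k * B.
  by rewrite /B (exprM q 2 3) -/s; ring.
have W z L : s ^+ 2 * (A / s / s * z + L * K) = A * z + L * (s ^+ 2 * K).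
  by field; rewrite gt_eqF.
have w1 : k * s * V s <= A / s / s * ((1 - k) ^- 2 - 1) + 2 * K by lra.
have w2 : A / s / s * (1 - (1 + k) ^- 2) + (-2) * K <= k * s * V s by lra.
move: w1 w2 => /(ler_wpM2l s2) w1 /(ler_wpM2l s2) w2.
rewrite BE W in w1; rewrite BE W in w2.
have z1 := ler_wpM2l (ltW A0) r1; have z2 := ler_wpM2l (ltW A0) r2.
have : `|k * (B - 2 * A)| <= k * (2 * (2 + 16 * A) * d / k + 8 * A * k).
  rewrite (_ : k * (2 * (2 + 16 * A) * d / k + 8 * A * k) = 2 * ((2 + 16 * A) * d) + 8 * A * (k * k)); last first.
    by field; rewrite gt_eqF.
  by rewrite ler_norml; clear -w1 w2 z1 z2 KE; apply/andP; split; lra.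
by rewrite normrM (gtr0_norm k0) (ler_pM2l k0) ler_norml.
Qed.

End MeanEstimate.

(** * The asymptotic formula *)

Section LnProduct.
Context {R : realType}.
Variables (r m : nat) (r_gt0 : (0 < r)%N) (r_lt : (2 * r < m)%N).
Let xx : R := r%:R / m%:R.

Let m_gt0 : 0 < m%:R :> R.
Proof. by rewrite ltr0n; clear -r_lt; lia. Qed.

Let xx0 : 0 < xx.
Proof. by rewrite /xx divr_gt0// ltr0n. Qed.

Let xx1 : xx < 1.
Proof. by rewrite /xx ltr_pdivrMr// mul1r ltr_nat; clear -r_lt; lia. Qed.

Lemma prod_part (s : R) N :
  \prod_(i < 2 * N) (1 - rpow s (part r m i)) = thetap xx (m%:R * s) N.
Proof.
elim: N => [|N ih]; first by rewrite muln0 /thetap !big_ord0.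
rewrite mulnS !addSn add0n !big_ord_recr/= ih /thetap big_ord_recr/= -mulrA.
have mn0 : m%:R != 0 :> R by rewrite gt_eqF.
congr (_ * ((1 - expR _) * (1 - expR _))).
  by rewrite part_even natrD natrM /xx; field.
rewrite part_odd natrB; last first.
  by apply: (@leq_trans m); [clear -r_lt; lia|rewrite leq_pmull].
by rewrite natrM -natr1 /xx; field.
Qed.

Lemma ln_prod (J : nat) (u : nat -> R) : (forall i, 0 < u i) ->
  ln (\prod_(i < J) u i) = \sum_(i < J) ln (u i).
Proof.
move=> u0; elim: J => [|J ih]; first by rewrite !big_ord0 ln1.
by rewrite !big_ord_recr/= lnM ?posrE ?prodr_gt0// ih.
Qed.

Lemma lnprod_part (s : R) N : 0 < s ->
  lnprod (part r m) (2 * N) s = - ln (thetap xx (m%:R * s) N).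
Proof.
move=> s0; rewrite -prod_part (ln_prod (2 * N) (fun i => 1 - rpow s (part r m i))); last first.
  by move=> i; case/andP: (sub1_rpow_itv s s0 (part r m i) (part_gt0 r m r_gt0 r_lt i)).
by rewrite /lnprod sumrN.
Qed.

(** Cross-multiplied form of the fact that the block of factors from N to N' increases with t. It
    lets the truncation error at one parameter control that at all larger ones. *)
Lemma thetap_mono (t t' : R) N N' : 0 < t' -> t' <= t -> (N <= N')%N ->
  thetap xx t N * thetap xx t' N' <= thetap xx t' N * thetap xx t N'.
Proof.
move=> t0' tt' /subnK <-; have t0 : 0 < t by exact: lt_le_trans tt'.
elim: (N' - N)%N => [|k ih]; first by rewrite add0n mulrC.
rewrite addSn /thetap ![\prod_(i < (k + N).+1) _]big_ord_recr/= -!/(thetap _ _ _) !mulrA.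
have e y : 0 < y -> 0 <= 1 - expR (- (t' * y)) <= 1 - expR (- (t * y)).
  move=> y0; rewrite subr_ge0 expR_le1 oppr_le0 mulr_ge0 ?(ltW t0') ?(ltW y0)//=.
  by rewrite lerD2l lerN2 ler_expR lerN2 ler_pM2r.
have /andP[a0 a1] : 0 <= 1 - expR (- (t' * ((k + N)%N%:R + xx))) <=
    1 - expR (- (t * ((k + N)%N%:R + xx))).
  by apply: e; rewrite ltr_wpDl.
have /andP[b0 b1] : 0 <= 1 - expR (- (t' * ((k + N)%N%:R + 1 - xx))) <=
    1 - expR (- (t * ((k + N)%N%:R + 1 - xx))).
  by apply: e; rewrite -addrA ltr_wpDl// subr_gt0.
have p0 (z : R) M : 0 < z -> 0 <= thetap xx z M by move=> z0; rewrite ltW// thetap_gt0.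
by rewrite -!mulrA !(mulrA (thetap xx _ N)) ler_pM// ?mulr_ge0 ?p0// ler_pM.
Qed.

(** A decreasing limit of positive numbers could vanish. For small t positivity follows from the
    limit in [cvg_thetal_exp], and every partial product increases with t. *)
Lemma thetal_gt0 (t : R) : 0 < t -> 0 < thetal xx t.
Proof.
move=> t0; have s0 : 0 < 2 * sin (pi * xx).
  rewrite mulr_gt0// sin_gt0_pi// mulr_gt0 ?pi_gt0//=.
  by rewrite gtr_pMr ?pi_gt0.
have : \forall t \near 0^'+, 0 < thetal xx t * expR (pi ^+ 2 / 3 / t).
  by apply: (cvgr_gt _ (cvg_thetal_exp xx xx0 xx1)).
move=> /near_right0P[d d0 hd]; pose t' := Num.min t (d / 2).
have t'0 : 0 < t' by rewrite lt_min t0 divr_gt0.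
have t't : t' <= t by rewrite ge_min lexx.
have t'd : t' <= d / 2 by rewrite ge_min lexx orbT.
have h := hd t'; rewrite t'0 (le_lt_trans t'd) ?ltr_pdivrMr ?ltr_pMr ?ltr1n// in h.
have := h isT; rewrite pmulr_lgt0 ?expR_gt0// => /lt_le_trans; apply.
have c1 : thetap xx t' N @[N --> \oo] --> thetal xx t' by exact: cvg_thetap.
have c2 : thetap xx t N @[N --> \oo] --> thetal xx t by exact: cvg_thetap.
apply: (ler_cvg_to c1 c2); near=> N.
have := thetap_mono t t' 0 N t'0 t't (leq0n N).
by rewrite {1 3}/thetap !big_ord0 !mul1r.
Unshelve. all: by end_near. Qed.

(** The ratio of the truncated to the infinite product is at least 1, and by [thetap_mono] it is
    largest at the smallest parameter, where N makes it less than exp e. *)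
Lemma lnprod_part_uniform (s e : R) : 0 < s -> 0 < e ->
  \forall N \near \oo, forall s', s <= s' ->
    `|lnprod (part r m) (2 * N) s' + ln (thetal xx (m%:R * s'))| <= e.
Proof.
move=> s0 e0; have ms0 : 0 < m%:R * s by rewrite mulr_gt0.
have l0 := thetal_gt0 _ ms0.
have e1 : thetal xx (m%:R * s) < thetal xx (m%:R * s) * expR e.
  by rewrite ltr_pMr// expR_gt1.
have : \forall N \near \oo, thetap xx (m%:R * s) N < thetal xx (m%:R * s) * expR e.
  by apply: (cvgr_lt _ (cvg_thetap xx xx0 xx1 (m%:R * s) ms0)).
apply: filterS => N hN s' ss'; have s0' : 0 < s' by exact: lt_le_trans ss'.
have ms0' : 0 < m%:R * s' by rewrite mulr_gt0.
have l0' := thetal_gt0 _ ms0'.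
rewrite lnprod_part// addrC -ln_div ?posrE//; last exact: thetap_gt0.
have h1 := thetap_ge xx xx0 xx1 (m%:R * s') N ms0'.
have P0 := thetap_gt0 xx xx0 xx1 (m%:R * s') N ms0'.
have h2 : thetap xx (m%:R * s') N <= expR e * thetal xx (m%:R * s').
  have h3 : thetap xx (m%:R * s') N * thetal xx (m%:R * s) <=
      thetap xx (m%:R * s) N * thetal xx (m%:R * s').
    have c1 : thetap xx (m%:R * s') N * thetap xx (m%:R * s) N' @[N' --> \oo] -->
        thetap xx (m%:R * s') N * thetal xx (m%:R * s).
      by apply: cvgMr; exact: cvg_thetap.
    have c2 : thetap xx (m%:R * s) N * thetap xx (m%:R * s') N' @[N' --> \oo] -->
        thetap xx (m%:R * s) N * thetal xx (m%:R * s').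
      by apply: cvgMr; exact: cvg_thetap.
    apply: (ler_cvg_to c1 c2); near=> N'; apply: thetap_mono => //.
      by rewrite ler_pM2l.
    by near: N'; exact: nbhs_infty_ge.
  rewrite -(ler_pM2r l0); apply: (le_trans h3).
  rewrite [leRHS](_ : _ = thetal xx (m%:R * s) * expR e * thetal xx (m%:R * s')).
    by rewrite ler_pM2r// ltW.
  by move: (thetal _ _) (thetal _ _) (expR e) => a b c; ring.
rewrite ler_norml; apply/andP; split.
  rewrite lerNl -lnV ?posrE ?divr_gt0// invf_div.
  by rewrite -ler_expR lnK ?posrE ?divr_gt0// ler_pdivrMr.
by rewrite (le_trans _ (ltW e0))// ln_le0// ler_pdivrMr// mul1r.
Unshelve. all: by end_near. Qed.

Lemma cvg_ln_thetal :
  - ln (thetal xx (m%:R * s)) - (pi ^+ 2 / (3 * m%:R)) / s @[s --> 0^'+] -->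
  - ln (2 * sin (pi * xx)).
Proof.
have s0 : 0 < 2 * sin (pi * xx).
  rewrite mulr_gt0// sin_gt0_pi// mulr_gt0 ?pi_gt0//=.
  by rewrite gtr_pMr ?pi_gt0.
have c := cvg_thetal_exp xx xx0 xx1.
have c2 : (fun s : R => m%:R * s) @ (0 : R)^'+ --> (0 : R)^'+.
  move=> P /near_right0P[d d0 hd]; apply/near_right0P.
  exists (d / m%:R); first by rewrite divr_gt0.
  move=> t /andP[t0 td]; apply: hd; rewrite mulr_gt0//=.
  by rewrite mulrC -ltr_pdivlMr.
have c3 : thetal xx (m%:R * s) * expR (pi ^+ 2 / 3 / (m%:R * s)) @[s --> 0^'+] --> 2 * sin (pi * xx).
  exact: cvg_comp c2 c.
have c4 : - ln (thetal xx (m%:R * s) * expR (pi ^+ 2 / 3 / (m%:R * s))) @[s --> 0^'+] -->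
    - ln (2 * sin (pi * xx)).
  by apply: cvgN; apply: (continuous_cvg _ (continuous_ln s0)).
apply: cvg_trans c4; apply: near_eq_cvg; near=> s.
have s1 : 0 < s by near: s; exact: nbhs_right_gt.
rewrite /= lnM ?posrE ?expR_gt0//; last by rewrite thetal_gt0// mulr_gt0.
rewrite expRK opprD; congr (_ - _).
by move: (pi : R) => p; field; rewrite !gt_eqF.
Unshelve. all: by end_near. Qed.

End LnProduct.

(** * The number of stacks as an integral *)

Section Representation.
Context {R : realType}.
Variables (r m : nat) (r_gt0 : (0 < r)%N) (r_lt : (2 * r < m)%N).
Local Notation x := (part r m).
Local Notation mu := (@lebesgue_measure R).

Let x_gt0 : forall i, (0 < x i)%N := part_gt0 r m r_gt0 r_lt.

Definition stack_kernel (n N : nat) (s l y : R) : R :=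
  cRe ((\sum_(k < N) aterm x (2 * N) s (l * y) (2 * k)%N) * cis (- n%:R * l * y)).

Lemma stack_kernelE (n N : nat) (s l y : R) :
  stack_kernel n N s l y = tailp x (2 * N) s 0 *
  \sum_(k < N) rpow s (x (2 * k)) *
    cRe (genf x s (2 * k).+1 (l * y) * cis (- (n%:Z - (x (2 * k))%:Z)%:~R * l * y)).
Proof.
rewrite /stack_kernel mulr_suml Re_sum mulr_sumr; apply: eq_bigr => k _.
rewrite atermE; last by rewrite ltn_pmul2l.
rewrite -!Re_realM; congr cRe; rewrite /qpow.
have -> : cis (- (n%:Z - (x (2 * k))%:Z)%:~R * l * y) =
    cis (- n%:R * l * y) * cis ((x (2 * k))%:R * (l * y)).
  by rewrite -cisD; congr cis; rewrite rmorphB/=; ring.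
move: (genf _ _ _ _) (real_complex R (tailp _ _ _ _)) (real_complex R (rpow _ _)) => g T p.
ring.
Qed.

Lemma continuous_sum_ord (M : nat) (f : nat -> R -> R) :
  (forall k, continuous (f k)) -> continuous (fun y => \sum_(k < M) f k y).
Proof.
move=> cf; elim: M => [|M ih] y.
  rewrite (_ : (fun y => _) = cst 0); first exact: cst_continuous.
  by apply/funext => z; rewrite big_ord0.
rewrite (_ : (fun y => _) = (fun y => \sum_(k < M) f k y) + f M).
  by apply: cvgD; [exact: ih|exact: cf].
by apply/funext => z; rewrite big_ord_recr.
Qed.

Lemma continuous_stack_kernel (n N : nat) (s l : R) : 0 < s ->
  continuous (stack_kernel n N s l).
Proof.
move=> s0; rewrite (_ : stack_kernel n N s l = fun y => tailp x (2 * N) s 0 *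
  \sum_(k < N) rpow s (x (2 * k)) *
    cRe (genf x s (2 * k).+1 (l * y) * cis (- (n%:Z - (x (2 * k))%:Z)%:~R * l * y))); last first.
  by apply/funext => y; exact: stack_kernelE.
move=> y; apply: cvgM; first exact: cvg_cst.
apply: (continuous_sum_ord N (fun k y => rpow s (x (2 * k)) *
  cRe (genf x s (2 * k).+1 (l * y) * cis (- (n%:Z - (x (2 * k))%:Z)%:~R * l * y)))) => k z.
by apply: cvgM; [exact: cvg_cst|exact: continuous_coef].
Qed.

(** The truncation loses nothing: [part (2 * k)] exceeds k, so n < N leaves room for every peak of
    size at most n, and larger peaks contribute vanishing coefficients by [coef_lt0]. *)
Lemma num_stacks_integral (n N : nat) (s l : R) : 0 < s -> 0 < l -> (n < N)%N ->
  (num_mixed_congruence_stacks r m n)%:R * rpow s n * (2 * (pi / l)) * tailp x (2 * N) s 0 =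
  \int[mu]_(y in `[- (pi / l), pi / l]) stack_kernel n N s l y.
Proof.
move=> s0 l0 nN; under eq_Rintegral do rewrite stack_kernelE.
pose f k y := rpow s (x (2 * k)) *
  cRe (genf x s (2 * k).+1 (l * y) * cis (- (n%:Z - (x (2 * k))%:Z)%:~R * l * y)).
have cf k : continuous (f k).
  by move=> y; apply: cvgM; [exact: cvg_cst|exact: continuous_coef].
have intf k : mu.-integrable `[- (pi / l), pi / l] (EFin \o f k).
  exact: continuous_integrable_itv.
have cF M : continuous (fun y => \sum_(k < M) f k y) by exact: continuous_sum_ord.
rewrite RintegralZl//; last exact: continuous_integrable_itv.
rewrite mulrC; congr (_ * _).
have -> : \int[mu]_(y in `[- (pi / l), pi / l]) (\sum_(k < N) f k y) =
    \sum_(k < N) rpow s (x (2 * k)) * coef x s l (2 * k).+1 (n%:Z - (x (2 * k))%:Z).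
  elim: N {nN} => [|M ih].
    by under eq_Rintegral do rewrite big_ord0; rewrite big_ord0 Rintegral_cst// mul0r.
  under eq_Rintegral do rewrite big_ord_recr/=.
  have -> : \int[mu]_(y in `[- (pi / l), pi / l]) (\sum_(k < M) f k y + f M y) =
      \int[mu]_(y in `[- (pi / l), pi / l]) (\sum_(k < M) f k y) +
      \int[mu]_(y in `[- (pi / l), pi / l]) f M y.
    by apply: RintegralD => //; exact: continuous_integrable_itv.
  rewrite ih big_ord_recr/=; congr (_ + _).
  by rewrite /f RintegralZl//; exact: integrable_coef.
have npE j k := coefE x x_gt0 (npairs r m) (npairs0 r m) (npairsS r m r_gt0 r_lt) s l s0 l0 j k.
rewrite (num_stacksE r m r_gt0 r_lt) natr_sum.
rewrite (big_ord_widen_cond N (fun k => x (2 * k)%N <= n)%N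
  (fun k => (npairs r m (2 * k).+1 (n - x (2 * k))%N)%:R : R) nN).
rewrite -mulrA mulr_suml [RHS](bigID (fun k : 'I_N => (x (2 * k) <= n)%N))/=.
rewrite [X in _ = _ + X]big1 ?addr0.
  apply: eq_big => k.
    apply: andb_idr => kn; rewrite ltnS.
    by apply: leq_trans kn; apply: leq_trans (ltnW (part_gt r m r_gt0 r_lt _)); lia.
  move=> /andP[kn _]; rewrite subzn// npE -{2}(subnKC kn) rpowD; ring.
move=> k; rewrite -ltnNge => kn; rewrite (coef_lt0 x x_gt0 s l s0 l0) ?mulr0//.
by rewrite subr_lt0 ltz_nat.
Qed.

End Representation.

(** * Dominated convergence on growing intervals *)

Section DominatedIntervals.
Context {R : realType}.
Local Notation mu := (@lebesgue_measure R).

Lemma integrable_oneDsqrV (C : R) : mu.-integrable setT (fun y => (C / (1 + y ^+ 2))%:E).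
Proof.
have c : continuous (fun y : R => (oneDsqr y)^-1) by exact: continuous_oneDsqrV.
have m0 : measurable_fun setT (fun y : R => (oneDsqr y)^-1).
  exact: continuous_measurable_fun.
have m1 := (measurable_EFinP _ _).2 m0.
have i1 : mu.-integrable setT (fun y : R => ((oneDsqr y)^-1)%:E).
  apply/integrableP; split => //.
  under eq_integral do rewrite gee0_abs ?lee_fin ?invr_ge0 ?addr_ge0 ?sqr_ge0//.
  rewrite ge0_symfun_integralT//=.
    rewrite (_ : [set x | _] = `[0, +oo[%classic); last first.
      by apply/seteqP; split => y /=; rewrite in_itv/= andbT.
    by rewrite integral0y_oneDsqr -EFinM ltry.
  by move=> y; rewrite /= /oneDsqr sqrrN.
have := @integrableZl _ _ _ mu setT measurableT C _ i1.
by apply: eq_integrable => // y _; rewrite EFinM.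
Qed.

(** The integrands are extended by zero. The majorant C / (1 + y ^ 2) is weak enough to lie above
    both the Gaussian bound and the bound far from the saddle point. *)
Lemma cvg_integral_itv (b : nat -> R) (F : nat -> R -> R) (G : R -> R) (C : R) :
  0 <= C -> b n @[n --> \oo] --> +oo -> (forall n, continuous (F n)) -> continuous G ->
  (forall n y, `|y| <= b n -> `|F n y| <= C / (1 + y ^+ 2)) ->
  (forall y, F n y @[n --> \oo] --> G y) ->
  \int[mu]_(y in `[- b n, b n]) F n y @[n --> \oo] --> \int[mu]_y G y.
Proof.
move=> C0 by_ cF cG FC FG.
pose f n := EFin \o (F n \_ `[- b n, b n]).
have mf0 n : measurable_fun setT (F n \_ `[- b n, b n]).
  apply/(measurable_restrictT _ _).1 => //.
  by apply: measurable_funTS; exact: continuous_measurable_fun.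
have mf n := (measurable_EFinP _ _).2 (mf0 n).
have mG0 : measurable_fun setT G by exact: continuous_measurable_fun.
have mG := (measurable_EFinP _ _).2 mG0.

have cfG : {ae mu, forall y, setT y -> f n y @[n --> \oo] --> (EFin \o G) y}.
  apply: aeW => y _; apply: cvg_EFin; first by near=> n.
  apply: cvg_trans (FG y); apply: near_eq_cvg; near=> n.
  rewrite /f /= patchE mem_set//= in_itv/=.
  rewrite -ler_norml; near: n.
  by have /cvgryPge/(_ `|y|) := by_.
have dom : {ae mu, forall y n, setT y -> (`|f n y| <= (C / (1 + y ^+ 2))%:E)%E}.
  apply: aeW => y n _; rewrite /f /= patchE; case: ifPn => [|_].
    by rewrite inE/= in_itv/= -ler_norml => yb; rewrite lee_fin FC.
  have -> : point = 0 :> R by [].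
  by rewrite normr0 lee_fin divr_ge0// addr_ge0// sqr_ge0.
have [iG _ cc] := @dominated_convergence _ _ _ mu setT measurableT f (EFin \o G) _
  mf mG cfG (integrable_oneDsqrV C) dom.
have fin : (\int[mu]_y (EFin \o G) y)%E \is a fin_num by exact: integrable_fin_num.
move: cc; rewrite -(fineK fin) => /fine_cvg.
by under [X in _ -> X @ _ --> _]eq_fun do rewrite Rintegral_mkcond.
Unshelve. all: by end_near. Qed.

End DominatedIntervals.

(** * The saddle point: choice of parameters and conclusion *)

Section SaddlePoint.
Context {R : realType}.
Variables (r m : nat) (coprime_rm : coprime r m) (r_gt0 : (0 < r)%N) (r_lt : (2 * r < m)%N).
Local Notation x := (part r m).
Local Notation xx := (r%:R / m%:R : R).

Let m_gt0 : 0 < m%:R :> R.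
Proof. by rewrite ltr0n; clear -r_lt; lia. Qed.

Let x_gt0 : forall i, (0 < x i)%N := part_gt0 r m r_gt0 r_lt.

Definition sadA : R := pi ^+ 2 / (3 * m%:R).
Local Notation A := sadA.

(* The saddle point is [exp (- q ^ 2)], with [q ^ 4 = A / n]. *)
Definition sadq (n : nat) : R := Num.sqrt (Num.sqrt (A / n%:R)).
Local Notation q := sadq.

Lemma sin_pi_ratio_gt0 : 0 < sin (pi * xx).
Proof.
have xx0 : 0 < xx by rewrite divr_gt0// ltr0n.
rewrite sin_gt0_pi// mulr_gt0 ?pi_gt0//=.
by rewrite gtr_pMr ?pi_gt0// ltr_pdivrMr// mul1r ltr_nat; clear -r_lt; lia.
Qed.

Lemma sadA_gt0 : 0 < A.
Proof. by rewrite /A divr_gt0 ?exprn_gt0 ?pi_gt0 ?mulr_gt0. Qed.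
Let A0 := sadA_gt0.

Lemma sadq_gt0 n : (0 < n)%N -> 0 < q n.
Proof. by move=> n0; rewrite !sqrtr_gt0 divr_gt0// ltr0n. Qed.

Lemma sadq_ge0 n : 0 <= q n.
Proof. exact: sqrtr_ge0. Qed.

Lemma sadq4 n : q n ^+ 4 = A / n%:R.
Proof.
rewrite (exprM _ 2 2) sqr_sqrtr ?sqrtr_ge0// sqr_sqrtr// divr_ge0//.
exact: ltW.
Qed.

Lemma near_sadq (e : R) : 0 < e -> \forall n \near \oo, [/\ (0 < n)%N, 0 < q n & q n < e].
Proof.
move=> e0; near=> n.
have n0 : (0 < n)%N by near: n; exact: nbhs_infty_gt.
split => //; first exact: sadq_gt0.
rewrite -(@ltr_pXn2r _ 4)// ?nnegrE ?sadq_ge0 ?(ltW e0)//.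
rewrite sadq4 ltr_pdivrMr ?ltr0n// mulrC -ltr_pdivrMr ?exprn_gt0//.
by near: n; exact: nbhs_infty_gtr.
Unshelve. all: by end_near. Qed.

Lemma cvg_sadq : q n @[n --> \oo] --> 0.
Proof.
apply/cvgr0Pnorm_le => e e0; apply: filterS (near_sadq e e0) => n [_ q0 qe].
by rewrite ger0_norm ltW.
Qed.

(** The largest L with L m q ^ 2 <= 1, the range of [normc_even_terms_le]. *)
Let L n := Num.trunc (m%:R * q n ^+ 2)^-1.

(** The truncation is chosen after n: the formula for the count only asks for n < N, while the
    uniform closeness to the infinite product, with an error q n tending to 0, may require a much
    larger N. *)
Lemma saddle_cutoff : exists N : nat -> nat, forall n, (0 < n)%N ->
  [/\ (n < N n)%N, (2 * L n <= N n)%N &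
   forall s, q n ^+ 2 / 4 <= s ->
    `|lnprod x (2 * N n) s + ln (thetal xx (m%:R * s))| <= q n].
Proof.
suff h n : exists M, (0 < n)%N -> [/\ (n < M)%N, (2 * L n <= M)%N &
   forall s, q n ^+ 2 / 4 <= s ->
    `|lnprod x (2 * M) s + ln (thetal xx (m%:R * s))| <= q n].
  by have [N hN] := choice h; exists N.
have [->|n0] := posnP n; first by exists 0%N.
have q0 := sadq_gt0 n n0; have s0 : 0 < q n ^+ 2 / 4 by rewrite divr_gt0 ?exprn_gt0.
have [N0 _ h] := lnprod_part_uniform r m r_gt0 r_lt _ _ s0 q0.
exists (N0 + n.+1 + 2 * L n)%N => _; split; [by clear; lia|by clear; lia|].
by apply: h => /=; clear; lia.
Qed.

Variable N : nat -> nat.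
Hypothesis N_spec : forall n, (0 < n)%N ->
  [/\ (n < N n)%N, (2 * L n <= N n)%N &
   forall s, q n ^+ 2 / 4 <= s ->
    `|lnprod x (2 * N n) s + ln (thetal xx (m%:R * s))| <= q n].

Let C : R := - ln (2 * sin (pi * xx)).

Lemma lnprod_estimate (e : R) : 0 < e -> \forall n \near \oo,
  forall s, q n ^+ 2 / 4 <= s <= 4 * q n ^+ 2 ->
  `|lnprod x (2 * N n) s - (A / s + C)| <= e.
Proof.
move=> e0; have e2 : 0 < e / 2 by rewrite divr_gt0.
have := @cvg_ln_thetal R r m r_gt0 r_lt.
move=> /cvgrPdist_le/(_ _ e2)/near_right0P[d d0 hd].
have d1 : 0 < Num.min 1 (Num.min (d / 4) (e / 2)) by rewrite !lt_min ltr01/= divr_gt0.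
apply: filterS (near_sadq _ d1) => n [n0 q0]; rewrite !lt_min => /and3P[q1 qd qe] s /andP[s1 s2].
have s0 : 0 < s by apply: lt_le_trans s1; rewrite divr_gt0 ?exprn_gt0.
have [_ _ /(_ s s1) h1] := N_spec n n0.
have h2 : `|C - (- ln (thetal xx (m%:R * s)) - A / s)| <= e / 2.
  apply: hd; rewrite s0/=; apply: (le_lt_trans s2).
  rewrite mulrC -ltr_pdivlMr//; apply: le_lt_trans qd.
  by rewrite expr2 ler_piMr// ltW.
have -> : lnprod x (2 * N n) s - (A / s + C) =
  (lnprod x (2 * N n) s + ln (thetal xx (m%:R * s))) -
  (C - (- ln (thetal xx (m%:R * s)) - A / s)) by ring.
by apply: (le_trans (ler_normB _ _)); lra.
Qed.

Let M n := mean x (2 * N n) (q n ^+ 2).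
Let V n := variance x (2 * N n) (q n ^+ 2).

(** The saddle-point equation is A / q ^ 4 = n. The mean must match n up to a vanishing fraction of
    the standard deviation, which by [cvg_variance] is of order q ^ (- 3). *)
Lemma cvg_mean : (M n - n%:R) * q n ^+ 3 @[n --> \oo] --> 0.
Proof.
apply/cvgr0Pnorm_le => e e0; pose K := 2 + 16 * A.
have K0 : 0 < K by rewrite addr_gt0// mulr_gt0.
pose d := Num.min (1 / 4) (e / K).
have d0 : 0 < d by rewrite lt_min !divr_gt0.
have d20 : 0 < d ^+ 2 by rewrite exprn_gt0.
near=> n; have [n0 q0 q1] : [/\ (0 < n)%N, 0 < q n & q n < 1].
  by near: n; exact: near_sadq.
have h : forall s, q n ^+ 2 / 4 <= s <= 4 * q n ^+ 2 ->
   `|lnprod x (2 * N n) s - (A / s + C)| <= d ^+ 2.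
  by near: n; exact: lnprod_estimate.
have := mean_estimate (lnprod x (2 * N n)) (mean x (2 * N n)) A C A0
  (lnprod_convex x x_gt0 (2 * N n)) (q n) d _ _ h (q n ^+ 2).
rewrite q0 (ltW q1) d0 ge_min lexx/= => /(_ isT isT) h1.
have q20 : 0 < q n ^+ 2 by rewrite exprn_gt0.
have q30 : 0 < q n ^+ 3 by rewrite exprn_gt0.
have := h1 _; rewrite (_ : _ <= _ <= _); last by apply/andP; split; lra.
move=> /(_ isT).
have -> : A / (q n ^+ 2) ^+ 2 = n%:R.
  by rewrite -exprM sadq4 invf_div mulrC divfK// gt_eqF.
rewrite -/(M n) ler_pdivlMr// normrM (gtr0_norm q30) => /le_trans; apply.
rewrite -/K mulrC -ler_pdivlMr//.
by rewrite /d ge_min lexx orbT.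
Unshelve. all: by end_near. Qed.

Lemma cvg_variance : q n ^+ 6 * V n @[n --> \oo] --> 2 * A.
Proof.
apply/cvgrPdist_le => e e0; pose K := 2 + 16 * A.
have K0 : 0 < K by rewrite addr_gt0// mulr_gt0.
(* [k] makes the curvature term at most e / 2; [d] is chosen after it, as its error is divided by
   [k]. *)
pose k := Num.min (1 / 4) (e / (16 * A)).
have k0 : 0 < k by rewrite lt_min !divr_gt0// mulr_gt0.
pose d := Num.min (1 / 4) (e * k / (4 * K)).
have d0 : 0 < d by rewrite lt_min !divr_gt0// mulr_gt0.
have d20 : 0 < d ^+ 2 by rewrite exprn_gt0.
near=> n; have [n0 q0 q1] : [/\ (0 < n)%N, 0 < q n & q n < 1].
  by near: n; exact: near_sadq.
have h : forall s, q n ^+ 2 / 4 <= s <= 4 * q n ^+ 2 ->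
   `|lnprod x (2 * N n) s - (A / s + C)| <= d ^+ 2.
  by near: n; exact: lnprod_estimate.
have := variance_estimate (lnprod x (2 * N n)) (mean x (2 * N n)) (variance x (2 * N n)) A C A0
  (lnprod_convex x x_gt0 (2 * N n)) (mean_convex x x_gt0 (2 * N n)) (q n) d k _ _ _ h.
rewrite q0 (ltW q1) d0 k0 !ge_min !lexx/= => /(_ isT isT isT).
rewrite -/(V n) distrC => /le_trans; apply.
have d1 : d <= e * k / (4 * K) by rewrite ge_min lexx orbT.
have k1 : k <= e / (16 * A) by rewrite ge_min lexx orbT.
rewrite -/K; have : 2 * K * d / k <= e / 2.
  rewrite ler_pdivrMr// mulrC -ler_pdivlMr ?mulr_gt0//; apply: (le_trans d1).
  by rewrite le_eqVlt; apply/orP; left; apply/eqP; field; rewrite gt_eqF.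
have : k * (16 * A) <= e by rewrite -ler_pdivlMr// mulr_gt0.
lra.
Unshelve. all: by end_near. Qed.

Lemma cvg_tailp : tailp x (2 * N n) (q n ^+ 2) 0 * expR (A / q n ^+ 2) @[n --> \oo] -->
  2 * sin (pi * xx).
Proof.
have s0 : 0 < 2 * sin (pi * xx).
  by rewrite mulr_gt0// sin_pi_ratio_gt0.
have c : A / q n ^+ 2 - lnprod x (2 * N n) (q n ^+ 2) @[n --> \oo] --> - C.
  apply/cvgrPdist_le => e e0; near=> n.
  have [n0 q0 q1] : [/\ (0 < n)%N, 0 < q n & q n < 1] by near: n; exact: near_sadq.
  have q20 : 0 < q n ^+ 2 by rewrite exprn_gt0.
  have h : forall s, q n ^+ 2 / 4 <= s <= 4 * q n ^+ 2 ->
     `|lnprod x (2 * N n) s - (A / s + C)| <= e.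
    by near: n; exact: lnprod_estimate.
  have := h (q n ^+ 2); rewrite (_ : _ <= _ <= _); last by apply/andP; split; lra.
  by move=> /(_ isT); congr (`| _ | <= _); ring.
have c2 : expR (A / q n ^+ 2 - lnprod x (2 * N n) (q n ^+ 2)) @[n --> \oo] --> expR (- C).
  by apply: (continuous_cvg _ (@continuous_expR R _)).
rewrite opprK lnK ?posrE// in c2.
apply: cvg_trans c2; apply: near_eq_cvg; near=> n.
have [n0 q0 q1] : [/\ (0 < n)%N, 0 < q n & q n < 1] by near: n; exact: near_sadq.
rewrite /= expRD expRN expR_lnprod// ?exprn_gt0// invrK mulrC.
by rewrite /tailp big_mkord.
Unshelve. all: by end_near. Qed.

Let a := Num.sqrt A.
(** With t = l y and variance about 2 A / q ^ 6, the exponent V t ^ 2 / 2 tends to y ^ 2. *)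
Let l n := q n ^+ 3 / a.

Let a0 : 0 < a.
Proof. by rewrite sqrtr_gt0. Qed.

Let a2 : a ^+ 2 = A.
Proof. by rewrite sqr_sqrtr// ltW. Qed.

Let F n (y : R) := stack_kernel r m n (N n) (q n ^+ 2) (l n) y.

Lemma expRN_sqr_le (c y : R) : 0 < c -> expR (- (c * y ^+ 2)) <= (1 + c^-1) / (1 + y ^+ 2).
Proof.
move=> c0; have y0 : 0 < 1 + y ^+ 2 by rewrite ltr_pwDl// sqr_ge0.
rewrite ler_pdivlMr//.
have h := expR_ge1Dx (c * y ^+ 2).
have h1 : 1 + y ^+ 2 <= (1 + c^-1) * (1 + c * y ^+ 2).
  rewrite (_ : (1 + c^-1) * (1 + c * y ^+ 2) = 1 + y ^+ 2 + (c^-1 + c * y ^+ 2)); last first.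
    by field; rewrite gt_eqF.
  by rewrite lerDl addr_ge0 ?invr_ge0 ?(ltW c0)// mulr_ge0 ?sqr_ge0 ?(ltW c0).
have c1 : 0 <= 1 + c^-1 by rewrite addr_ge0// invr_ge0 ltW.
rewrite expRN mulrC ler_pdivrMr ?expR_gt0//; apply: (le_trans h1).
by rewrite ler_wpM2l.
Qed.

(** Far from the saddle point the bound is constant in y, but |y| <= pi / l is at most of order q ^
    (- 3). With p = q ^ 2 this is the hypothesis on y, and exp z >= (z / 3) ^ 3 beats the cube. *)
Lemma expRN_inv_sqr_le (c B p y : R) : 0 < c -> 0 < p -> y ^+ 2 <= B / p ^+ 3 ->
  expR (- (c / p)) <= (1 + 27 * B / c ^+ 3) / (1 + y ^+ 2).
Proof.
move=> c0 p0 yB; have y0 : 0 < 1 + y ^+ 2 by rewrite ltr_pwDl// sqr_ge0.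
have B0 : 0 <= B.
  have : 0 <= B / p ^+ 3 by apply: le_trans yB; exact: sqr_ge0.
  by rewrite pmulr_lge0// invr_gt0 exprn_gt0.
rewrite ler_pdivlMr//; set z := c / p; have z0 : 0 < z by rewrite divr_gt0.
have h : (z / 3) ^+ 3 <= expR z.
  have -> : expR z = expR (z / 3) ^+ 3 by rewrite -expRM_natl; congr expR; field.
  have z30 : 0 <= z / 3 by move: z0; lra.
  by rewrite lerXn2r ?nnegrE ?expR_ge0//; have := expR_ge1Dx (z / 3); lra.
have h1 : 1 <= expR z by have := expR_ge1Dx z; move: z0; lra.
rewrite expRN mulrC ler_pdivrMr ?expR_gt0//.
have c30 : 0 < c ^+ 3 by rewrite exprn_gt0.
have yz : y ^+ 2 <= 27 * B / c ^+ 3 * (z / 3) ^+ 3.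
  apply: (le_trans yB); rewrite le_eqVlt /z; apply/orP; left; apply/eqP.
  by field; rewrite !gt_eqF.
have : 0 <= 27 * B / c ^+ 3 by rewrite divr_ge0 ?mulr_ge0// ltW.
move: (27 * B / c ^+ 3) yz => D yz D0.
have := ler_wpM2l D0 h; lra.
Qed.

Lemma stack_kernel_dominated : exists2 K : R, 0 <= K & \forall n \near \oo,
  forall y, `|y| <= pi / l n -> `|F n y| <= K / (1 + y ^+ 2).
Proof.
have [c c0 [L0 L00 hL]] := @normc_even_terms_le R r m coprime_rm r_gt0 r_lt.
(* With z = 1 / (m q ^ 2) and L >= z / 2, c1 / q ^ 2 = c z / 2 <= c L; [c2] is what (c1 / q ^ 2) (z
   t / 2) ^ 2 leaves of y ^ 2 at t = l y. *)
pose c1 := c / (2 * m%:R); have c10 : 0 < c1 by rewrite divr_gt0// mulr_gt0.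
pose c2 := c1 / (4 * m%:R ^+ 2 * A).
have c20 : 0 < c2.
  by apply: divr_gt0 => //; apply: mulr_gt0 => //; apply: mulr_gt0 => //; exact: exprn_gt0.
pose K1 := 1 + 27 * (pi ^+ 2 * A) / c1 ^+ 3; pose K2 := 1 + c2^-1.
have K10 : 0 <= K1.
  rewrite addr_ge0//; apply: divr_ge0; last by rewrite exprn_ge0// ltW.
  by apply: mulr_ge0 => //; apply: mulr_ge0; [exact: sqr_ge0|exact: ltW].
have K20 : 0 <= K2 by rewrite addr_ge0// invr_ge0 ltW.
exists (2 * K1 + K2); first by rewrite addr_ge0// mulr_ge0.
(* q < e <= 1 gives m q ^ 2 <= 1 / (L0 + 2), so that the cutoff [L n] is at least [L0]. *)
pose e : R := Num.min 1 (m%:R * (L0%:R + 2))^-1.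
have e0 : 0 < e by rewrite lt_min ltr01 invr_gt0 mulr_gt0// addr_gt0// ltr0n.
apply: filterS (near_sadq e e0) => n [n0 q0]; rewrite lt_min => /andP[q1 qe] y yl.
have q20 : 0 < q n ^+ 2 by rewrite exprn_gt0.
have mq : 0 < m%:R * q n ^+ 2 by rewrite mulr_gt0.
set z := (m%:R * q n ^+ 2)^-1; have z0 : 0 < z by rewrite invr_gt0.
have zL : L0%:R + 2 <= z.
  rewrite -[leLHS]invrK lef_pV2 ?posrE ?invr_gt0 ?addr_gt0 ?ltr0n//.
  rewrite -ler_pdivlMl// -invfM.
  apply: le_trans (ltW qe); by rewrite expr2 ler_piMr// ltW.
have /andP[Lz zL1] := truncn_itv (ltW z0); rewrite -/(L n) in Lz zL1.
have L2 : z / 2 <= (L n)%:R.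
  have : 0 <= L0%:R :> R by [].
  by rewrite -natr1 in zL1; lra.
have L0L : (L0 <= L n)%N.
  by rewrite /L -/z truncn_ge_nat ?(ltW z0)//; lra.
have Ls : (L n * m)%:R * q n ^+ 2 <= 1.
  by rewrite natrM -mulrA -ler_pdivlMr// div1r.
have l0 : 0 < l n by rewrite divr_gt0// exprn_gt0.
have tp : `|l n * y| <= pi by rewrite normrM gtr0_norm// mulrC -ler_pdivlMr.
have [nN LN _] := N_spec n n0.
have := hL (L n) (N n) (q n ^+ 2) (l n * y) L0L LN q20 Ls tp => h.
apply: (@le_trans _ _ (2 * expR (- (c1 / q n ^+ 2)) + expR (- (c2 * y ^+ 2)))).
  rewrite /F /stack_kernel; apply: (le_trans (abs_Re_le _)).
  rewrite normcM normc_cis mulr1; apply: (le_trans h).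
  have cz : c1 / q n ^+ 2 = c * (z / 2).
    by rewrite /c1 /z; field; rewrite !gt_eqF.
  have cL : c1 / q n ^+ 2 <= c * (L n)%:R by rewrite cz ler_pM2l.
  apply: lerD; first by rewrite ler_pM2l// ler_expR lerN2.
  rewrite ler_expR lerN2.
  apply: (@le_trans _ _ (c1 / q n ^+ 2 * (z / 2 * (l n * y)) ^+ 2)).
    rewrite le_eqVlt /c2 /z /l -a2; apply/orP; left; apply/eqP.
    by field; rewrite !gt_eqF.
  apply: ler_pM; [by apply: divr_ge0; exact: ltW|exact: sqr_ge0|exact: cL|].
  have e2 (u v : R) : (u * v) ^+ 2 = u ^+ 2 * v ^+ 2 by ring.
  rewrite (e2 (z / 2)) (e2 (L n)%:R); apply: ler_wpM2r; first exact: sqr_ge0.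
  by rewrite lerXn2r ?nnegrE//; move: z0; lra.
have -> : (2 * K1 + K2) / (1 + y ^+ 2) = 2 * (K1 / (1 + y ^+ 2)) + K2 / (1 + y ^+ 2).
  by rewrite [LHS]mulrDl -mulrA.
apply: lerD; last exact: expRN_sqr_le.
rewrite ler_pM2l//; apply: expRN_inv_sqr_le => //.
rewrite -(real_normK (num_real y)).
have -> : pi ^+ 2 * A / (q n ^+ 2) ^+ 3 = (pi / l n) ^+ 2.
  by rewrite -a2 /l; move: (pi : R) => p; field; rewrite !gt_eqF.
have pl : 0 <= pi / l n by apply: divr_ge0; [exact: pi_ge0|exact: ltW].
by rewrite lerXn2r ?nnegrE.
Qed.

Lemma cvg_expRN_inv_sadq : expR (- (A / q n ^+ 2)) @[n --> \oo] --> 0.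
Proof.
have c : q n ^+ 2 / A @[n --> \oo] --> 0.
  have c1 : q n ^+ 2 / A @[n --> \oo] --> 0 ^+ 2 / A.
    by apply: cvgMl; apply: (continuous_cvg _ (@exprn_continuous R 2 0)); exact: cvg_sadq.
  by rewrite expr0n/= mul0r in c1.
apply: (squeeze_cvgr _ (cvg_cst 0) c); near=> n.
have [n0 q0 q1] : [/\ (0 < n)%N, 0 < q n & q n < 1] by near: n; exact: near_sadq.
have z0 : 0 < A / q n ^+ 2 by apply: divr_gt0 => //; exact: exprn_gt0.
rewrite expR_ge0 /= expRN -[leRHS]invf_div lef_pV2 ?posrE ?expR_gt0//.
by have := expR_ge1Dx (A / q n ^+ 2); lra.
Unshelve. all: by end_near. Qed.

Lemma rpow_sadq n : (0 < n)%N -> rpow (q n ^+ 2) n = expR (- (A / q n ^+ 2)).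
Proof.
move=> n0; congr (expR (- _)); have q0 := sadq_gt0 n n0.
have -> : A = n%:R * q n ^+ 4 by rewrite sadq4 mulrC divfK// gt_eqF// ltr0n.
by field; rewrite gt_eqF.
Qed.

(** At t = l y this is exp (- V t ^ 2 / 2) cos ((M - n) t), written in terms of the two quantities
    whose limits are known. *)
Let h n y := expR (- (q n ^+ 6 * V n * (y ^+ 2 / (2 * A)))) *
  cos ((M n - n%:R) * q n ^+ 3 * (y / a)).

Lemma cvg_gauss_factor y : h n y @[n --> \oo] --> expR (- y ^+ 2).
Proof.
have c1 : - (q n ^+ 6 * V n * (y ^+ 2 / (2 * A))) @[n --> \oo] --> - (2 * A * (y ^+ 2 / (2 * A))).
  by apply: cvgN; apply: cvgMl; exact: cvg_variance.
have c2 : (M n - n%:R) * q n ^+ 3 * (y / a) @[n --> \oo] --> 0 * (y / a).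
  by apply: cvgMl; exact: cvg_mean.
have -> : - y ^+ 2 = - (2 * A * (y ^+ 2 / (2 * A))) by field; rewrite gt_eqF.
have c3 : h n y @[n --> \oo] --> expR (- (2 * A * (y ^+ 2 / (2 * A)))) * cos (0 * (y / a)).
  apply: cvgM; first by apply: (continuous_cvg _ (@continuous_expR R _)).
  by apply: (continuous_cvg _ (@continuous_cos R _)).
by rewrite mul0r cos0 mulr1 in c3.
Qed.

(** For fixed y, t = l y is of order q ^ 3, so 7 |t| <= q ^ 2 eventually. The error of
    [headz_approx] is then of order (q ^ 3 / q ^ 2) ^ 3 / q ^ 2 = q, and the rest comes from
    [sum_aterm_even]. *)
Lemma stack_kernel_approx y : \forall n \near \oo, `|F n y - 2^-1 * h n y| <=
  tailp x (2 * N n) (q n ^+ 2) 0 + expR m%:R *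
   (m%:R * (2 * q n ^+ 2 + q n ^+ 3 * (`|y| / a)) + expR (- (A / q n ^+ 2))) +
  90 * (q n * (7 * `|y| / a) ^+ 3).
Proof.
have e0 : 0 < Num.min 1 (a / (7 * (`|y| + 1))).
  by rewrite lt_min ltr01/= divr_gt0// mulr_gt0// ltr_wpDl.
apply: filterS (near_sadq _ e0) => n [n0 q0]; rewrite lt_min => /andP[q1 qy].
have s0 : 0 < q n ^+ 2 by rewrite exprn_gt0.
have q30 : 0 < q n ^+ 3 by rewrite exprn_gt0.
have [nN _ _] := N_spec n n0.
pose t := l n * y.
have tE : `|t| = q n ^+ 3 * (`|y| / a).
  by rewrite /t /l normrM ger0_norm ?divr_ge0 ?(ltW q30) ?(ltW a0)// -!mulrA (mulrC a^-1).
have ts : 7 * `|t| <= q n ^+ 2.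
  rewrite tE (_ : 7 * (q n ^+ 3 * (`|y| / a)) = q n ^+ 2 * (q n * (7 * `|y| / a))); last by ring.
  rewrite ler_piMr ?(ltW s0)//.
  apply: (@le_trans _ _ (a / (7 * (`|y| + 1)) * (7 * `|y| / a))).
    by rewrite ler_wpM2r ?(ltW qy)// divr_ge0 ?mulr_ge0 ?(ltW a0).
  have y1 : 0 < `|y| + 1 by rewrite ltr_wpDl.
  rewrite (_ : a / (7 * (`|y| + 1)) * (7 * `|y| / a) = `|y| / (`|y| + 1)); last first.
    by field; rewrite !gt_eqF.
  by rewrite ler_pdivrMr// mul1r lerDl.
have k1 := sum_aterm_even x m (2 * N n) (q n ^+ 2) x_gt0 (part_ltS r m r_gt0 r_lt)
  (part_leS r m r_gt0 r_lt) s0 t (N n) erefl.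
have k2 := headz_approx x (2 * N n) (q n ^+ 2) t (part_gt r m r_gt0 r_lt) s0 ts.
rewrite -/(mean x (2 * N n) (q n ^+ 2)) -/(variance x (2 * N n) (q n ^+ 2)) -/(M n) -/(V n) in k2.
set w := _ * cis (M n * t) in k2.
have hE : h n y = cRe (w * cis (- n%:R * t)).
  rewrite /w -mulrA -cisD Re_realM /h /=; congr (expR _ * cos _).
    by rewrite /t /l -a2; field; rewrite gt_eqF.
  by rewrite /t /l; field; rewrite gt_eqF.
have -> : F n y - 2^-1 * h n y = cRe ((\sum_(k < N n) aterm x (2 * N n) (q n ^+ 2) t (2 * k) -
    2^-1 * headz x (q n ^+ 2) t (2 * N n) +
    real_complex R 2^-1 * (headz x (q n ^+ 2) t (2 * N n) - w)) * cis (- n%:R * t)).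
  have r2 : real_complex R 2^-1 = 2^-1 by rewrite fmorphV rmorph_nat.
  rewrite hE -Re_realM /F /stack_kernel -ReB; congr cRe.
  rewrite r2 -(mulrA (- n%:R)) -/t.
  clear k1 k2 hE; move: (\sum_(k < N n) _) (headz _ _ _ _) w => S Z w'; ring.
apply: (le_trans (abs_Re_le _)); rewrite normcM normc_cis mulr1.
apply: (le_trans (normcD _ _)); apply: lerD.
  apply: (le_trans k1); rewrite lerD2l; apply: ler_pM; rewrite ?expR_ge0//.
  - by rewrite addr_ge0 ?rpow_ge0// mulr_ge0// addr_ge0// mulr_ge0// ltW.
  - rewrite ler_expR ler_piMr// expr_le1// ltW//.
  rewrite tE lerD2l -rpow_sadq//; apply: ler_rpow => //.
  by clear -nN; lia.
rewrite (normcM (real_complex R 2^-1)) normc_real ger0_norm//.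
have -> : 90 * (q n * (7 * `|y| / a) ^+ 3) = 2^-1 * (180 * (7 * `|t| / q n ^+ 2) ^+ 3 / q n ^+ 2).
  by rewrite tE; field; rewrite !gt_eqF.
by rewrite ler_pM2l.
Qed.

Lemma cvg_stack_kernel y : F n y @[n --> \oo] --> 2^-1 * expR (- y ^+ 2).
Proof.
have qX k : q n ^+ k.+1 @[n --> \oo] --> 0.
  have c : q n ^+ k.+1 @[n --> \oo] --> (0 : R) ^+ k.+1.
    by apply: (continuous_cvg _ (@exprn_continuous R k.+1 0)); exact: cvg_sadq.
  by rewrite expr0n/= in c.
have tail0 : tailp x (2 * N n) (q n ^+ 2) 0 @[n --> \oo] --> 0.
  have c : tailp x (2 * N n) (q n ^+ 2) 0 * expR (A / q n ^+ 2) * expR (- (A / q n ^+ 2))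
      @[n --> \oo] --> 2 * sin (pi * xx) * 0.
    by apply: cvgM; [exact: cvg_tailp|exact: cvg_expRN_inv_sadq].
  rewrite mulr0 in c; apply: cvg_trans c; apply: near_eq_cvg; near=> n.
  by rewrite /= -mulrA -expRD subrr expR0 mulr1.
have err : tailp x (2 * N n) (q n ^+ 2) 0 + expR m%:R *
   (m%:R * (2 * q n ^+ 2 + q n ^+ 3 * (`|y| / a)) + expR (- (A / q n ^+ 2))) +
  90 * (q n * (7 * `|y| / a) ^+ 3) @[n --> \oo] -->
  0 + expR m%:R * (m%:R * (2 * 0 + 0 * (`|y| / a)) + 0) + 90 * (0 * (7 * `|y| / a) ^+ 3).
  apply: cvgD; last by apply: cvgMr; apply: cvgMl; exact: cvg_sadq.
  apply: cvgD => //; apply: cvgMr; apply: cvgD; last exact: cvg_expRN_inv_sadq.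
  apply: cvgMr; apply: cvgD; first by apply: cvgMr; exact: qX.
  by apply: cvgMl; exact: qX.
rewrite !(mul0r, mulr0, addr0) in err.
have c0 : F n y - 2^-1 * h n y @[n --> \oo] --> 0.
  apply/cvgr0Pnorm_le => e e0; move/cvgr0Pnorm_le: err => /(_ e e0) err.
  apply: filterS2 err (stack_kernel_approx y) => n h1 h2.
  exact: le_trans h2 (le_trans (ler_norm _) h1).
have c1 : 2^-1 * h n y @[n --> \oo] --> 2^-1 * expR (- y ^+ 2).
  by apply: cvgMr; exact: cvg_gauss_factor.
have c2 : F n y - 2^-1 * h n y + 2^-1 * h n y @[n --> \oo] --> 0 + 2^-1 * expR (- y ^+ 2).
  exact: cvgD.
rewrite add0r in c2; apply: cvg_trans c2; apply: near_eq_cvg; near=> n.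
by rewrite /= subrK.
Unshelve. all: by end_near. Qed.

Lemma cvg_stack_integral :
  \int[lebesgue_measure]_(y in `[- (pi / l n), pi / l n]) F n y @[n --> \oo] -->
  2^-1 * Num.sqrt pi.
Proof.
have [K K0 [n0 _ hK]] := stack_kernel_dominated.
have hb : pi / l n @[n --> \oo] --> +oo.
  apply/cvgryPge => B; pose e := Num.min 1 (pi * a / (`|B| + 1)).
  have B1 : 0 < `|B| + 1 by rewrite ltr_wpDl.
  have e0 : 0 < e by rewrite lt_min ltr01/= divr_gt0// mulr_gt0// pi_gt0.
  apply: filterS (near_sadq e e0) => n [_ q0]; rewrite lt_min => /andP[q1 qB].
  have q30 : 0 < q n ^+ 3 by rewrite exprn_gt0.
  have -> : pi / l n = pi * a / q n ^+ 3 by rewrite /l invf_div mulrA.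
  have q3q : q n ^+ 3 <= q n.
    by rewrite exprS ler_piMr ?(ltW q0)// expr_le1// ltW.
  rewrite ler_pdivlMr//; apply: (@le_trans _ _ ((`|B| + 1) * q n ^+ 3)).
    by rewrite ler_pM2r//; have := ler_norm B; lra.
  apply: (@le_trans _ _ ((`|B| + 1) * q n)); first by rewrite ler_pM2l.
  by rewrite mulrC -ler_pdivlMr// ltW.
(* [cvg_integral_itv] asks for its hypotheses at every index, whereas the domination holds from n0
   on; the extra 1 keeps the index positive, hence q > 0. *)
have c : \int[lebesgue_measure]_(y in `[- (pi / l (n + n0.+1)), pi / l (n + n0.+1)])
      F (n + n0.+1)%N y @[n --> \oo] --> \int[lebesgue_measure]_y (2^-1 * gauss_fun y : R).
  apply: (@cvg_integral_itv R (fun n => pi / l (n + n0.+1)%N) (fun n => F (n + n0.+1)%N)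
    (fun y => 2^-1 * gauss_fun y) K K0).
  - by rewrite (@cvg_shiftn n0.+1 _ (fun n => pi / l n)).
  - move=> n; apply: continuous_stack_kernel => //.
    by rewrite exprn_gt0// sadq_gt0// addnS.
  - by move=> y; apply: cvgM; [exact: cvg_cst|exact: continuous_gauss_fun].
  - by move=> n y; apply: hK => /=; lia.
  - move=> y; rewrite (@cvg_shiftn n0.+1 _ (fun n => F n y)).
    exact: cvg_stack_kernel.
rewrite -(@cvg_shiftn n0.+1).
move: c; rewrite RintegralZl//; last exact: integrableT_gauss.
by rewrite {2}/Rintegral integralT_gauss.
Qed.

Let T n := tailp x (2 * N n) (q n ^+ 2) 0 * expR (A / q n ^+ 2).
Let I n := \int[lebesgue_measure]_(y in `[- (pi / l n), pi / l n]) F n y.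
Let w n : R := 3 `^ (1 / 4) * m%:R `^ (1 / 4) * n%:R `^ (3 / 4).

Lemma powR_quarter (z : R) k : 0 <= z -> (z `^ (k%:R / 4)) ^+ 4 = z ^+ k.
Proof.
move=> z0; rewrite -powR_mulrn ?powR_ge0// -powRrM.
by rewrite (_ : k%:R / 4 * 4%:R = k%:R) ?powR_mulrn//; field.
Qed.

(** Fourth powers remove all roots: l ^ 4 = A / n ^ 3, and the claim becomes 3 m A pi ^ 2 = pi ^
    4. *)
Lemma scaleE n : (0 < n)%N -> l n * Num.sqrt pi * w n = pi.
Proof.
move=> n0; have q0 := sadq_gt0 n n0; have nR : 0 < n%:R :> R by rewrite ltr0n.
have l0 : 0 < l n by apply: divr_gt0 => //; exact: exprn_gt0.
have w0 : 0 <= w n by rewrite /w !mulr_ge0 ?powR_ge0.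
apply/eqP; rewrite -(@eqrXn2 _ 4)// ?pi_ge0//; last first.
  by rewrite mulr_ge0// mulr_ge0 ?sqrtr_ge0// ltW.
have e4 (u v z : R) : (u * v * z) ^+ 4 = u ^+ 4 * v ^+ 4 * z ^+ 4 by ring.
rewrite e4.
have -> : w n ^+ 4 = 3 * m%:R * n%:R ^+ 3.
  rewrite /w !exprMn -[1 / 4]/(1%:R / 4) !powR_quarter// ?expr1//.
have -> : Num.sqrt pi ^+ 4 = pi ^+ 2 :> R by rewrite (exprM _ 2 2) sqr_sqrtr ?pi_ge0.
have -> : l n ^+ 4 = A / n%:R ^+ 3.
  have -> : l n ^+ 4 = (q n ^+ 4) ^+ 3 / (a ^+ 2) ^+ 2.
    by rewrite /l; field; rewrite gt_eqF.
  by rewrite sadq4 a2; field; rewrite !gt_eqF.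
rewrite /A; move: (pi : R) => p; apply/eqP; field.
by rewrite !gt_eqF.
Qed.

(** One copy of A / q ^ 2 comes from |q| ^ (- n), the other from [tailp]. *)
Lemma exponentE n : (0 < n)%N ->
  2 * pi * Num.sqrt (n%:R / (3 * m%:R)) = 2 * (A / q n ^+ 2) :> R.
Proof.
move=> n0; have q0 := sadq_gt0 n n0; have nR : 0 < n%:R :> R by rewrite ltr0n.
have -> : n%:R / (3 * m%:R) = (A / (pi * q n ^+ 2)) ^+ 2 :> R.
  have -> : (A / (pi * q n ^+ 2)) ^+ 2 = A ^+ 2 / (pi ^+ 2 * q n ^+ 4).
    by have := @pi_gt0 R; move: (pi : R) => p p0; field; rewrite !gt_eqF.
  rewrite sadq4 /A; have := @pi_gt0 R; move: (pi : R) => p p0; field.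
  by rewrite !gt_eqF.
rewrite sqrtr_sqr ger0_norm; last first.
  by apply: divr_ge0; [exact: ltW|rewrite mulr_ge0 ?pi_ge0 ?exprn_ge0// ltW].
by have := @pi_gt0 R; move: (pi : R) => p p0; field; rewrite !gt_eqF.
Qed.

(** An exact identity: [I n] and [T n] appear divided by, respectively into, their limits, so that
    the last factor tends to 1. The 2 ^ 3 collects the period 2 pi / l, the 1/2 from the parity of
    the peak index and the 2 of 2 sin. *)
Lemma num_stacks_ratio n : (0 < n)%N ->
  (num_mixed_congruence_stacks r m n)%:R =
  csc (pi * r%:R / m%:R) / (2 ^+ 3 * 3 `^ (1 / 4) * m%:R `^ (1 / 4) * n%:R `^ (3 / 4)) *
    expR (2 * pi * Num.sqrt (n%:R / (3 * m%:R))) *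
  (I n / (2^-1 * Num.sqrt pi) * (2 * sin (pi * xx) / T n)).
Proof.
move=> n0; have q0 := sadq_gt0 n n0; have s0 : 0 < q n ^+ 2 by rewrite exprn_gt0.
have l0 : 0 < l n by apply: divr_gt0 => //; exact: exprn_gt0.
have [nN _ _] := N_spec n n0.
have := num_stacks_integral r m r_gt0 r_lt n (N n) (q n ^+ 2) (l n) s0 l0 nN.
rewrite -/(I n) rpow_sadq// expRN => <-.
rewrite exponentE// expRM_natl.
have -> : 2 ^+ 3 * 3 `^ (1 / 4) * m%:R `^ (1 / 4) * n%:R `^ (3 / 4) = 2 ^+ 3 * w n.
  by rewrite /w !mulrA.
have wE : w n = pi / (l n * Num.sqrt pi).
  rewrite -[X in X / _](scaleE n n0) mulrC mulKf// mulf_neq0 ?gt_eqF// sqrtr_gt0 pi_gt0//.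
rewrite wE /T /csc -mulrA.
have E0 := expR_gt0 (A / q n ^+ 2).
have t0 := tailp_gt0 x (2 * N n) (q n ^+ 2) x_gt0 s0 0.
have p0 : 0 < Num.sqrt pi :> R by rewrite sqrtr_gt0 pi_gt0.
have pp := @pi_gt0 R.
have sn : sin (pi * xx) != 0 by rewrite gt_eqF// sin_pi_ratio_gt0.
rewrite -(mulrA pi).
move: (pi : R) (tailp _ _ _ _) (expR _) (Num.sqrt pi) (sin _) (l n)
  (num_mixed_congruence_stacks _ _ _)%:R t0 E0 p0 sn l0 pp
  => pii t E p sn ln S t0 E0 p0 sn0 l0 pp.
by field; rewrite sn0 !gt_eqF.
Qed.

Lemma num_stacks_equiv :
  (fun n : nat => (num_mixed_congruence_stacks r m n)%:R : R) ~_\oo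
  (fun n : nat =>
     csc (pi * r%:R / m%:R)
       / (2 ^+ 3 * 3 `^ (1 / 4) * m%:R `^ (1 / 4) * n%:R `^ (3 / 4))
     * expR (2 * pi * Num.sqrt (n%:R / (3 * m%:R))) : R).
Proof.
have sn : 0 < 2 * sin (pi * xx) by rewrite mulr_gt0// sin_pi_ratio_gt0.
have c : I n / (2^-1 * Num.sqrt pi) * (2 * sin (pi * xx) / T n) @[n --> \oo] -->
    (2^-1 * Num.sqrt pi / (2^-1 * Num.sqrt pi) * (2 * sin (pi * xx) / (2 * sin (pi * xx))) : R).
  apply: cvgM; first by apply: cvgMl; exact: cvg_stack_integral.
  by apply: cvgMr; apply: cvgV; [rewrite gt_eqF|exact: cvg_tailp].
have p0 : 0 < Num.sqrt pi :> R by rewrite sqrtr_gt0 pi_gt0.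
have p1 : 2^-1 * Num.sqrt pi != 0 :> R by rewrite gt_eqF// mulr_gt0.
have s1 : 2 * sin (pi * xx) != 0 by rewrite gt_eqF.
rewrite (divff p1) (divff s1) mulr1 in c.
apply/eqaddoP => e e0; move/cvgrPdist_le: c => /(_ e e0) c.
near=> n; have n0 : (0 < n)%N by near: n; exact: nbhs_infty_gt.
rewrite !fctE num_stacks_ratio// -[X in `|_ - X|]mulr1 -mulrBr normrM mulrC.
rewrite ler_wpM2r// distrC; near: n; exact: c.
Unshelve. all: by end_near. Qed.

End SaddlePoint.

Theorem theorem1 (R : realType) (m r : nat) (m_gt1 : (1 < m)%N)
    (coprime_rm : coprime r m) (r_gt0 : (0 < r)%N) (r_lt : (2 * r < m)%N) :
  (fun n : nat => (num_mixed_congruence_stacks r m n)%:R : R) ~_\oo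
  (fun n : nat =>
     csc (pi * r%:R / m%:R)
       / (2 ^+ 3 * 3 `^ (1 / 4) * m%:R `^ (1 / 4) * n%:R `^ (3 / 4))
     * expR (2 * pi * Num.sqrt (n%:R / (3 * m%:R))) : R).
Proof.
have [N hN] := @saddle_cutoff R r m r_gt0 r_lt.
exact: (num_stacks_equiv r m coprime_rm r_gt0 r_lt N hN).
Qed.
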